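(* Let $\mathcal{K}_{geod}$, $\mathcal{K}_{horo}$ and $\mathcal{K}_{hyper}$ be the graphs of geodesics, horocycles and hypercycles in $\mathbb{H}^2$, respectively. \begin{itemize} \item The natural injection $i:\mathrm{Homeo}(\mathbb{S}^1)\to\mathrm{Aut}(\mathcal{K}_{geod})$, which sends $f$ to the automorphism mapping the geodesic with endpoints $\{x,y\}$ to the geodesic with endpoints $\{f(x),f(y)\}$, is an isomorphism. In other words, every automorphism of $\mathcal{K}_{geod}$ is induced by a link-preserving homeomorphism of $\mathbb{S}^1$. \item The natural injection $i:\mathrm{Isom}(\mathbb{H}^2)\to\mathrm{Aut}(\mathcal{K}_{horo})$, $\varphi\mapsto(h\mapsto\varphi(h))$, is an isomorphism; likewise the natural injection $\mathrm{Isom}(\mathbb{H}^2)\to\mathrm{Aut}(\mathcal{K}_{hyper})$, $\varphi\mapsto(h\mapsto\varphi(h))$, is an isomorphism. \end{itemize}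
   Context: $\mathbb{H}^2=\{z\in\mathbb{C}:\mathrm{Im}(z)>0\}$ is the hyperbolic plane, with boundary $\partial\mathbb{H}^2=\mathbb{R}\cup\{\infty\}$ identified with the circle $\mathbb{S}^1$. A geodesic is determined by its two distinct endpoints in $\mathbb{S}^1$. A horocycle is a Euclidean circle tangent to $\mathbb{R}$ with the tangency point removed, or a horizontal line in $\mathbb{H}^2$. A hypercycle is the intersection with $\mathbb{H}^2$ of either a Euclidean circle crossing $\mathbb{R}$ at two points and not orthogonal to $\mathbb{R}$, or a Euclidean line that is neither vertical nor horizontal (equivalently, a complete curve of constant geodesic curvature in $(0,1)$; geodesics are not hypercycles). $\mathcal{K}_{geod}$ (respectively $\mathcal{K}_{horo}$, $\mathcal{K}_{hyper}$) is the simple graph whose vertices are all geodesics (respectively horocycles, hypercycles) of $\mathbb{H}^2$, two distinct vertices being joined by an edge if and only if the corresponding curves are disjoint in $\mathbb{H}^2$. (In particular, distinct curves that meet only at points of $\partial\mathbb{H}^2$ are disjoint.) $\mathrm{Aut}(\cdot)$ denotes the group of graph automorphisms, $\mathrm{Homeo}(\mathbb{S}^1)$ the group of all homeomorphisms of $\mathbb{S}^1$, and $\mathrm{Isom}(\mathbb{H}^2)$ the group of all isometries (orientation-preserving or reversing). For four different points $t,x,y,z\in\mathbb{S}^1$, the sets $\{t,x\}$ and $\{y,z\}$ are linked if $y$ and $z$ lie in different components of $\mathbb{S}^1-\{t,x\}$; a map $\mathbb{S}^1\to\mathbb{S}^1$ is link-preserving if it sends linked sets to linked sets. *)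

(* Defs.v *)
From HB Require Import structures.
From mathcomp Require Import all_boot all_order all_algebra.
From mathcomp Require Import all_classical all_reals all_analysis.
From mathcomp Require Import complex.

Set Implicit Arguments.
Unset Strict Implicit.
Unset Printing Implicit Defensive.

Import Order.TTheory GRing.Theory Num.Theory.
Import numFieldNormedType.Exports.

Local Open Scope classical_set_scope.
Local Open Scope ring_scope.
Local Open Scope complex_scope.

(** The inverse is stored as data, but it is determined by the forward map
    (see [symm_eq]), so that equality of symmetries is equality of maps. *)
Record symm (T : Type) := Symm {
  symm_fun :> T -> T;
  symm_inv : T -> T;
  symm_funK : cancel symm_fun symm_inv;
  symm_invK : cancel symm_inv symm_fun }.

Lemma symm_eq (T : Type) (f g : symm T) : f =1 g -> f = g.
Proof.
case: f g => [f f' fK f'K] [g g' gK g'K] /= /funext fg.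
have f'g' : f' = g' by apply/funext => x; rewrite -{1}(g'K x) -fg fK.
by subst g g'; congr Symm; exact: Prop_irrelevance.
Qed.

Section SymmGroup.
Variable T : Type.

HB.instance Definition _ := gen_eqMixin (symm T).
HB.instance Definition _ := gen_choiceMixin (symm T).

Definition symm1 : symm T :=
  @Symm T id id (fun=> erefl) (fun=> erefl).
Definition symmV (f : symm T) : symm T :=
  Symm (@symm_invK T f) (@symm_funK T f).
Definition symmM (f g : symm T) : symm T :=
  Symm (can_comp (@symm_funK T f) (@symm_funK T g))
       (can_comp (@symm_invK T g) (@symm_invK T f)).

Lemma symmA : associative symmM. Proof. by move=> f g h; exact: symm_eq. Qed.
Lemma symm1M : left_id symm1 symmM. Proof. by move=> f; exact: symm_eq. Qed.
Lemma symmM1 : right_id symm1 symmM. Proof. by move=> f; exact: symm_eq. Qed.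
Lemma symmVM : left_inverse symm1 symmV symmM.
Proof. by move=> f; apply: symm_eq => x /=; rewrite symm_funK. Qed.
Lemma symmMV : right_inverse symm1 symmV symmM.
Proof. by move=> f; apply: symm_eq => x /=; rewrite symm_invK. Qed.

HB.instance Definition _ :=
  isGroup.Build (symm T) symmA symm1M symmM1 symmVM symmMV.

End SymmGroup.

Lemma symm_group_closed (T : Type) (A : set (symm T)) :
  A (symm1 T) -> (forall f, A f -> A (symmV f)) ->
  (forall f g, A f -> A g -> A (symmM f g)) ->
  @group_closed (symm T) (fun f => f \in A).
Proof.
move=> A1 AV AM; split; first exact/mem_set.
move=> f g /set_mem Af /set_mem Ag; apply/mem_set.
by apply: (AM f (symmV g)) => //; exact: AV.
Qed.

Section Homeo.
Variable T : topologicalType.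

Definition homeos : set (symm T) :=
  [set f | continuous (symm_fun f) /\ continuous (symm_inv f)].

Definition Homeo : Type := {f : symm T | f \in homeos}.

Lemma homeos_group_closed : @group_closed (symm T) (fun f => f \in homeos).
Proof.
apply: symm_group_closed => [|f [cf cV]|f g [cf fV] [cg gV]]; split => //=;
  try by move=> x; apply: cvg_id.
- by move=> x; apply: continuous_comp; [exact: cg|exact: cf].
- by move=> x; apply: continuous_comp; [exact: fV|exact: gV].
Qed.

HB.instance Definition _ := SubChoice.on Homeo.
HB.instance Definition _ :=
  SubChoice_isSubGroup.Build (symm T) (fun f => f \in homeos) Homeo
    homeos_group_closed.

End Homeo.

Record graph := Graph {
  vertex : Type;
  adj : vertex -> vertex -> Prop;
  adj_sym : forall u v, adj u v -> adj v u;
  adj_irr : forall u, ~ adj u u }.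

Section Aut.
Variable G : graph.

Definition auts : set (symm (vertex G)) :=
  [set a | forall u v, adj u v <-> adj (symm_fun a u) (symm_fun a v)].

Definition Aut : Type := {a : symm (vertex G) | a \in auts}.

Lemma auts_group_closed :
  @group_closed (symm (vertex G)) (fun a => a \in auts).
Proof.
apply: symm_group_closed => [|a aP|a b aP bP] u v //=.
- by rewrite (aP (symm_inv a u)) !symm_invK.
- by rewrite bP aP.
Qed.

HB.instance Definition _ := SubChoice.on Aut.
HB.instance Definition _ :=
  SubChoice_isSubGroup.Build (symm (vertex G)) (fun a => a \in auts) Aut
    auts_group_closed.

End Aut.

Section DisjointnessGraph.
Variables (T : Type) (C : set (set T)).

Definition disj (c d : {c : set T | c \in C}) : Prop :=
  c <> d /\ val c `&` val d = set0.

Lemma disj_sym c d : disj c d -> disj d c.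
Proof. by move=> [cd cd0]; split; [exact: nesym|rewrite setIC]. Qed.

Lemma disj_irr c : ~ disj c c. Proof. by case. Qed.

Definition disj_graph : graph := Graph disj_sym disj_irr.

End DisjointnessGraph.

Section Circle.
Variable R : realType.

(** The circle at infinity, [None] being the point at infinity. *)
Definition S1 : topologicalType := one_point_compactification R.

Definition linked (t x y z : S1) : Prop :=
  uniq [:: t; x; y; z] /\ ~ connected_component (~` [set t; x]) y z.

Definition link_preserving (f : S1 -> S1) : Prop :=
  forall t x y z, linked t x y z -> linked (f t) (f x) (f y) (f z).

End Circle.

Section HyperbolicPlane.
Variable R : realType.

Definition H2 : Type := {z : R[i] | 0 < complex.Im z}.

Definition cabs (z : R[i]) : R := ComplexField.Normc.normc z.

Definition arcosh (t : R) : R := ln (t + Num.sqrt (t ^+ 2 - 1)).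

Definition hdist (z w : H2) : R :=
  arcosh (1 + cabs (val z - val w) ^+ 2 /
              (2 * complex.Im (val z) * complex.Im (val w))).

Definition isoms : set (symm H2) :=
  [set phi | forall z w, hdist (symm_fun phi z) (symm_fun phi w) = hdist z w].

Definition Isom : Type := {phi : symm H2 | phi \in isoms}.

Lemma isoms_group_closed : @group_closed (symm H2) (fun f => f \in isoms).
Proof.
apply: symm_group_closed => [|f fP|f g fP gP] z w //=.
- by rewrite -fP !symm_invK.
- by rewrite fP gP.
Qed.

HB.instance Definition _ := SubChoice.on Isom.
HB.instance Definition _ :=
  SubChoice_isSubGroup.Build (symm H2) (fun f => f \in isoms) Isom
    isoms_group_closed.

Definition circle (c : R[i]) (r : R) : set R[i] := [set z | cabs (z - c) = r].

Definition line (a b k : R) : set R[i] :=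
  [set z | a * complex.Re z + b * complex.Im z = k].

Definition trace (E : set R[i]) : set H2 := [set z | E (val z)].

(** The semicircle with Euclidean diameter [a, b], or a vertical half-line;
    only meaningful for distinct endpoints (it is empty when [x = y]). *)
Definition geodesic (x y : S1 R) : set H2 :=
  match x, y with
  | Some a, Some b => trace (circle (((a + b) / 2) +i* 0) (`|b - a| / 2))
  | Some a, None | None, Some a => trace (line 1 0 a)
  | None, None => set0
  end.

Definition geodesics : set (set H2) :=
  [set g | exists x y, x <> y /\ g = geodesic x y].

(** The circle of centre [a + ir] and radius [r] is tangent to the real line
    at [a], a point which [trace] removes. *)
Definition horocycles : set (set H2) :=
  [set h | (exists a r, 0 < r /\ h = trace (circle (a +i* r) r)) \/
           (exists k, 0 < k /\ h = trace (line 0 1 k))].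

(** A circle of centre [c] and radius [r] meets the real line in two points
    iff [`|Im c| < r], and is orthogonal to it iff [Im c = 0]. *)
Definition hypercycles : set (set H2) :=
  [set h | (exists c r, [/\ `|complex.Im c| < r, complex.Im c <> 0 &
                            h = trace (circle c r)]) \/
           (exists a b k, [/\ a <> 0, b <> 0 & h = trace (line a b k)])].

Definition K_geod : graph := disj_graph geodesics.
Definition K_horo : graph := disj_graph horocycles.
Definition K_hyper : graph := disj_graph hypercycles.

End HyperbolicPlane.

(* Main.v *)
Require Import Defs.
From HB Require Import structures.
From mathcomp Require Import all_boot all_order all_algebra.
From mathcomp Require Import all_classical all_reals all_analysis.
From mathcomp Require Import complex ring lra.

Set Implicit Arguments.
Unset Strict Implicit.
Unset Printing Implicit Defensive.

Import Order.TTheory GRing.Theory Num.Theory.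
Import numFieldNormedType.Exports.

Local Open Scope classical_set_scope.
Local Open Scope ring_scope.

(** In all three cases the graph determines the boundary circle together with
    its linked pairs, and for horocycles and hypercycles also enough metric
    information to single out the Möbius transformations.

    Geodesics.  Two geodesics meet when their pairs of endpoints are linked,
    that is, have negative cross-ratio ([cross]).  Two disjoint geodesics share
    an endpoint unless some pair of crossing geodesics is met by every geodesic
    that meets both ([asymptotic_common]), and three geodesics that pairwise
    share an endpoint have a common one, or form an ideal triangle, according to
    whether some geodesic meets all three ([pencil_transversal],
    [triangle_no_transversal]).  So an automorphism permutes the pencils of
    geodesics from a point of the circle: it comes from a bijection of the circle
    that preserves linked pairs ([circle_map]).  Such a bijection permutes the
    open arcs, hence is a homeomorphism; conversely homeomorphisms preserve linked
    pairs because these are characterized by connectedness ([linked_cross]).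

    Horocycles and hypercycles.  The group generated by affine maps and an
    inversion is transitive on triples of points of the circle
    ([moebius_normalize]) and contains all isometries ([isometry_moebius]).
    Therefore it suffices to see that an automorphism is trivial once the map it
    induces on the circle fixes infinity, 0 and 1.

    For horocycles, inclusion of the sets of neighbours detects common centres
    and the order of concentric horocycles ([inside_center]), and from these
    tangency is defined.  Tangency with the horocycles at infinity shows that the
    diameters are changed by one increasing function, and tangency between
    horocycles of equal diameter that the distances of the centres are changed by
    the same function.  It is additive, hence the identity
    ([normalized_horo_id]).

    For hypercycles, two disjoint ones have the same endpoints exactly when no
    third one forms with them a triple in which none separates the others
    ([same_ends_no_tripod], [tripod_exists]).  So an automorphism permutes the
    classes of hypercycles with common endpoints, which are the geodesics, and
    the first part gives a circle map ([hyper_circle_map]).  After normalization,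
    the conditions for Euclidean lines and circles to be disjoint show that all
    angle parameters are changed by a single odd increasing function and that the
    circle map preserves the equality of ratios of adjacent segments of the line;
    so both are trivial ([normalized_hyper_id], [ratio_rigid]). *)

(** * Coordinates, boundary points and Möbius transformations *)
Section Coordinates.
Variable R : realType.
Implicit Types (z w : H2 R) (p q r s : S1 R).

Definition re z : R := complex.Re (val z).
Definition im z : R := complex.Im (val z).

Lemma im_gt0 z : 0 < im z. Proof. exact: (valP z). Qed.

Definition mkH2 (x y : R) (y_gt0 : 0 < y) : H2 R :=
  exist (fun z : R[i] => 0 < complex.Im z) (x +i* y)%C y_gt0.

Lemma re_mk x y (h : 0 < y) : re (mkH2 x h) = x. Proof. by []. Qed.
Lemma im_mk x y (h : 0 < y) : im (mkH2 x h) = y. Proof. by []. Qed.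

Lemma H2_eq z w : re z = re w -> im z = im w -> z = w.
Proof.
case: z w => [[x y] hz] [[x' y'] hw]; rewrite /re /im /= => -> E.
by apply: val_inj => /=; rewrite E.
Qed.

(** The distance d enters only through [delta], which is 2 cosh d - 2 and,
    unlike d, a rational function of the coordinates. *)
Definition delta z w : R :=
  ((re z - re w) ^+ 2 + (im z - im w) ^+ 2) / (im z * im w).

Lemma arcosh_inj : {in [pred t : R | 1 <= t] &, injective (@arcosh R)}.
Proof.
(* the inverse of arcosh on [1, +oo[ is cosh *)
suff arcoshK (t : R) : 1 <= t ->
    (expR (arcosh t) + (expR (arcosh t))^-1) / 2 = t.
  by move=> t u t1 u1 tu; rewrite -(arcoshK t)// -(arcoshK u)// tu.
move=> t1; have sq : 0 <= t ^+ 2 - 1 by rewrite subr_ge0 exprn_ege1.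
have s0 := sqrtr_ge0 (t ^+ 2 - 1).
have E := sqr_sqrtr sq.
rewrite /arcosh lnK; last by rewrite posrE; lra.
move: s0 E; set u := Num.sqrt _ => s0 E.
have n0 : t + u != 0 by apply: lt0r_neq0; lra.
apply: (mulIf n0); apply: (mulIf (x := 2)) => //.
rewrite (_ : (t + u + (t + u)^-1) / 2 * (t + u) * 2 = (t + u) ^+ 2 + 1); last first.
  by field; rewrite n0.
rewrite (_ : (t + u) ^+ 2 = t ^+ 2 + 2 * t * u + u ^+ 2); last by ring.
by rewrite E; ring.
Qed.

Lemma delta_ge0 z w : 0 <= delta z w.
Proof.
by rewrite divr_ge0 ?addr_ge0 ?sqr_ge0// mulr_ge0// ltW// im_gt0.
Qed.

Lemma hdistE z w : hdist z w = arcosh (1 + delta z w / 2).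
Proof.
rewrite /hdist /delta /re /im /cabs; case: z w => [[x y] hz] [[x' y'] hw] /=.
rewrite sqr_sqrtr ?addr_ge0 ?sqr_ge0//; congr (arcosh (1 + _)).
by field; rewrite !gt_eqF.
Qed.

Lemma hdist_eq z w z' w' :
  (hdist z w = hdist z' w') <-> (delta z w = delta z' w').
Proof.
rewrite !hdistE; split=> [|-> //].
have H a b : 1 + delta a b / 2 \in [pred t : R | 1 <= t].
  by rewrite inE lerDl divr_ge0// delta_ge0.
by move/(arcosh_inj (H _ _) (H _ _)); lra.
Qed.

(** The horocycles centred at [p]: [k] is the Euclidean diameter when [p] is
    finite, the height when [p] is at infinity. *)
Definition horo p (k : R) : set (H2 R) := [set z |
  if p is Some a then (re z - a) ^+ 2 + im z ^+ 2 = k * im z else im z = k].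

(** By the inscribed angle theorem, the circle arcs through [u < v] are the
    sets of points from which the segment between [u] and [v] is seen under a
    constant angle; [t] is the cotangent of this angle.  The same equation,
    divided by an endpoint that tends to infinity, gives the lines.  Thus [t = 0]
    is the geodesic, the other values give all hypercycles with endpoints [p]
    and [q], and exchanging [p] and [q] changes the sign of [t]. *)
Definition hyper p q (t : R) : set (H2 R) := [set z |
  match p, q with
  | Some u, Some v =>
      (re z - u) * (re z - v) + im z ^+ 2 = (v - u) * t * im z
  | Some u, None => re z - u = - t * im z
  | None, Some u => re z - u = t * im z
  | None, None => False
  end].

(** The determinant of the homogeneous coordinates, [(1, a)] for [Some a] and
    [(0, 1)] for [None]. *)
Definition det p q : R :=
  match p, q with
  | Some a, Some b => b - a
  | Some _, None => 1
  | None, Some _ => -1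
  | None, None => 0
  end.

(** The cross-ratio of the four points is negative, that is, the pairs are
    linked.  Every point occurs twice in the product, so that its sign does not
    depend on the choice of homogeneous coordinates. *)
Definition cross p q r s : Prop :=
  det p r * det p s * (det q r * det q s) < 0.

Lemma hyperC p q t : hyper p q t = hyper q p (- t).
Proof.
by apply/seteqP; split=> z; case: p q => [u|] [v|] //=; rewrite ?opprK// => E;
  rewrite mulrC E; ring.
Qed.

Lemma cross_swapl p q r s : cross p q r s <-> cross q p r s.
Proof. by rewrite /cross mulrC. Qed.

Lemma cross_swapr p q r s : cross p q r s <-> cross p q s r.
Proof. by rewrite /cross [det p r * _]mulrC [det q r * _]mulrC. Qed.

Lemma detC p q : det p q = - det q p.
Proof. by case: p q => [a|] [b|] /=; rewrite ?opprB ?opprK ?oppr0. Qed.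

Lemma cross_sym p q r s : cross p q r s <-> cross r s p q.
Proof.
rewrite /cross (detC p r) (detC p s) (detC q r) (detC q s).
by rewrite (_ : _ * _ * _ = det r p * det r q * (det s p * det s q)) //; ring.
Qed.

Lemma det_eq0 p q : det p q = 0 <-> p = q.
Proof.
case: p q => [a|] [b|] //=; split=> //; try by move/eqP; rewrite ?oppr_eq0 oner_eq0.
  by move/eqP; rewrite subr_eq0 => /eqP ->.
by case=> ->; rewrite subrr.
Qed.

(** What is used of a Möbius transformation [phi], or of its composite with a
    reflection, and of its extension [m] to the circle.  Only the square of the
    angle parameter of a hypercycle is kept, because reflections change its
    sign.  Affine maps and the inversion in the unit circle have these
    properties by computation, and they generate the whole group. *)
Record moebius (phi : symm (H2 R)) (m : symm (S1 R)) : Prop := Moebius {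
  moebius_delta : forall z w, delta (phi z) (phi w) = delta z w;
  moebius_cross : forall p q r s,
    cross (m p) (m q) (m r) (m s) <-> cross p q r s;
  moebius_horo : forall p k, 0 < k ->
    exists2 l, 0 < l & forall z, horo p k z <-> horo (m p) l (phi z);
  moebius_hyper : forall p q t, p <> q ->
    exists2 u, u ^+ 2 = t ^+ 2 &
      forall z, hyper p q t z <-> hyper (m p) (m q) u (phi z) }.

Lemma symm_inj (T : Type) (f : symm T) : injective f.
Proof. exact: can_inj (@symm_funK T f). Qed.

Lemma moebius1 : moebius (symm1 _) (symm1 _).
Proof. by split=> // [p k k0|p q t _]; [exists k|exists t]. Qed.

Lemma moebiusM phi psi m n : moebius phi m -> moebius psi n ->
  moebius (symmM phi psi) (symmM m n).
Proof.
move=> [d c ho hy] [d' c' ho' hy']; split=> /= [z w|p q r s|p k k0|p q t pq].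
- by rewrite d d'.
- by rewrite c c'.
- have [l l0 E] := ho' p k k0; have [l' l'0 E'] := ho (n p) l l0.
  by exists l' => // z; rewrite E E'.
- have [u u2 E] := hy' p q t pq.
  have [//|v v2 E'] := hy (n p) (n q) u; first by move/(@symm_inj _ n).
  by exists v => [|z]; rewrite ?E ?E'// v2.
Qed.

Lemma norm_im_gt0 (a : R) (ha : a != 0) z : 0 < `|a| * im z.
Proof. by rewrite mulr_gt0 ?normr_gt0 ?im_gt0. Qed.

Definition affineH (a b : R) (ha : a != 0) z : H2 R :=
  mkH2 (a * re z + b) (norm_im_gt0 ha z).

Definition affineS (a b : R) p : S1 R :=
  if p is Some x then Some (a * x + b) else None.

Lemma affineHK a b (ha : a != 0) (ha' : a^-1 != 0) :
  cancel (affineH b ha) (affineH (- (b / a)) ha').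
Proof.
move=> z; apply: H2_eq; rewrite /= ?re_mk ?im_mk; first by field.
by rewrite normfV mulrA mulVf ?mul1r// normr_eq0.
Qed.

Lemma affineHK' a b (ha : a != 0) (ha' : a^-1 != 0) :
  cancel (affineH (- (b / a)) ha') (affineH b ha).
Proof.
move=> z; apply: H2_eq; rewrite /= ?re_mk ?im_mk; first by field.
by rewrite normfV mulrA mulfV ?mul1r// normr_eq0.
Qed.

Lemma affineSK a b : a != 0 -> cancel (affineS a b) (affineS a^-1 (- (b / a))).
Proof. by move=> ha [x|] //=; congr Some; field. Qed.

Lemma affineSK' a b : a != 0 -> cancel (affineS a^-1 (- (b / a))) (affineS a b).
Proof. by move=> ha [x|] //=; congr Some; field. Qed.

Definition affine_H2 a b (ha : a != 0) : symm (H2 R) :=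
  Symm (affineHK b ha (invr_neq0 ha)) (affineHK' b ha (invr_neq0 ha)).
Definition affine_S1 a b (ha : a != 0) : symm (S1 R) :=
  Symm (affineSK b ha) (affineSK' b ha).

Lemma moebius_affine a b (ha : a != 0) : moebius (affine_H2 b ha) (affine_S1 b ha).
Proof.
have na : `|a| != 0 by rewrite normr_eq0.
have na0 : 0 < `|a| by rewrite normr_gt0.
have a2 : `|a| ^+ 2 = a ^+ 2 by rewrite -normrX ger0_norm// sqr_ge0.
have a20 : 0 < a ^+ 2 by rewrite lt_def sqrf_eq0 ha sqr_ge0.
split=> /= [z w|p q r s|p k k0|p q t pq].
- rewrite /delta !re_mk !im_mk.
  have := im_gt0 z; have := im_gt0 w => w0 z0.
  rewrite (_ : (_ - _) ^+ 2 + _ =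
    a ^+ 2 * (re z - re w) ^+ 2 + `|a| ^+ 2 * (im z - im w) ^+ 2); last by ring.
  rewrite a2 -mulrDr -[in RHS](@mulfK _ (a ^+ 2) _ ((re z - re w) ^+ 2 + _)) ?gt_eqF//.
  by rewrite -a2; field; rewrite !gt_eqF.
- rewrite /cross.
  have H (x y : R) : (exists2 c : R, 0 < c & x = c * y) -> x < 0 <-> y < 0.
    by case=> c c0 ->; rewrite pmulr_rlt0.
  apply: H; have a40 := mulr_gt0 a20 a20.
  case: p q r s => [p|] [q|] [r|] [s|] /=;
    do [ by exists (a ^+ 2 * a ^+ 2) => //; ring
       | by exists (a ^+ 2) => //; ring
       | by exists 1 => //; ring ].
- case: p => [x|] /=.
  + exists (`|a| * k); first exact: mulr_gt0.
    move=> z; rewrite !re_mk !im_mk.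
    rewrite (_ : _ + (`|a| * _) ^+ 2 = `|a| ^+ 2 * ((re z - x) ^+ 2 + im z ^+ 2)); last first.
      by rewrite [RHS]mulrDr {1}a2; ring.
    rewrite (_ : `|a| * k * _ = `|a| ^+ 2 * (k * im z)); last by ring.
    split=> [->//|/mulfI]; apply; exact: expf_neq0.
  + exists (`|a| * k); first exact: mulr_gt0.
    by move=> z; rewrite !im_mk; split=> [->//|/mulfI->].
- exists (Num.sg a * t); first by rewrite exprMn sqr_sg ha mul1r.
  have sa : Num.sg a * `|a| = a by rewrite mulr_sg_norm.
  move=> z; case: p q {pq} => [u|] [v|] //=; rewrite !re_mk !im_mk.
  + rewrite (_ : _ + (`|a| * _) ^+ 2 = a ^+ 2 * ((re z - u) * (re z - v) + im z ^+ 2)); last first.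
      by rewrite exprMn a2; ring.
    rewrite (_ : _ * (`|a| * _) = a ^+ 2 * ((v - u) * t * im z)); last first.
      by transitivity (a * (v - u) * t * im z * (Num.sg a * `|a|)); [ring|rewrite sa; ring].
    split=> [->//|/mulfI]; apply; exact: expf_neq0.
  + rewrite (_ : a * re z + b - _ = a * (re z - u)); last by ring.
    rewrite (_ : _ * (`|a| * _) = a * (- t * im z)); last first.
      by transitivity (- t * im z * (Num.sg a * `|a|)); [ring|rewrite sa; ring].
    by split=> [->//|/mulfI->].
  + rewrite (_ : a * re z + b - _ = a * (re z - v)); last by ring.
    rewrite (_ : _ * (`|a| * _) = a * (t * im z)); last first.
      by transitivity (t * im z * (Num.sg a * `|a|)); [ring|rewrite sa; ring].
    by split=> [->//|/mulfI->].
Qed.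

Lemma eq_scale (x y x' y' c : R) :
  c != 0 -> x' = x * c -> y' = y * c -> (x = y) <-> (x' = y').
Proof. by move=> c0 -> ->; split=> [->//|/mulIf->]. Qed.

Definition mod2 z : R := re z ^+ 2 + im z ^+ 2.

Lemma mod2_gt0 z : 0 < mod2 z.
Proof. by rewrite ltr_wpDl ?sqr_ge0// exprn_gt0// im_gt0. Qed.

Lemma im_inv_gt0 z : 0 < im z / mod2 z.
Proof. by rewrite divr_gt0 ?im_gt0 ?mod2_gt0. Qed.

Definition inversionH z : H2 R := mkH2 (re z / mod2 z) (im_inv_gt0 z).

Definition inversionS p : S1 R :=
  if p is Some x then if x == 0 then None else Some x^-1 else Some 0.

Lemma inversionHK : involutive inversionH.
Proof.
move=> z; have m0 := mod2_gt0 z.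
have E : mod2 (inversionH z) = (mod2 z)^-1.
  rewrite {1}/mod2 re_mk im_mk !exprMn -mulrDl -/(mod2 z).
  by field; rewrite gt_eqF.
by apply: H2_eq; rewrite ?re_mk ?im_mk E; field; rewrite gt_eqF.
Qed.

Lemma inversionSK : involutive inversionS.
Proof.
case=> [x|] /=; last by rewrite eqxx.
by case: eqP => [->//|/eqP x0] /=; rewrite invr_eq0 (negPf x0) invrK.
Qed.

Definition inversion_H2 : symm (H2 R) := Symm inversionHK inversionHK.
Definition inversion_S1 : symm (S1 R) := Symm inversionSK inversionSK.

Lemma moebius_inversion : moebius inversion_H2 inversion_S1.
Proof.
split=> /= [z w|p q r s|p k k0|p q t pq].
- rewrite /delta !re_mk !im_mk.
  have z0 := im_gt0 z; have w0 := im_gt0 w.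
  have := mod2_gt0 z; have := mod2_gt0 w; rewrite /mod2 => mw mz.
  by field; rewrite !gt_eqF.
- rewrite /cross.
  have H (x y : R) : (exists2 c : R, 0 < c & x = c * y) -> x < 0 <-> y < 0.
    by case=> c c0 ->; rewrite pmulr_rlt0.
  apply: H.
  (* the factor by which the inversion scales the coordinates of x *)
  pose c x : R := if x is Some a then if a == 0 then 1 else a^-1 else 1.
  have H x y : det (inversionS x) (inversionS y) = - c x * c y * det x y.
    rewrite /c; case: x y => [x|] [y|] //=; try by ring.
    + case: (eqVneq x 0) => [->|x0]; case: (eqVneq y 0) => [->|y0] /=; try by ring.
      * by field.
      * by field.
      * by field; rewrite x0 y0.
    + by case: (eqVneq x 0) => [_|x0] /=; [ring|field].
    + by case: (eqVneq y 0) => [_|y0] /=; [ring|field].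
  have cx x : c x != 0.
    rewrite /c; case: x => [x|]; last exact: oner_neq0.
    by case: (eqVneq x 0) => [_|x0]; [exact: oner_neq0 | exact: invr_neq0].
  exists ((c p * c q * c r * c s) ^+ 2).
    by rewrite lt_def sqr_ge0 sqrf_eq0 !mulf_neq0.
  by rewrite !H; ring.
- have k0' : k != 0 by rewrite gt_eqF.
  have m0 z : mod2 z != 0 by rewrite gt_eqF// mod2_gt0.
  case: p => [x|] /=; first case: (eqVneq x 0) => [->|x0] /=.
  + exists k^-1; first by rewrite invr_gt0.
    move=> z; rewrite im_mk; apply: iff_trans.
      exact: (conj (@esym _ _ _) (@esym _ (k * im z) _)).
    apply: (@eq_scale _ _ _ _ (k * mod2 z)^-1);
      first (by rewrite invr_eq0 mulf_neq0);
      by move: (m0 z); rewrite /mod2 => mz; field; rewrite mz k0'.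
  + exists (k / x ^+ 2).
      by rewrite divr_gt0// lt_def sqrf_eq0 x0 sqr_ge0.
    move=> z; rewrite re_mk im_mk.
    apply: (@eq_scale _ _ _ _ (x ^+ 2 * mod2 z)^-1);
      first (by rewrite invr_eq0 mulf_neq0// sqrf_eq0);
      by move: (m0 z); rewrite /mod2 => mz; field; rewrite mz x0.
  + exists k^-1; first by rewrite invr_gt0.
    move=> z; rewrite re_mk im_mk; apply: iff_trans.
      exact: (conj (@esym _ (im z) k) (@esym _ k (im z))).
    apply: (@eq_scale _ _ _ _ (k * mod2 z)^-1);
      first (by rewrite invr_eq0 mulf_neq0);
      by move: (m0 z); rewrite /mod2 => mz; field; rewrite mz k0'.
- exists (- t); first by rewrite sqrrN.
  move=> z; have m0 : mod2 z != 0 by rewrite gt_eqF// mod2_gt0.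
  case: p q pq => [u|] [v|] //= pq;
    do ?[case: eqVneq => [u0|u0] //=]; do ?[case: eqVneq => [v0|v0] //=];
    rewrite ?re_mk ?im_mk.
  + by case: pq; congr Some; rewrite u0 v0.
  + apply: (@eq_scale _ _ _ _ (- (v * mod2 z)^-1));
      first (by rewrite oppr_eq0 invr_eq0 mulf_neq0);
      by move: m0; rewrite ?u0 /mod2 => m0; field; rewrite m0 v0.
  + apply: (@eq_scale _ _ _ _ (- (u * mod2 z)^-1));
      first (by rewrite oppr_eq0 invr_eq0 mulf_neq0);
      by move: m0; rewrite ?v0 /mod2 => m0; field; rewrite m0 u0.
  + apply: (@eq_scale _ _ _ _ (u * v * mod2 z)^-1);
      first (by rewrite invr_eq0 !mulf_neq0);
      by move: m0; rewrite /mod2 => m0; field; rewrite m0 u0 v0.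
  + apply: (@eq_scale _ _ _ _ (mod2 z)^-1);
      first (by rewrite invr_eq0);
      by move: m0; rewrite ?u0 /mod2 => m0; field; rewrite m0.
  + apply: (@eq_scale _ _ _ _ (- (u * mod2 z)^-1));
      first (by rewrite oppr_eq0 invr_eq0 mulf_neq0);
      by move: m0; rewrite /mod2 => m0; field; rewrite m0 u0.
  + apply: (@eq_scale _ _ _ _ (mod2 z)^-1);
      first (by rewrite invr_eq0);
      by move: m0; rewrite ?u0 /mod2 => m0; field; rewrite m0.
  + apply: (@eq_scale _ _ _ _ (- (v * mod2 z)^-1));
      first (by rewrite oppr_eq0 invr_eq0 mulf_neq0);
      by move: m0; rewrite /mod2 => m0; field; rewrite m0 u0.
Qed.

End Coordinates.

(** * The curves and the isometries of the plane *)
Section Moebius.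
Variable R : realType.
Implicit Types (z w : H2 R) (p q r s : S1 R).

Lemma geodesicE p q : p <> q -> geodesic p q = hyper p q 0.
Proof.
have H (a b : R) : trace (circle (((a + b) / 2) +i* 0)%C (`|b - a| / 2)) =
    hyper (Some a : S1 R) (Some b) 0.
  apply/seteqP; split=> z /=; rewrite /circle /trace /re /im /cabs /=;
    case: (val z) => x y /=; rewrite subr0 mulr0 mul0r => E.
  - have : (x - (a + b) / 2) ^+ 2 + y ^+ 2 = (`|b - a| / 2) ^+ 2.
      by rewrite -E sqr_sqrtr// addr_ge0 ?sqr_ge0.
    rewrite expr_div_n real_normK ?num_real// => {}E.
    by apply/eqP; rewrite -subr_eq0; apply/eqP; lra.
  - rewrite -[RHS](@ger0_norm _ (`|b - a| / 2)) ?divr_ge0// -sqrtr_sqr.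
    by congr Num.sqrt; rewrite expr_div_n real_normK ?num_real//; lra.
case: p q => [a|] [b|] // _ /=; first exact: H.
- by apply/seteqP; split=> z /=; rewrite /trace /line /re /im /=; case: (val z) => x y /=; lra.
- by apply/seteqP; split=> z /=; rewrite /trace /line /re /im /=; case: (val z) => x y /=; lra.
Qed.

Lemma horocyclesE h :
  horocycles h <-> exists p k, 0 < k /\ h = horo p k.
Proof.
have H (a k : R) : 0 < k -> trace (circle (a +i* k)%C k) = horo (Some a : S1 R) (2 * k).
  move=> k0; apply/seteqP; split=> z /=; rewrite /circle /trace /re /im /cabs /=;
    case: (val z) => x y /= E.
    have : (x - a) ^+ 2 + (y - k) ^+ 2 = k ^+ 2.
      by rewrite -[in RHS]E sqr_sqrtr// addr_ge0 ?sqr_ge0.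
    by lra.
  rewrite -[RHS]gtr0_norm// -sqrtr_sqr; congr Num.sqrt; lra.
have H' (k : R) : trace (line 0 1 k) = horo (None : S1 R) k.
  by apply/seteqP; split=> z /=; rewrite /trace /line /re /im /=; case: (val z) => x y /=; lra.
split=> [[[a [k [k0 ->]]]|[k [k0 ->]]]|[[a|] [k [k0 ->]]]].
- by exists (Some a), (2 * k); rewrite H// mulr_gt0.
- by exists None, k.
- left; exists a, (k / 2); rewrite H ?divr_gt0//; split=> //.
  by congr horo; field.
- by right; exists k.
Qed.

Lemma hypercyclesE h :
  hypercycles h <-> exists p q t, [/\ p <> q, t <> 0 & h = hyper p q t].
Proof.
have H (u v t : R) : u < v -> trace (circle (((u + v) / 2) +i* ((v - u) * t / 2))%C
    ((v - u) / 2 * Num.sqrt (1 + t ^+ 2))) = hyper (Some u : S1 R) (Some v) t.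
  move=> uv; apply/seteqP; split=> z /=; rewrite /circle /trace /re /im /cabs /=;
    case: (val z) => x y /= E.
    have : (x - (u + v) / 2) ^+ 2 + (y - (v - u) * t / 2) ^+ 2 =
        ((v - u) / 2) ^+ 2 * (1 + t ^+ 2).
      rewrite -(@sqr_sqrtr _ (1 + t ^+ 2)) ?addr_ge0 ?sqr_ge0// -exprMn -E.
      by rewrite sqr_sqrtr// addr_ge0 ?sqr_ge0.
    by lra.
  have uv2 : 0 <= (v - u) / 2 by rewrite divr_ge0// subr_ge0 ltW.
  rewrite -[X in _ = X * _](ger0_norm uv2) -sqrtr_sqr -sqrtrM ?sqr_ge0//.
  by congr Num.sqrt; lra.
have Hl (a b k : R) : a <> 0 -> trace (line a b k) = hyper (None : S1 R) (Some (k / a)) (- b / a).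
  move=> /eqP a0; apply/seteqP; split=> z /=; rewrite /trace /line /re /im /=;
    case: (val z) => x y /= E.
    by apply: (mulfI a0); rewrite mulrBr (mulrC a (k / a)) divfK// -E; field.
  have -> : x = k / a + - b / a * y by rewrite -E; ring.
  by field.
split=> [[[[c1 c2] [r [/= c2r c20 ->]]]|[a [b [k [a0 b0 ->]]]]]|[p [q [t [pq t0 ->]]]]].
- have r0 : 0 < r by exact: le_lt_trans c2r.
  have : 0 < r ^+ 2 - c2 ^+ 2.
    by rewrite subr_gt0 -(real_normK (num_real c2)) ltr_pXn2r// nnegrE ?ltW.
  set d := (_ - _) => d0; have sd0 : 0 < Num.sqrt d by rewrite sqrtr_gt0.
  have sd := sqr_sqrtr (ltW d0).
  exists (Some (c1 - Num.sqrt d)), (Some (c1 + Num.sqrt d)), (c2 / Num.sqrt d).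
  have sdn : Num.sqrt d != 0 by rewrite gt_eqF.
  split; first by case=> E; lra.
    by apply/eqP; rewrite mulf_neq0 ?invr_eq0//; apply/eqP.
  rewrite -H; last by lra.
  congr (trace (circle _ _)); first by congr (_ +i* _)%C; field.
  have -> : 1 + (c2 / Num.sqrt d) ^+ 2 = r ^+ 2 / Num.sqrt d ^+ 2.
    rewrite (_ : r ^+ 2 = Num.sqrt d ^+ 2 + c2 ^+ 2); first by field.
    by rewrite sd /d; ring.
  rewrite -expr_div_n sqrtr_sqr ger0_norm ?divr_ge0// ?ltW//.
  by field.
- exists None, (Some (k / a)), (- b / a); split=> //; last exact: Hl.
  by apply/eqP; rewrite mulf_neq0 ?oppr_eq0 ?invr_eq0//; exact/eqP.
- have H1 : forall (u v t : R), u < v -> t <> 0 -> hypercycles (hyper (Some u : S1 R) (Some v) t).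
    move=> {}u v {}t uv {}t0; left; rewrite -H//.
    exists (((u + v) / 2) +i* ((v - u) * t / 2))%C, ((v - u) / 2 * Num.sqrt (1 + t ^+ 2)).
    have uv2 : 0 < (v - u) / 2 by rewrite divr_gt0// subr_gt0.
    split=> //=.
      rewrite mulrAC normrM gtr0_norm// ltr_pM2l// -sqrtr_sqr ltr_sqrt;
        last by have := sqr_ge0 t; lra.
      by lra.
    by apply/eqP; rewrite mulrAC (mulf_neq0 (lt0r_neq0 uv2))//; exact/eqP.
  have H2 (u t' : R) : t' <> 0 -> hypercycles (hyper (None : S1 R) (Some u) t').
    move=> t'0; right; exists 1, (- t'), u; split; [exact/eqP/oner_neq0| |].
      by apply/eqP; rewrite oppr_eq0; exact/eqP.
    by rewrite Hl ?divr1 ?opprK//; exact/eqP/oner_neq0.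
  have nt0 : - t <> 0 by apply/eqP; rewrite oppr_eq0; exact/eqP.
  case: p q pq => [u|] [v|] // pq; last exact: H2.
    have [uv|vu|E] := ltgtP u v; first exact: H1.
      by rewrite hyperC; exact: H1.
    by case: pq; rewrite E.
  by rewrite hyperC; exact: H2.
Qed.

Lemma S1_third p q : exists r, r <> p /\ r <> q.
Proof.
case: p q => [a|] [b|].
- by exists None.
- by exists (Some (a + 1)); split=> // -[]; lra.
- by exists (Some (b + 1)); split=> // -[]; lra.
- by exists (Some 0).
Qed.

(** The group is transitive on triples of points of the circle: an inversion
    sends the first one to infinity and an affine map places the two others.
    All the configurations below are put in this position. *)
Lemma moebius_normalize p q r : p <> q -> p <> r -> q <> r ->
  exists phi m, [/\ moebius phi m, m p = None, m q = Some 0 & m r = Some 1].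
Proof.
have [phi [m [mob mp]]] : exists phi m, moebius phi m /\ m p = None.
  case: p => [c|]; last by exists (symm1 _), (symm1 _); split=> //; exact: moebius1.
  exists (symmM (inversion_H2 R) (affine_H2 (- c) (oner_neq0 R))),
         (symmM (inversion_S1 R) (affine_S1 (- c) (oner_neq0 R))).
  split; first by apply: moebiusM; [exact: moebius_inversion|exact: moebius_affine].
  by rewrite /= mul1r subrr eqxx.
move=> pq pr qr.
case mq: (m q) => [x|]; last by case: pq; apply: (@symm_inj _ m); rewrite mp mq.
case mr: (m r) => [y|]; last by case: pr; apply: (@symm_inj _ m); rewrite mp mr.
have xy : y - x != 0.
  rewrite subr_eq0; apply/eqP => yx; apply: qr; apply: (@symm_inj _ m).
  by rewrite mq mr yx.
have xy' := invr_neq0 xy.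
exists (symmM (affine_H2 (- (x / (y - x))) xy') phi), (symmM (affine_S1 (- (x / (y - x))) xy') m).
split=> /=; first by apply: moebiusM => //; exact: moebius_affine.
- by rewrite mp.
- by rewrite mq; congr Some; ring.
- by rewrite mr; congr Some; field.
Qed.

Let pt_i : H2 R := mkH2 0 (@ltr01 R).
Let pt_2i : H2 R := mkH2 0 (@ltr0Sn R 1).
Let pt_1i : H2 R := mkH2 1 (@ltr01 R).

Lemma common_geodesic z w :
  exists p q, [/\ p <> q, hyper p q 0 z & hyper p q 0 w].
Proof.
have z0 := im_gt0 z; have w0 := im_gt0 w.
have [E|ne] := eqVneq (re z) (re w).
  by exists None, (Some (re z)); split=> //=; rewrite ?E; lra.
(* the centre of the geodesic is the real point equidistant from z and w *)
pose c := (re z ^+ 2 + im z ^+ 2 - re w ^+ 2 - im w ^+ 2) / (2 * (re z - re w)).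
have n0 : re z - re w != 0 by rewrite subr_eq0.
have cE : 2 * c * (re z - re w) = re z ^+ 2 + im z ^+ 2 - re w ^+ 2 - im w ^+ 2.
  by rewrite /c; field.
pose d := (re z - c) ^+ 2 + im z ^+ 2.
have d0 : 0 < d by rewrite ltr_wpDl ?sqr_ge0// exprn_gt0.
have sd := sqr_sqrtr (ltW d0); have sd0 : 0 < Num.sqrt d by rewrite sqrtr_gt0.
exists (Some (c - Num.sqrt d)), (Some (c + Num.sqrt d)); split=> /=.
- by case=> E; lra.
- by move: sd; rewrite {2}/d; lra.
- by move: sd; rewrite {2}/d; lra.
Qed.

Lemma delta_poly z w z' w' : delta z w = delta z' w' <->
  ((re z - re w) ^+ 2 + (im z - im w) ^+ 2) * (im z' * im w') =
  ((re z' - re w') ^+ 2 + (im z' - im w') ^+ 2) * (im z * im w).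
Proof.
have [z0 w0 z'0 w'0] := And4 (im_gt0 z) (im_gt0 w) (im_gt0 z') (im_gt0 w').
have n : im z * im w != 0 by rewrite mulf_neq0// gt_eqF.
have n' : im z' * im w' != 0 by rewrite mulf_neq0// gt_eqF.
rewrite /delta; split=> [E|E].
  by apply/eqP; rewrite -eqr_div//; apply/eqP.
by apply/eqP; rewrite eqr_div//; apply/eqP.
Qed.

(** The value of [delta] is the one at the points i and 2i, so that once the
    geodesic through [z] and [w] is the imaginary axis and [z] is i, the point
    [w] is 2i or i/2; the inversion exchanges these. *)
Lemma moebius_two_points z w : delta z w = 1 / 2 ->
  exists phi m, [/\ moebius phi m, phi z = pt_i & phi w = pt_2i].
Proof.
move=> dzw.
have [p [q [pq zpq wpq]]] := common_geodesic z w.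
have [r [rp rq]] := S1_third p q.
have [|||phi [m [mob mp mq _]]] := @moebius_normalize p q r => //; try exact: nesym.
have [u] := moebius_hyper mob 0 pq.
rewrite expr0n /= => /eqP; rewrite sqrf_eq0 mp mq => /eqP -> H.
have /= := (H z).1 zpq; have /= := (H w).1 wpq; rewrite !subr0 !mul0r => rw rz.
have z0 := im_gt0 (phi z); have w0 := im_gt0 (phi w).
have k0 := invr_neq0 (lt0r_neq0 z0).
pose psi := symmM (affine_H2 0 k0) phi.
have mobp : moebius psi (symmM (affine_S1 0 k0) m).
  by apply: moebiusM => //; exact: moebius_affine.
have nk : `|(im (phi z))^-1| = (im (phi z))^-1 by rewrite gtr0_norm// invr_gt0.
have pz : psi z = pt_i.
  apply: H2_eq; rewrite /= ?re_mk ?im_mk; first by rewrite rz mulr0 addr0.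
  by rewrite nk mulVf// lt0r_neq0.
have pw : re (psi w) = 0 by rewrite /= re_mk rw mulr0 addr0.
clearbody psi.
have : delta (psi z) (psi w) = delta pt_i pt_2i.
  by rewrite (moebius_delta mobp) dzw /delta /pt_i /pt_2i /pt_1i !re_mk !im_mk; field.
have key v : re v = 0 -> delta pt_i v = delta pt_i pt_2i ->
    (im v - 2) * (2 * im v - 1) = 0.
  by rewrite delta_poly /pt_i /pt_2i !re_mk !im_mk => ->; lra.
rewrite pz => /(key _ pw).
move=> /eqP; rewrite mulf_eq0 => /orP[] /eqP yE.
  exists psi, (symmM (affine_S1 0 k0) m); split=> //.
  by apply: H2_eq => //; rewrite /pt_2i im_mk; lra.
have mod2_i : mod2 pt_i = 1 by rewrite /mod2 /pt_i re_mk im_mk; ring.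
exists (symmM (inversion_H2 R) psi),
  (symmM (inversion_S1 R) (symmM (affine_S1 0 k0) m)); split=> /=.
- by apply: moebiusM => //; exact: moebius_inversion.
- by rewrite pz; apply: H2_eq; rewrite ?re_mk ?im_mk mod2_i; lra.
- apply: H2_eq; rewrite ?re_mk ?im_mk /mod2 pw ?mul0r//.
  have -> : im (psi w) = 1 / 2 by lra.
  by rewrite /pt_2i ?im_mk; field.
Qed.

(** An isometry is determined by its values at i, 2i and 1 + i.  After
    composition with a Möbius transformation the first two are fixed, and the
    third one is fixed up to the reflection in the imaginary axis.  The argument
    is applied to the inverse of [phi], so that it presents [phi] itself, and
    not its inverse, as a Möbius transformation. *)
Lemma isometry_moebius (phi : symm (H2 R)) :
  (forall z w, delta (phi z) (phi w) = delta z w) -> exists m, moebius phi m.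
Proof.
move=> iso; pose chi := symmV phi.
have isoV z w : delta (chi z) (chi w) = delta z w.
  by rewrite -iso /chi /= !symm_invK.
have [|psi [m [mob pz pw]]] := @moebius_two_points (chi pt_i) (chi pt_2i).
  by rewrite isoV /delta /pt_i /pt_2i /pt_1i !re_mk !im_mk; field.
suff [psi' [m' [mob' H]]] : exists psi' m', moebius psi' m' /\
    [/\ psi' (chi pt_i) = pt_i, psi' (chi pt_2i) = pt_2i & psi' (chi pt_1i) = pt_1i].
  suff E : phi = psi' by exists m'; rewrite E.
  apply: symm_eq => z; have : psi' (chi (phi z)) = phi z; last by rewrite /chi /= symm_funK.
  move: (phi z) H => {z} z [H1 H2 H3].
  have K x : delta (psi' (chi z)) (psi' (chi x)) = delta z x.
    by rewrite (moebius_delta mob') isoV.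
  have := K pt_i; have := K pt_2i; have := K pt_1i; rewrite H1 H2 H3 !delta_poly.
  have z0 := im_gt0 z; rewrite /pt_i /pt_2i /pt_1i !re_mk !im_mk.
  set z' := psi' _; have z'0 := im_gt0 z' => E3 E2 E1.
  have E : im z' = im z by lra.
  move: E1 E2 E3; rewrite E => E1 E2 E3.
  have E4 : (re z' - re z) * im z = 0 by lra.
  by apply: H2_eq => //; move/eqP: E4; rewrite mulf_eq0 subr_eq0 (gt_eqF z0) orbF => /eqP.
have K x : delta (psi (chi pt_1i)) (psi (chi x)) = delta pt_1i x.
  by rewrite (moebius_delta mob) isoV.
have := K pt_i; have := K pt_2i; rewrite pz pw !delta_poly /pt_i /pt_2i /pt_1i !re_mk !im_mk.
set z' := psi _; have z'0 := im_gt0 z' => E2 E1.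
have E : im z' = 1 by lra.
have : (re z' - 1) * (re z' + 1) = 0.
  by move: E1; rewrite E; lra.
move=> /eqP; rewrite mulf_eq0 => /orP[] /eqP rE.
  by exists psi, m; split=> //; split=> //; apply: H2_eq;
    rewrite /pt_i /pt_2i /pt_1i ?re_mk ?im_mk -/z'; lra.
have n1 : - 1 != 0 :> R by rewrite oppr_eq0 oner_eq0.
exists (symmM (affine_H2 0 n1) psi), (symmM (affine_S1 0 n1) m).
split; first by apply: moebiusM => //; exact: moebius_affine.
by split; rewrite /= ?pz ?pw; apply: H2_eq;
  rewrite /pt_i /pt_2i /pt_1i ?re_mk ?im_mk ?normrN1 -/z'; lra.
Qed.

End Moebius.

(** * Combinatorics of linked pairs on the circle *)
Section Linking.
Variable R : realType.
Implicit Types (p q r s k l m : S1 R).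

Lemma mulr_lt0_iff (x y : R) :
  x * y < 0 <-> (x < 0 /\ 0 < y) \/ (0 < x /\ y < 0).
Proof.
split=> [|[[x0 y0]|[x0 y0]]]; last 2 first.
- by rewrite nmulr_rlt0.
- by rewrite pmulr_rlt0.
have [x0|x0|->] := ltgtP x 0; last by rewrite mul0r ltxx.
- by rewrite nmulr_rlt0//; left.
- by rewrite pmulr_rlt0//; right.
Qed.

Lemma cross_inf (x a b : R) : cross None (Some x) (Some a) (Some b) <->
  (a < x /\ x < b) \/ (b < x /\ x < a).
Proof.
rewrite /cross /= mulrNN !mul1r mulr_lt0_iff.
by split=> -[[? ?]|[? ?]]; [left|right|left|right]; split; lra.
Qed.

Lemma cross_fin (a b c d : R) : a < b ->
  cross (Some a) (Some b) (Some c) (Some d) <->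
  (a < c < b /\ (d < a \/ b < d)) \/ (a < d < b /\ (c < a \/ b < c)).
Proof.
move=> ab; rewrite /cross /=.
rewrite (_ : _ * _ = ((c - a) * (c - b)) * ((d - a) * (d - b))); last by ring.
have H (x : R) : ((x - a) * (x - b) < 0) <-> (a < x < b).
  rewrite mulr_lt0_iff; split=> [[[? ?]|[? ?]]|/andP[? ?]]; lra.
have H' (x : R) : (0 < (x - a) * (x - b)) <-> (x < a \/ b < x).
  rewrite -oppr_lt0 -mulrN mulr_lt0_iff.
  split=> [[[? ?]|[? ?]]|[?|?]]; [left|right|left|right]; try split; lra.
rewrite mulr_lt0_iff !H !H'; tauto.
Qed.

Lemma cross_neq p q r s : cross p q r s ->
  [/\ p <> r, p <> s, q <> r & q <> s].
Proof.
by rewrite /cross => c; split=> /det_eq0 E; move: c; rewrite E !(mul0r, mulr0) ltxx.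
Qed.

Lemma cross_sharedl p q s : ~ cross p q p s.
Proof. by move=> /cross_neq[]. Qed.

Lemma cross_sharedr p q s : ~ cross q p p s.
Proof. by move=> /cross_neq[]. Qed.

Lemma crossxx p r s : ~ cross p p r s.
Proof. by rewrite /cross -expr2 ltNge sqr_ge0. Qed.

(** The second equivalence moves to the left-hand side the points that are
    given by their normalized coordinates. *)
Lemma normalize3 p q r : p <> q -> p <> r -> q <> r ->
  exists m : symm (S1 R), [/\ m p = None, m q = Some 0, m r = Some 1,
    forall p q r s, cross (m p) (m q) (m r) (m s) <-> cross p q r s &
    forall p q r s, cross (symm_inv m p) (symm_inv m q) r s <->
      cross p q (m r) (m s)].
Proof.
move=> pq pr qr; have [phi [m [mob ? ? ?]]] := moebius_normalize pq pr qr.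
exists m; split=> // [|k l k' l']; first exact: moebius_cross mob.
by rewrite -(moebius_cross mob) !symm_invK.
Qed.

Lemma below3 (x y z : R) : exists a, [/\ a < x, a < y & a < z].
Proof.
exists (- (`|x| + `|y| + `|z| + 1)).
have := (ler_norm (- x), ler_norm (- y), ler_norm (- z)); rewrite !normrN => -[[]].
by have := (normr_ge0 x, normr_ge0 y, normr_ge0 z) => -[[]]; split; lra.
Qed.

Lemma above3 (x y z : R) : exists a, [/\ x < a, y < a & z < a].
Proof.
have [a [ax ay az]] := below3 (- x) (- y) (- z).
by exists (- a); split; lra.
Qed.

Definition between p q r s k l := forall m n,
  cross m n p q -> cross m n r s -> cross m n k l.

(** With [p] at infinity, the geodesics that meet both [p q] and [p r] include
    all the sufficiently wide semicircles, which avoid any bounded geodesic. *)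
Lemma between_common p q r k l : p <> q -> p <> r -> q <> r ->
  between p q p r k l -> p = k \/ p = l.
Proof.
move=> pq pr qr btw; have [m [mp mq mr cm cm']] := normalize3 pq pr qr.
case mk : (m k) => [x|]; last by left; apply: (@symm_inj _ m); rewrite mp.
case ml : (m l) => [y|]; last by right; apply: (@symm_inj _ m); rewrite mp.
exfalso.
have [a [a0 ax ay]] := below3 0 x y; have [b [b1 bx bY]] := above3 1 x y.
have := btw (symm_inv m (Some a)) (symm_inv m (Some b)).
rewrite !cm' mp mq mr mk ml (cross_sym _ _ None) (cross_sym _ _ None).
rewrite !cross_inf cross_fin; last lra.
by clear -a0 ax ay b1 bx bY => /(_ ltac:(lra) ltac:(lra)); lra.
Qed.

(** Disjoint geodesics without common endpoint are opposite sides of an ideal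
    quadrilateral.  Every geodesic that meets both sides also meets the two
    diagonals, which are linked. *)
Lemma between_crossing p q r s : p <> q -> p <> r -> p <> s -> q <> r ->
  q <> s -> r <> s -> ~ cross p q r s ->
  exists k l k' l', [/\ cross k l k' l', between p q r s k l &
    between p q r s k' l'].
Proof.
move=> pq pr ps qr qs rs; have [m [mp mq mr cm cm']] := normalize3 pq pr qr.
case ms : (m s) => [c|]; last by case: ps; apply: (@symm_inj _ m); rewrite mp.
have c0 : c != 0 by apply/eqP => E; apply: qs; apply: (@symm_inj _ m); rewrite mq ms E.
have c1 : c != 1 by apply/eqP => E; apply: rs; apply: (@symm_inj _ m); rewrite mr ms E.
rewrite -cm mp mq mr ms cross_inf => ncr.
have {ncr} c_gt0 : 0 < c.
  by rewrite lt_neqAle eq_sym c0 leNgt; apply/negP => ?; apply: ncr; right.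
have btw k l : between None (Some 0) (Some 1) (Some c) k l ->
    between p q r s (symm_inv m k) (symm_inv m l).
  move=> btw x y; rewrite -(cm _ _ p) -(cm _ _ r) -(cm x) !symm_invK mp mq mr ms; exact: btw.
suff [k [l [k' [l' [H1 H2 H3]]]]] : exists k l k' l', [/\ cross k l k' l',
    between None (Some 0) (Some 1) (Some c) k l &
    between None (Some 0) (Some 1) (Some c) k' l'].
  exists (symm_inv m k), (symm_inv m l), (symm_inv m k'), (symm_inv m l').
  by split; [rewrite -cm !symm_invK|exact: btw|exact: btw].
clear - c_gt0 c0 c1.
have [c1'|c1'|c1'] := ltgtP c 1; last by rewrite c1' eqxx in c1.
- exists (Some 0), (Some 1), None, (Some c); split.
  + by rewrite cross_sym cross_inf; lra.
  + move=> [x|] [y|]; try by [move=> /cross_sharedl|move=> /cross_sharedr].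
    rewrite cross_sym cross_inf cross_sym cross_swapl.
    by rewrite cross_fin// cross_sym cross_fin; lra.
  + move=> [x|] [y|]; try by [move=> /cross_sharedl|move=> /cross_sharedr].
    rewrite cross_sym cross_inf cross_sym cross_swapl.
    by rewrite cross_fin// cross_sym cross_inf; lra.
- exists (Some 0), (Some c), None, (Some 1); split.
  + by rewrite cross_sym cross_inf; lra.
  + move=> [x|] [y|]; try by [move=> /cross_sharedl|move=> /cross_sharedr].
    rewrite cross_sym cross_inf cross_sym.
    by rewrite cross_fin// cross_sym cross_fin; lra.
  + move=> [x|] [y|]; try by [move=> /cross_sharedl|move=> /cross_sharedr].
    rewrite cross_sym cross_inf cross_sym.
    by rewrite cross_fin// cross_sym cross_inf; lra.
Qed.

(** Geodesics with a common endpoint at infinity are vertical, and a wide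
    semicircle meets them all; the sides of an ideal triangle, on the other hand,
    are not met by a common geodesic. *)
Lemma pencil_transversal p q r s : p <> q -> p <> r -> q <> r -> p <> s ->
  exists m n, [/\ cross m n p q, cross m n p r & cross m n p s].
Proof.
move=> pq pr qr ps; have [m [mp mq mr cm cm']] := normalize3 pq pr qr.
case ms : (m s) => [c|]; last by case: ps; apply: (@symm_inj _ m); rewrite mp.
have [a [a0 a1 ac]] := below3 0 1 c; have [b [b0 b1 bc]] := above3 0 1 c.
exists (symm_inv m (Some a)), (symm_inv m (Some b)).
by split; rewrite cm' mp ?mq ?mr ?ms (cross_sym _ _ None) cross_inf; left.
Qed.

Lemma triangle_no_transversal p q r m n : p <> q -> p <> r -> q <> r ->
  cross m n p q -> cross m n p r -> cross m n q r -> False.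
Proof.
move=> pq pr qr; have [f [fp fq fr cf _]] := normalize3 pq pr qr.
rewrite -!(cf m n) fp fq fr.
case: (f m) => [x|]; last by move=> /cross_sharedl.
case: (f n) => [y|]; last by move=> /cross_sharedr.
rewrite !(cross_sym _ _ None) !cross_inf cross_sym cross_fin//; lra.
Qed.
End Linking.

(** * Intersections of curves with given endpoints *)
Definition same_pair (T : Type) (p q r s : T) : Prop :=
  (p = r /\ q = s) \/ (p = s /\ q = r).

Section Geodesics.
Variable R : realType.
Implicit Types (p q r s k l m : S1 R).

Lemma quadratic_pos_root (a b c : R) : 0 < a -> c < 0 ->
  exists2 y, 0 < y & a * y ^+ 2 - b * y + c = 0.
Proof.
move=> a0 c0; have ac : 0 < - (4 * (a * c)).
  by rewrite oppr_gt0 pmulr_rlt0// pmulr_rlt0.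
have d0 : b ^+ 2 < b ^+ 2 - 4 * (a * c) by rewrite ltrDl.
have d0' : 0 <= b ^+ 2 - 4 * (a * c) by rewrite (le_trans (sqr_ge0 b))// ltW.
have sd := sqr_sqrtr d0'; set r := Num.sqrt _ in sd.
have br : - b < r.
  by rewrite (le_lt_trans (ler_norm _))// normrN -sqrtr_sqr ltr_sqrt// (le_lt_trans (sqr_ge0 b)).
exists ((b + r) / (2 * a)); first by rewrite divr_gt0 ?mulr_gt0//; lra.
have a_neq0 : a != 0 by rewrite gt_eqF.
rewrite (_ : _ + c = (r ^+ 2 - (b ^+ 2 - 4 * (a * c))) / (4 * a)); last by field.
by rewrite sd subrr mul0r.
Qed.

(** When one of the curves is a line through 0, the intersection is given by a
    quadratic equation whose roots have the sign of the product of the endpoints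
    of the other; linked pairs make this product negative. *)
Lemma cross_hyper_meet p q r s t u : p <> q -> cross p q r s ->
  exists z, hyper p q t z /\ hyper r s u z.
Proof.
move=> pq c; have [pr ps qr qs] := cross_neq c.
have [k [kp kq]] := S1_third p q.
have [|||phi [m [mob mp mq _]]] := @moebius_normalize R p q k => //; try exact: nesym.
have rs : r <> s by move=> rs; move: c; rewrite rs (cross_sym) => /crossxx.
have [t' _ Ht] := moebius_hyper mob t pq; have [u' _ Hu] := moebius_hyper mob u rs.
suff [z [zt zu]] : exists z, hyper (m p) (m q) t' z /\ hyper (m r) (m s) u' z.
  by exists (symm_inv phi z); rewrite Ht Hu !symm_invK.
move: c; rewrite -(moebius_cross mob) mp mq.
case: (m r) (m s) => [a|] [b|]; try by move=> /cross_neq[].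
rewrite cross_inf => ab.
have ab0 : a * b < 0.
  by rewrite mulr_lt0_iff; case: ab => -[? ?]; [left|right].
have [|y y0 E] := @quadratic_pos_root (1 + t' ^+ 2) (t' * (a + b) + (b - a) * u') (a * b) _ ab0.
  by have := sqr_ge0 t'; lra.
exists (mkH2 (t' * y) y0) => /=; rewrite !re_mk !im_mk; split; lra.
Qed.

Lemma geodesic_meet_cross p q r s z : p <> q -> r <> s ->
  ~ same_pair p q r s -> hyper p q 0 z -> hyper r s 0 z -> cross p q r s.
Proof.
move=> pq rs nsp zpq zrs.
have [k [kp kq]] := S1_third p q.
have [|||phi [m [mob mp mq _]]] := @moebius_normalize R p q k => //; try exact: nesym.
have [t2 + Ht] := moebius_hyper mob 0 pq; have [u2 + Hu] := moebius_hyper mob 0 rs.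
rewrite !expr0n /= => /eqP; rewrite sqrf_eq0 => /eqP u0 /eqP; rewrite sqrf_eq0 => /eqP t0.
move: zpq zrs; rewrite Ht Hu mp mq t0 u0 -(moebius_cross mob) mp mq.
have {nsp} : ~ same_pair (m p) (m q) (m r) (m s).
  by move=> H; apply: nsp; case: H => -[/(@symm_inj _ m) -> /(@symm_inj _ m) ->]; [left|right].
rewrite mp mq; have z0 := im_gt0 (phi z); clear -z0.
rewrite /= mul0r subr0 => nsp x0.
case: (m r) (m s) nsp => [a|] [b|] //= nsp; rewrite x0 => E.
- rewrite cross_inf.
  have : a * b < 0 by have : 0 < im (phi z) ^+ 2 by [exact: exprn_gt0]; lra.
  by rewrite mulr_lt0_iff => -[[? ?]|[? ?]]; [left|right].
- by case: nsp; right; split=> //; congr Some; lra.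
- by case: nsp; left; split=> //; congr Some; lra.
Qed.

Lemma geodesic_inj p q r s : p <> q -> r <> s ->
  geodesic p q = geodesic r s -> same_pair p q r s.
Proof.
move=> pq rs; rewrite !geodesicE// => E.
have [k [kp kq]] := S1_third p q.
have [|||phi [m [mob mp mq _]]] := @moebius_normalize R p q k => //; try exact: nesym.
have [t2 + Ht] := moebius_hyper mob 0 pq; have [u2 + Hu] := moebius_hyper mob 0 rs.
rewrite !expr0n /= => /eqP; rewrite sqrf_eq0 => /eqP u0 /eqP; rewrite sqrf_eq0 => /eqP t0.
suff : same_pair (m p) (m q) (m r) (m s).
  by case=> -[/(@symm_inj _ m) -> /(@symm_inj _ m) ->]; [left|right].
have H z : hyper (m p) (m q) 0 z <-> hyper (m r) (m s) 0 z.
  by rewrite -[z](symm_invK phi) -{1}t0 -{1}u0 -Ht -Hu E.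
have [/= H1 _] := H (mkH2 0 (@ltr01 R)); have [/= H2 _] := H (mkH2 0 (@ltr0Sn R 1)).
move: H1 H2; rewrite mp mq /= !mul0r subrr => /(_ erefl) + /(_ erefl).
case: (m r) (m s) => [a|] [b|] //=; rewrite !im_mk ?re_mk => E1 E2; clear -E1 E2.
- by exfalso; lra.
- by right; split=> //; congr Some; lra.
- by left; split=> //; congr Some; lra.
Qed.

Definition ends (v : vertex (K_geod R)) p q : Prop :=
  p <> q /\ val v = geodesic p q.

Lemma geodesicC p q : geodesic p q = geodesic q p.
Proof.
by case: p q => [a|] [b|] //=; rewrite addrC distrC.
Qed.

Lemma endsC v p q : ends v p q -> ends v q p.
Proof. by move=> [pq E]; split; [exact: nesym|rewrite geodesicC]. Qed.

Lemma ends_exists v : exists p q, ends v p q.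
Proof. by have /set_mem [p [q [pq E]]] := valP v; exists p, q. Qed.

Lemma ends_build p q : p <> q -> exists v, ends v p q.
Proof.
move=> pq; have H : geodesic p q \in @geodesics R by apply/mem_set; exists p, q.
by exists (exist (fun c => c \in @geodesics R) _ H).
Qed.

Lemma ends_inj v w p q : ends v p q -> ends w p q -> v = w.
Proof. by move=> [_ E] [_ E']; apply: val_inj; rewrite E. Qed.

Lemma ends_uniq v p q r s : ends v p q -> ends v r s -> same_pair p q r s.
Proof. by move=> [pq E] [rs E']; apply: geodesic_inj; rewrite -?E. Qed.

Lemma ends_same v p q r s : ends v p q -> same_pair p q r s -> ends v r s.
Proof. by move=> e [[<- <-]|[<- <-]] //; exact: endsC. Qed.

Definition meets (G : graph) (u v : vertex G) : Prop := u <> v /\ ~ adj u v.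

Lemma meets_cross v w p q r s : ends v p q -> ends w r s ->
  meets v w <-> cross p q r s.
Proof.
move=> ev ew; have [pq E] := ev; have [rs E'] := ew; split=> [[vw nadj]|c].
  have [z [zv zw]] : val v `&` val w !=set0.
    by apply/set0P/eqP => E0; apply: nadj.
  apply: (@geodesic_meet_cross _ _ _ _ z) => //; rewrite -?geodesicE -?E -?E'//.
  by move=> /(ends_same ev) ew'; apply: vw; exact: ends_inj ew' ew.
have [z [z1 z2]] := @cross_hyper_meet p q r s 0 0 pq c.
split=> [vw|[_ E0]].
  rewrite -vw in ew; have [pr ps qr qs] := cross_neq c.
  by case: (ends_uniq ev ew) => -[].
suff : set0 z by []; rewrite -E0; split; rewrite ?E ?E' geodesicE//.
Qed.
End Geodesics.

(** * The circle map of an automorphism of the geodesic graph *)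
Section CircleMap.
Variable R : realType.
Implicit Types (p q r s k l m : S1 R) (u v w : vertex (K_geod R)).

(** The counterpart of [between] in terms of the graph alone. *)
Definition graph_between u v w := forall x, meets x u -> meets x v -> meets x w.

Definition asymptotic v w := [/\ v <> w, ~ meets v w &
  forall x y, graph_between v w x -> graph_between v w y -> ~ meets x y].

Lemma graph_between_ends v w x p q r s k l : ends v p q -> ends w r s ->
  ends x k l -> graph_between v w x <-> between p q r s k l.
Proof.
move=> ev ew ex; split=> [btw m n c1 c2|btw y].
  have mn : m <> n.
    by move=> mn; move: c1; rewrite mn => /crossxx.
  have [y ey] := ends_build mn.
  rewrite -(meets_cross ey ex); apply: btw.
    by rewrite (meets_cross ey ev).
  by rewrite (meets_cross ey ew).
have [a [b ey]] := ends_exists y.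
rewrite (meets_cross ey ev) (meets_cross ey ew) (meets_cross ey ex); exact: btw.
Qed.

(** Sharing an endpoint is visible in the graph, by [between_common] and
    [between_crossing]. *)
Lemma asymptotic_common v w : asymptotic v w <->
  exists p q r, [/\ ends v p q, ends w p r & q <> r].
Proof.
split=> [[vw nm H]|[p [q [r [ev ew qr]]]]]; last first.
  have [[pq _] [pr _]] := (ev, ew).
  split.
  - move=> vw; move: ew; rewrite -vw => /(ends_uniq ev)[[_ //]|[p_ q_]].
    by apply: pr.
  - by rewrite (meets_cross ev ew) => /cross_neq[].
  move=> x y bx by_; have [k [l ex]] := ends_exists x.
  have [k' [l' ey]] := ends_exists y.
  move: bx by_; rewrite (graph_between_ends ev ew ex) (graph_between_ends ev ew ey).
  move=> /(between_common pq pr qr) H1 /(between_common pq pr qr) H2.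
  rewrite (meets_cross ex ey) => /cross_neq[kk' kl' lk' ll'].
  by case: H1 => E1; case: H2 => E2; subst.
have [p [q ev]] := ends_exists v; have [r [s ew]] := ends_exists w.
have [[pq _] [rs _]] := (ev, ew).
have [E|pr] := pselect (p = r).
  subst r; exists p, q, s; split=> // E; subst s; apply: vw; exact: ends_inj ev ew.
have [E|ps] := pselect (p = s).
  subst s; exists p, q, r; split=> //; first exact: endsC.
  by move=> E; subst r; apply: vw; apply: ends_inj ev (endsC ew).
have [E|qr] := pselect (q = r).
  by subst r; exists q, p, s; split=> //; exact: endsC.
have [E|qs] := pselect (q = s).
  by subst s; exists q, p, r; split=> //; exact: endsC.
exfalso; move: nm; rewrite (meets_cross ev ew).
move=> /(between_crossing pq pr ps qr qs rs)[k [l [k' [l' [c b1 b2]]]]].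
have kl : k <> l by move=> E; move: c; rewrite E => /crossxx.
have kl' : k' <> l' by move=> E; move: c; rewrite E cross_sym => /crossxx.
have [x ex] := ends_build kl; have [y ey] := ends_build kl'.
apply: (H x y); rewrite ?(graph_between_ends ev ew ex) ?(graph_between_ends ev ew ey)//.
by rewrite (meets_cross ex ey).
Qed.

Section Automorphism.
Variable F : symm (vertex (K_geod R)).
Hypothesis F_meets : forall u v, meets (F u) (F v) <-> meets u v.

Lemma asymptotic_image v w : asymptotic v w -> asymptotic (F v) (F w).
Proof.
have FV_meets u u' : meets (symm_inv F u) (symm_inv F u') <-> meets u u'.
  by rewrite -F_meets !symm_invK.
have betweenF x : graph_between (F v) (F w) x -> graph_between v w (symm_inv F x).
  move=> b y; rewrite -F_meets -(F_meets y w) => /b {}b /b.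
  by rewrite -{1}[x](symm_invK F) F_meets.
move=> [vw nm H]; split; first by move/(@symm_inj _ F).
  by rewrite F_meets.
by move=> x y /betweenF bx /betweenF by_; rewrite -FV_meets; exact: H.
Qed.

(** The images of two geodesics from [p] share an endpoint [p'].  The image of
    a third one shares an endpoint with both; if this were not [p'], the three
    images would form an ideal triangle, whereas they have a common transversal. *)
Lemma pencil_image p : exists p',
  forall v q, ends v p q -> exists q', ends (F v) p' q'.
Proof.
have [y [yp _]] := S1_third p p; have [z [zp zy]] := S1_third p y.
have py := nesym yp; have pz := nesym zp; have yz := nesym zy.
have [v ev] := ends_build py; have [w ew] := ends_build pz.
have /asymptotic_image/asymptotic_common[p' [s [t [ev' ew' st]]]] : asymptotic v w.
  by apply/asymptotic_common; exists p, y, z.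
exists p' => u q eu; have pq := eu.1.
have [E|qy] := pselect (q = y).
  by subst q; exists s; rewrite (ends_inj eu ev).
have [E|qz] := pselect (q = z).
  by subst q; exists t; rewrite (ends_inj eu ew).
have /asymptotic_image/asymptotic_common[a [b [c [e1 e2 bc]]]] : asymptotic u v.
  by apply/asymptotic_common; exists p, q, y.
have /asymptotic_image/asymptotic_common[a' [b' [c' [e1' e2' bc']]]] : asymptotic u w.
  by apply/asymptotic_common; exists p, q, z.
have [[ap _]|[ap _]] := ends_uniq e2 ev'; first by exists b; rewrite -ap.
have [[a'p _]|[a'p _]] := ends_uniq e2' ew'; first by exists b'; rewrite -a'p.
exfalso; subst a a'.
have [[E _]|[_ E]] := ends_uniq e1 e1'; first exact: st.
have eu' : ends (F u) s t by rewrite -E.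
have [m [n [c1 c2 c3]]] := pencil_transversal py pz yz pq.
have mn : m <> n by move=> mn; move: c1; rewrite mn => /crossxx.
have [x ex] := ends_build mn; have [i [j ex']] := ends_exists (F x).
have := (meets_cross ex ev).2 c1; have := (meets_cross ex ew).2 c2.
have := (meets_cross ex eu).2 c3.
rewrite -(F_meets x u) -(F_meets x w) -(F_meets x v)
  (meets_cross ex' eu') (meets_cross ex' ew').
rewrite (meets_cross ex' ev') => C1 C2 C3.
by apply: (@triangle_no_transversal _ p' s t i j) => //; [exact: ev'.1|exact: ew'.1].
Qed.

(** The map is injective because geodesics from two different points can be
    linked, whereas geodesics with a common endpoint cannot. *)
Lemma circle_map_forward : exists f : S1 R -> S1 R,
  forall v p q, ends v p q -> ends (F v) (f p) (f q).
Proof.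
have [f fP] := choice pencil_image.
have f_inj : injective f.
  move=> p q E; apply: contrapT => pq.
  have [y [yp yq]] := S1_third p q.
  have [m [mp mq my cm cm']] := normalize3 pq (nesym yp) (nesym yq).
  pose l := symm_inv m (Some 2).
  have c : cross p y q l.
    by rewrite -cm symm_invK mp mq my cross_inf; left; split; lra.
  have ql : q <> l by move=> ql; move: c; rewrite ql cross_sym => /crossxx.
  have [v ev] := ends_build (nesym yp); have [w ew] := ends_build ql.
  have [s ev'] := fP p v y ev; have [t ew'] := fP q w l ew.
  move: c; rewrite -(meets_cross ev ew) -F_meets (meets_cross ev' ew') E.
  exact: cross_sharedl.
exists f => v p q ev; have [a ea] := fP p v q ev.
have [b eb] := fP q v p (endsC ev).
have [[/f_inj E _]|[_ E]] := ends_uniq ea eb; first by case: (ev.1).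
by rewrite -E.
Qed.
End Automorphism.

Lemma ends_image_inj (f g : S1 R -> S1 R) :
  (forall v p q, ends v p q -> ends v (g (f p)) (g (f q))) -> cancel f g.
Proof.
move=> H p; have [y [yp _]] := S1_third p p; have [z [zp zy]] := S1_third p y.
have [v ev] := ends_build (nesym yp); have [w ew] := ends_build (nesym zp).
have [[E _]|[Ey _]] := ends_uniq (H _ _ _ ev) ev; first exact: E.
have [[E _]|[Ez _]] := ends_uniq (H _ _ _ ew) ew; first exact: E.
by case: zy; rewrite -Ez Ey.
Qed.

Lemma circle_map (F : symm (vertex (K_geod R))) :
  (forall u v, meets (F u) (F v) <-> meets u v) ->
  exists f : symm (S1 R),
    (forall p q r s, cross (f p) (f q) (f r) (f s) <-> cross p q r s) /\
    forall v p q, ends v p q -> ends (F v) (f p) (f q).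
Proof.
move=> FM; have [f fP] := circle_map_forward FM.
have GM u v : meets (symmV F u) (symmV F v) <-> meets u v.
  by rewrite -FM /= !symm_invK.
have [g gP] := circle_map_forward GM.
have fK : cancel f g.
  by apply: ends_image_inj => v p q /fP/gP /=; rewrite symm_funK.
have gK : cancel g f.
  by apply: ends_image_inj => v p q /gP/fP /=; rewrite symm_invK.
exists (Symm fK gK); split=> //= p q r s.
have cr_neq (x y z t : S1 R) : cross x y z t -> x <> y /\ z <> t.
  by move=> c; split=> E; move: c; rewrite E; [|rewrite cross_sym]; exact: crossxx.
split=> c; have [c1 c2] := cr_neq _ _ _ _ c.
  have pq : p <> q by move=> E; apply: c1; rewrite E.
  have rs : r <> s by move=> E; apply: c2; rewrite E.
  have [v ev] := ends_build pq; have [w ew] := ends_build rs.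
  by rewrite -(meets_cross ev ew) -FM (meets_cross (fP _ _ _ ev) (fP _ _ _ ew)).
have [v ev] := ends_build c1; have [w ew] := ends_build c2.
by rewrite -(meets_cross (fP _ _ _ ev) (fP _ _ _ ew)) FM (meets_cross ev ew).
Qed.
End CircleMap.

(** * Linked pairs and the topology of the circle *)
Section Topology.
Variable R : realType.
Implicit Types (p q r s : S1 R).

(** Bounded closed intervals are compact, so that a set that contains infinity
    is a neighbourhood of it as soon as it contains all large real numbers. *)
Lemma open_S1 (O : set (S1 R)) : open (Some @^-1` O : set R) ->
  (O None -> exists M : R, forall x, M < `|x| -> O (Some x)) -> open O.
Proof.
move=> Oo ON; rewrite openE => -[x Ox|Ox].
  by change (nbhs x (Some @^-1` O)); exact: open_nbhs_nbhs.
have [M HM] := ON Ox.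
exists `[- M, M]%classic; first by split; [exact: segment_compact|exact: interval_closed].
move=> w [[x /= xM <-]|->//]; apply: HM; rewrite ltNge; apply/negP => xle; apply: xM.
by rewrite in_itv /= -ler_norml.
Qed.

Lemma far_mul_gt0 (a b x : R) : `|a| + `|b| < `|x| -> 0 < (x - a) * (x - b).
Proof.
move=> xM.
have := (ler_norm a, ler_norm (- a), ler_norm b, ler_norm (- b)).
rewrite !normrN => -[[[a1 a2] b1] b2].
have := (normr_ge0 a, normr_ge0 b) => -[a0 b0].
have [x0|x0] := ltP x 0.
  rewrite (ltr0_norm x0) in xM.
  have : 0 < (a - x) * (b - x) by apply: mulr_gt0; lra.
  by lra.
by rewrite (ger0_norm x0) in xM; apply: mulr_gt0; lra.
Qed.

(** The set is the open arc between [p] and [q] that does not contain [s]. *)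
Lemma arc_open p q s : open [set w | cross p q s w].
Proof.
have det_cont r : continuous (fun w : R => det r (Some w)).
  case: r => [a|] w /=; last exact: cvg_cst.
  by apply: cvgB; [exact: cvg_id|exact: cvg_cst].
apply: open_S1.
  have : continuous (fun w : R => det p s * det p (Some w) * (det q s * det q (Some w))).
    by move=> w; do ![apply: cvgM => /=]; do ?[exact: cvg_cst|exact: det_cont].
  move=> /continuousP/(_ [set x | x < 0]); apply; exact: open_lt.
move=> /= c; have [_ pN _ qN] := cross_neq c.
case: p q pN qN c => [a|//] [b|//] _ _; rewrite /cross /= !mulr1 => c.
exists (`|a| + `|b|) => x xM.
have -> : det (Some a) s * (x - a) * (det (Some b) s * (x - b)) =
  det (Some a) s * det (Some b) s * ((x - a) * (x - b)) by ring.
rewrite nmulr_rlt0//.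
exact: far_mul_gt0.
Qed.

Lemma arc_basis p (O : set (S1 R)) : nbhs p O ->
  exists a b s, cross a b s p /\ [set w | cross a b s w] `<=` O.
Proof.
case: p => [x|].
  change (nbhs x (Some @^-1` O) -> exists a b s,
    cross a b s (Some x) /\ [set w | cross a b s w] `<=` O).
  move=> /nbhs_ballP[e /= e0 eO].
  (* infinity lies on the other arc between the two endpoints *)
  exists (Some (x - e)), (Some (x + e)), None; split.
    by rewrite /cross /= !mul1r mulr_lt0_iff; right; lra.
  move=> [w|]; last by rewrite /= cross_sym => /crossxx.
  rewrite /cross /= !mul1r mulr_lt0_iff => H; apply: eO; rewrite /ball /= ltr_distlC.
  by case: H; lra.
case=> K [/compact_bounded[M [_ HM]] _] KO.
pose N := `|M| + 1; have MN : M < N by have := ler_norm M; rewrite /N; lra.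
have N0 : 0 < N by rewrite ltr_wpDl.
exists (Some (- N)), (Some N), (Some 0); split.
  by rewrite /cross /= !mulr1 mulr_lt0_iff; right; lra.
case=> [w|]; last by move=> _; apply: KO; right.
rewrite /cross /= => H; apply: KO; left; exists w => // Kw.
have /= := HM N MN w Kw; rewrite ler_norml => /andP[w1 w2].
move: H; rewrite (_ : _ * _ = N ^+ 2 * ((N - w) * (N + w))); last by ring.
by rewrite ltNge !mulr_ge0 ?sqr_ge0//; lra.
Qed.

Lemma cross_continuous (f : symm (S1 R)) :
  (forall p q r s, cross (f p) (f q) (f r) (f s) <-> cross p q r s) ->
  continuous f.
Proof.
move=> fc p O /arc_basis[a [b [s [c cO]]]].
change (nbhs p (f @^-1` O)).
apply: (@filterS _ _ _ [set w | cross (symm_inv f a) (symm_inv f b) (symm_inv f s) w]).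
  by move=> w /=; rewrite -fc !symm_invK; exact: cO.
apply: open_nbhs_nbhs; split; first exact: arc_open.
by rewrite /= -fc !symm_invK.
Qed.

Lemma cross_symmV (f : symm (S1 R)) :
  (forall p q r s, cross (f p) (f q) (f r) (f s) <-> cross p q r s) ->
  forall p q r s, cross (symmV f p) (symmV f q) (symmV f r) (symmV f s) <->
    cross p q r s.
Proof. by move=> fc p q r s; rewrite -fc /= !symm_invK. Qed.

(** The arcs form a basis of the topology and are permuted by [f]. *)
Lemma cross_homeo (f : symm (S1 R)) :
  (forall p q r s, cross (f p) (f q) (f r) (f s) <-> cross p q r s) ->
  homeos f.
Proof.
move=> fc; split; first exact: cross_continuous.
exact: (cross_continuous (cross_symmV fc)).
Qed.

Lemma image_connected (f : S1 R -> S1 R) (A : set (S1 R)) :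
  continuous f -> connected A -> connected (f @` A).
Proof.
move=> fc cA; apply: connected_continuous_connected => //.
exact: continuous_subspaceT.
Qed.

(** If the pairs are linked, the two arcs between [p] and [q] are disjoint open
    sets that separate [r] from [s].  If they are not, normalize to [p] at
    infinity, [q = 0] and [r = 1]; this is a homeomorphism by [cross_homeo], and
    then [s > 0] is connected to [r] by a segment of positive numbers. *)
Lemma linked_cross p q r s : linked p q r s <-> cross p q r s.
Proof.
split=> [[u nc]|c]; last first.
  have [pr ps qr qs] := cross_neq c.
  have pq : p <> q by move=> E; move: c; rewrite E => /crossxx.
  have rs : r <> s by move=> E; move: c; rewrite E cross_sym => /crossxx.
  split.
    by rewrite /= !inE !negb_or; do ![apply/andP; split]; apply/eqP.
  move=> [C [Cr Csub Cconn] Cs].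
  (* the product of the three cross products is a square *)
  have dj w : cross p q r w -> cross p q s w -> False.
    move: c; rewrite /cross => c0 c1 c2.
    have : 0 <= (det p r * det p s * (det q r * det q s)) *
      ((det p r * det p w * (det q r * det q w)) *
       (det p s * det p w * (det q s * det q w))).
      rewrite (_ : _ * _ = (det p r * det p s * det q r * det q s * det p w * det q w) ^+ 2);
        last by ring.
      exact: sqr_ge0.
    by rewrite nmulr_rge0// leNgt nmulr_rgt0// c2.
  have cov w : C w -> cross p q r w \/ cross p q s w.
    move=> /Csub /= /not_orP[wp wq].
    have n0 : det p w * det q w != 0.
      by rewrite mulf_neq0//; apply/eqP => /det_eq0; [move/esym|move/esym].
    have key x : cross p q x w <-> (det p x * det q x) * (det p w * det q w) < 0.
      by rewrite /cross; split=> H;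
        [rewrite (_ : _ * _ = det p x * det p w * (det q x * det q w))
        |rewrite (_ : _ * _ = det p x * det q x * (det p w * det q w))] => //; ring.
    rewrite !key; move: c n0.
    rewrite /cross (_ : _ * _ = det p r * det q r * (det p s * det q s)); last by ring.
    rewrite (mulr_lt0_iff (det p r * _)) => c; rewrite neq_lt => /orP[w0|w0];
      rewrite (mulr_lt0_iff (det p r * _)) (mulr_lt0_iff (det p s * _)); tauto.
  have E : C `&` [set w | cross p q r w] = C.
    apply: Cconn.
    - by exists s.
    - by exists [set w | cross p q r w] => //; exact: arc_open.
    - exists (~` [set w | cross p q s w]); first exact/open_closedC/arc_open.
      apply/seteqP; split=> w [Cw cw]; split=> //; first by move/(dj w cw).
      by case: (cov w Cw).
  by move: Cr; rewrite -E => -[_ /=]; rewrite cross_sym => /crossxx.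
move: u; rewrite /= !inE !negb_or => /and3P[/and3P[/eqP pq /eqP pr /eqP ps]].
move=> /andP[/eqP qr /eqP qs] /andP[/eqP rs _].
apply: contrapT => ncr; apply: nc.
have [m [mp mq mr cm cm']] := normalize3 pq pr qr.
have [_ cV] := cross_homeo cm.
case ms : (m s) => [x|]; last by case: ps; apply: (@symm_inj _ m); rewrite mp.
have x0 : x != 0 by apply/eqP => E; apply: qs; apply: (@symm_inj _ m); rewrite mq ms E.
move: ncr; rewrite -cm mp mq mr ms cross_inf => ncr.
have {x0} x0 : 0 < x.
  by rewrite lt_neqAle eq_sym x0 leNgt; apply/negP => ?; apply: ncr; right.
pose I : set R := `[Num.min 1 x, Num.max 1 x]%classic.
have Iin y : I y -> 0 < y.
  by rewrite /I /= in_itv /= => /andP[+ _]; apply: lt_le_trans; rewrite lt_min ltr01.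
have cI : connected (symm_inv m @` (Some @` I)).
  apply: image_connected => //; apply: connected_continuous_connected.
    exact: segment_connected.
  apply: continuous_subspaceT; exact: one_point_compactification_some_continuous.
exists (symm_inv m @` (Some @` I)).
  split=> //.
  - exists (Some 1); last by rewrite -mr symm_funK.
    by exists 1 => //; rewrite /I /= in_itv /= ge_min le_max lexx.
  - move=> _ [_ [y /Iin y0 <-] <-] /= [] E.
      by have := congr1 m E; rewrite symm_invK mp.
    by have := congr1 m E; rewrite symm_invK mq => -[] y00; rewrite y00 ltxx in y0.
exists (Some x); last by rewrite -ms symm_funK.
by exists x => //; rewrite /I /= in_itv /= ge_min le_max lexx !orbT.
Qed.

Lemma homeo_linked (f : symm (S1 R)) : homeos f -> link_preserving f.
Proof.
move=> [fc fVc] t x y z [u nc]; split.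
  by rewrite (_ : [:: f t; f x; f y; f z] = map f [:: t; x; y; z])// map_inj_uniq//; exact: symm_inj.
move=> [C [Cy Csub Cconn] Cz]; apply: nc.
exists (symm_inv f @` C); last by exists (f z) => //; rewrite symm_funK.
split.
- by exists (f y) => //; rewrite symm_funK.
- by move=> _ [w Cw <-] /= [E|E]; apply: (Csub w Cw); [left|right]; rewrite /= -E symm_invK.
- exact: image_connected.
Qed.

Lemma homeo_cross (f : symm (S1 R)) : homeos f ->
  forall p q r s, cross (f p) (f q) (f r) (f s) <-> cross p q r s.
Proof.
move=> fh p q r s; rewrite -!linked_cross; split; last exact: homeo_linked.
have [fc fVc] := fh.
have fVh : homeos (symmV f) by split.
by move=> /(homeo_linked fVh) /=; rewrite !symm_funK.
Qed.
End Topology.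

(** * Automorphisms of the graph of geodesics *)
Lemma multiplicative_exists (G H : magmaType) (F : G -> H) :
  {morph F : x y / (x * y)%g} -> exists i : {multiplicative G -> H}, i =1 F.
Proof.
move=> FM; pose m := isMultiplicative.Build G H F FM.
pose i : {multiplicative G -> H} := HB.pack F m.
by exists i.
Qed.

Lemma adj_meets (G : graph) (u v : vertex G) :
  adj u v <-> u <> v /\ ~ meets u v.
Proof.
split=> [uv|[uv nm]]; last by apply: contrapT => nadj; apply: nm.
by split=> [E|[_]//]; move: uv; rewrite E => /adj_irr.
Qed.

Lemma auts_meets (G : graph) (a : symm (vertex G)) : auts a <->
  forall u v, meets (a u) (a v) <-> meets u v.
Proof.
have inj u v : a u = a v <-> u = v by split=> [/(@symm_inj _ a)|->].
split=> [H u v|H u v]; first by rewrite /meets -H inj.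
by rewrite !adj_meets H inj.
Qed.

Section GeodesicAutomorphisms.
Variable R : realType.
Implicit Types (p q : S1 R) (v w : vertex (K_geod R)) (f g : symm (S1 R)).

(** The action of a bijection of the circle on geodesics, defined through its
    effect on all choices of endpoints. *)
Lemma geod_act_exists f v :
  {w | forall p q, ends v p q -> ends w (f p) (f q)}.
Proof.
apply: cid; have [p [q ev]] := ends_exists v.
have [|w ew] := @ends_build _ (f p) (f q).
  by move=> /(@symm_inj _ f); exact: ev.1.
exists w => r s /(ends_uniq ev)[[<- <-]|[<- <-]] //; exact: endsC.
Qed.

Definition geod_act f v := sval (geod_act_exists f v).

Lemma geod_actP f v p q : ends v p q -> ends (geod_act f v) (f p) (f q).
Proof. exact: (svalP (geod_act_exists f v)). Qed.

Lemma geod_actM f g v : geod_act (symmM f g) v = geod_act f (geod_act g v).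
Proof.
have [p [q ev]] := ends_exists v.
exact: ends_inj (geod_actP (symmM f g) ev) (geod_actP f (geod_actP g ev)).
Qed.

Lemma geod_act1 v : geod_act (symm1 _) v = v.
Proof.
have [p [q ev]] := ends_exists v.
exact: ends_inj (geod_actP (symm1 _) ev) ev.
Qed.

Lemma geod_actK f : cancel (geod_act f) (geod_act (symmV f)).
Proof.
move=> v; rewrite -geod_actM (_ : symmM _ _ = symm1 _) ?geod_act1//.
by apply: symm_eq => p /=; rewrite symm_funK.
Qed.

Lemma geod_actVK f : cancel (geod_act (symmV f)) (geod_act f).
Proof.
move=> v; rewrite -geod_actM (_ : symmM _ _ = symm1 _) ?geod_act1//.
by apply: symm_eq => p /=; rewrite symm_invK.
Qed.

Definition geod_symm f : symm (vertex (K_geod R)) :=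
  Symm (geod_actK f) (geod_actVK f).

Lemma geod_symm_aut f : homeos f -> geod_symm f \in @auts (K_geod R).
Proof.
move=> fh; apply/mem_set/auts_meets => u v.
have [p [q eu]] := ends_exists u; have [r [s ev]] := ends_exists v.
rewrite (meets_cross (geod_actP f eu) (geod_actP f ev)) (homeo_cross fh).
by rewrite (meets_cross eu ev).
Qed.

Definition homeo_aut (f : Homeo (S1 R)) : Aut (K_geod R) :=
  exist (fun a => a \in @auts (K_geod R)) _ (geod_symm_aut (set_mem (valP f))).

Lemma homeo_autM : {morph homeo_aut : f g / (f * g)%g}.
Proof. by move=> f g; apply/val_inj/symm_eq => v; exact: geod_actM. Qed.

Lemma homeo_aut_inj : injective homeo_aut.
Proof.
move=> f g E; apply/val_inj/symm_eq.
have H (f' g' : symm (S1 R)) : (forall v, geod_act f' v = geod_act g' v) ->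
    cancel f' (symm_inv g').
  move=> H; apply: ends_image_inj => v p q ev.
  have := geod_actP (symmV g') (geod_actP f' ev).
  by rewrite H geod_actK.
have {}H := H (val f) (val g); move=> p.
apply: (can_inj (@symm_invK _ (val g))); rewrite symm_funK; apply: H => v.
by have := congr1 (fun a : Aut (K_geod R) => val a v) E.
Qed.

Lemma homeo_aut_surj (a : Aut (K_geod R)) :
  exists f : Homeo (S1 R), link_preserving (val f) /\ homeo_aut f = a.
Proof.
have /set_mem/auts_meets aP := valP a.
have [f [fc fe]] := circle_map aP.
have fh : f \in homeos (T := S1 R) by apply/mem_set/cross_homeo.
exists (exist _ f fh); split; first exact/homeo_linked/set_mem.
apply/val_inj/symm_eq => v; have [p [q ev]] := ends_exists v.
exact: ends_inj (geod_actP f ev) (fe _ _ _ ev).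
Qed.

Lemma K_geod_automorphisms :
  exists i : {multiplicative Homeo (S1 R) -> Aut (K_geod R)},
  [/\ forall (f : Homeo (S1 R)) (g : vertex (K_geod R)) (x y : S1 R),
        x <> y -> val g = geodesic x y ->
        val (val (i f) g) = geodesic (val f x) (val f y),
      bijective i
    & forall a : Aut (K_geod R),
        exists f : Homeo (S1 R), link_preserving (val f) /\ i f = a].
Proof.
have [i iE] := multiplicative_exists homeo_autM.
exists i; split=> [f g x y xy E||a].
- by rewrite iE; have [_] := geod_actP (val f) (conj xy E : ends g x y).
- have [j jP] := choice homeo_aut_surj.
  exists j => x; last by rewrite iE; case: (jP x).
  by apply: homeo_aut_inj; rewrite -[in RHS]iE; case: (jP (i x)).
- by have [f [fl fa]] := homeo_aut_surj a; exists f; rewrite iE.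
Qed.
End GeodesicAutomorphisms.

(** * The action of isometries on a class of curves *)
Section IsometryAction.
Variables (R : realType) (C : set (set (H2 R))).
Implicit Types (phi psi : symm (H2 R)) (h : vertex (disj_graph C)).

(** For a class of curves that is invariant under Möbius transformations,
    isometries act on the disjointness graph.  The action is faithful if the
    curves separate points, and onto if every automorphism becomes trivial after
    composition with some isometry. *)
Hypothesis C_moebius : forall phi m, moebius phi m ->
  forall c, C c -> C (phi @` c).

Lemma isoms_delta phi :
  isoms phi <-> forall z w, delta (phi z) (phi w) = delta z w.
Proof. by split=> iso z w; apply/hdist_eq; exact: iso. Qed.

Lemma isoms_closed phi c : isoms phi -> C c -> C (phi @` c).
Proof.
by move=> /isoms_delta/isometry_moebius[m mob]; exact: C_moebius mob _.
Qed.

Lemma isomsV phi : isoms phi -> isoms (symmV phi).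
Proof. by move=> iso z w; rewrite -iso /= !symm_invK. Qed.

Definition isom_act (f : Isom R) h : vertex (disj_graph C) :=
  exist (fun c => c \in C) (val f @` val h)
    (mem_set (isoms_closed (set_mem (valP f)) (set_mem (valP h)))).

Definition isom_actV (f : Isom R) h : vertex (disj_graph C) :=
  exist (fun c => c \in C) (symmV (val f) @` val h)
    (mem_set (isoms_closed (isomsV (set_mem (valP f))) (set_mem (valP h)))).

Lemma isom_actK f : cancel (isom_act f) (isom_actV f).
Proof.
move=> h; apply: val_inj; rewrite /= image_comp.
by rewrite (_ : _ \o _ = id) ?image_id//; apply/funext => z /=; rewrite symm_funK.
Qed.

Lemma isom_actVK f : cancel (isom_actV f) (isom_act f).
Proof.
move=> h; apply: val_inj; rewrite /= image_comp.
by rewrite (_ : _ \o _ = id) ?image_id//; apply/funext => z /=; rewrite symm_invK.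
Qed.

Definition isom_symm (f : Isom R) : symm (vertex (disj_graph C)) :=
  Symm (isom_actK f) (isom_actVK f).

Lemma isom_symm_aut f : isom_symm f \in @auts (disj_graph C).
Proof.
apply/mem_set => c d /=; rewrite /disj /=; split=> -[cd cd0]; split.
- by move=> /(can_inj (isom_actK f)).
- rewrite -subset0 => _ [[z cz <-] [w dw /(@symm_inj _ (val f)) E]].
  by suff : set0 z by []; rewrite -cd0; split=> //; rewrite -E.
- by move=> E; apply: cd; rewrite E.
- rewrite -subset0 => z [cz dz]; suff : set0 (val f z) by [].
  by rewrite -cd0; split; exists z.
Qed.

Definition isom_aut (f : Isom R) : Aut (disj_graph C) :=
  exist (fun a => a \in @auts (disj_graph C)) _ (isom_symm_aut f).

Lemma isom_autM : {morph isom_aut : f g / (f * g)%g}.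
Proof.
move=> f g; apply/val_inj/symm_eq => h; apply: val_inj => /=.
by rewrite image_comp.
Qed.

Hypothesis C_separates : forall z w,
  (forall c, C c -> c z -> c w) -> z = w.

(** A curve through [f z] is the image by [f] of a curve through [z], hence also
    its image by [g], so that it contains [g z]. *)
Lemma isom_aut_inj : injective isom_aut.
Proof.
move=> f g E; apply/val_inj/symm_eq => z; apply: C_separates => c Cc cz.
pose b := symmV (val f) @` c.
have Cb : C b by apply: isoms_closed Cc; exact/isomsV/set_mem/valP.
pose h : vertex (disj_graph C) := exist (fun c => c \in C) b (mem_set Cb).
have fb : val f @` b = c.
  rewrite /b image_comp (_ : _ \o _ = id) ?image_id//.
  by apply/funext => w /=; rewrite symm_invK.
have : val f @` b = val g @` b.
  by have := congr1 (fun a : Aut (disj_graph C) => val (val a h)) E.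
rewrite fb => ->; exists z => //; exists (val f z) => //=.
by rewrite symm_funK.
Qed.

(** Composing an automorphism with an isometry puts it in normal position. *)
Lemma compose_isometry (a : Aut (disj_graph C)) phi : isoms phi ->
  exists F : symm (vertex (disj_graph C)),
    (forall u v, meets (F u) (F v) <-> meets u v) /\
    forall h, val (F h) = phi @` val (val a h).
Proof.
move=> iso; pose f : Isom R := exist (fun f => f \in @isoms R) phi (mem_set iso).
exists (val (isom_aut f * a)%g); split=> //.
exact/auts_meets/set_mem/(valP (isom_aut f * a)%g).
Qed.

Hypothesis C_rigid : forall a : Aut (disj_graph C),
  exists2 phi, isoms phi & forall h, phi @` val (val a h) = val h.

Lemma isometry_automorphisms :
  exists i : {multiplicative Isom R -> Aut (disj_graph C)},
  (forall (phi : Isom R) (h : vertex (disj_graph C)),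
     val (val (i phi) h) = [set val phi z | z in val h]) /\
  bijective i.
Proof.
have [i iE] := multiplicative_exists isom_autM.
exists i; split=> [f h|]; first by rewrite iE.
have surj (a : Aut (disj_graph C)) : exists f, isom_aut f = a.
  have [phi iso phiE] := C_rigid a.
  exists (exist (fun f => f \in @isoms R) _ (mem_set (isomsV iso))).
  apply/val_inj/symm_eq => h; apply: val_inj; rewrite /= -phiE image_comp.
  by rewrite (_ : _ \o _ = id) ?image_id//; apply/funext => z /=; rewrite symm_funK.
have [j jP] := choice surj.
exists j => x; last by rewrite iE jP.
by apply: isom_aut_inj; rewrite jP iE.
Qed.
End IsometryAction.

(** * Horocycles: incidence and tangency *)

(** Such a function is increasing and fixes the positive integers; comparison
    of [n x] with integers gives [n * `|f x - x| <= 1] for all [n]. *)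
Lemma additive_id (R : realType) (f : R -> R) :
  (forall a b, 0 < a -> 0 < b -> f (a + b) = f a + f b) ->
  (forall a, 0 < a -> 0 < f a) -> f 1 = 1 -> forall x, 0 < x -> f x = x.
Proof.
move=> fD f0 f1.
have fM n x : 0 < x -> f (n.+1%:R * x) = n.+1%:R * f x.
  move=> x0; elim: n => [|n IH]; first by rewrite !mul1r.
  by rewrite -addn1 natrD !mulrDl !mul1r fD ?IH// mulr_gt0.
have fn n : f n.+1%:R = n.+1%:R by have := fM n 1 ltr01; rewrite !mulr1 f1 mulr1.
have fle a b : 0 < a -> a <= b -> f a <= f b.
  move=> a0; rewrite le_eqVlt => /predU1P[->//|ab].
  have -> : b = a + (b - a) by ring.
  by rewrite fD ?subr_gt0// lerDl ltW// f0// subr_gt0.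
have bound x n : 0 < x -> n.+1%:R * `|f x - x| <= 1.
  move=> x0; pose y := n.+1%:R * x.
  have y0 : 0 < y by rewrite mulr_gt0.
  have /andP[m1 m2] := truncn_itv (ltW y0).
  have up : f y <= (Num.truncn y).+1%:R by rewrite -fn; apply: fle => //; exact: ltW.
  have lo : (Num.truncn y)%:R <= f y.
    case: (Num.truncn y) m1 => [|k] m1; first by rewrite ltW// f0.
    by rewrite -fn; apply: fle.
  have -> : n.+1%:R * `|f x - x| = `|f y - y|.
    by rewrite /y fM// -mulrBr normrM (ger0_norm (ler0n _ _)).
  rewrite ler_norml; move: up m2; rewrite -addn1 natrD => up m2.
  by apply/andP; split; lra.
move=> x x0; apply/eqP; rewrite -subr_eq0 -normr_eq0; apply: contrapT => /negP nz.
have e0 : 0 < `|f x - x| by rewrite lt_def nz normr_ge0.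
pose n := Num.truncn (`|f x - x|^-1).
have i0 : 0 < `|f x - x|^-1 by rewrite invr_gt0.
have /andP[_ nlt] := truncn_itv (ltW i0).
have := bound x n x0; rewrite leNgt => /negP; apply.
by rewrite -[ltLHS](mulVf (lt0r_neq0 e0)) ltr_pM2r.
Qed.

Section Horocycles.
Variable R : realType.
Implicit Types (p q : S1 R) (h g x y : vertex (K_horo R)).

Lemma image_symm (T : Type) (phi : symm T) (A B : set T) :
  (forall z, A z <-> B (phi z)) -> phi @` A = B.
Proof.
move=> AB; apply/seteqP; split=> [_ [z /AB Bz <-//]|z Bz].
by exists (symm_inv phi z); rewrite ?symm_invK// AB symm_invK.
Qed.

Lemma horocycles_moebius phi m : moebius phi m ->
  forall c, @horocycles R c -> horocycles (phi @` c).
Proof.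
move=> mob c /horocyclesE[p [k [k0 ->]]]; apply/horocyclesE.
have [l l0 E] := moebius_horo mob p k0.
by exists (m p), l; split=> //; exact: image_symm.
Qed.

(** A point is the top of a horocycle with finite centre and the point where it
    touches a horizontal one. *)
Lemma horocycles_separate (z w : H2 R) :
  (forall c, horocycles c -> c z -> c w) -> z = w.
Proof.
move=> H; have z0 := im_gt0 z.
have E : im w = im z.
  apply: (H (horo None (im z))) => //.
  by apply/horocyclesE; exists None, (im z).
apply: H2_eq => //.
have : horo (Some (re z)) (im z) w.
  apply: H; first by apply/horocyclesE; exists (Some (re z)), (im z).
  by rewrite /= subrr expr0n /= add0r expr2.
rewrite /= E expr2 => E2.
have : (re w - re z) ^+ 2 = 0 by lra.
by move=> /eqP; rewrite sqrf_eq0 subr_eq0 => /eqP.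
Qed.

Definition horo_at h p (k : R) : Prop := 0 < k /\ val h = horo p k.

Lemma horo_at_exists h : exists p k, horo_at h p k.
Proof. by have /set_mem/horocyclesE[p [k E]] := valP h; exists p, k. Qed.

Lemma horo_at_build p (k : R) : 0 < k -> exists h, horo_at h p k.
Proof.
move=> k0; have H : horo p k \in @horocycles R.
  by apply/mem_set/horocyclesE; exists p, k.
by exists (exist (fun c => c \in @horocycles R) _ H).
Qed.

Lemma horo_at_inj h g p k : horo_at h p k -> horo_at g p k -> h = g.
Proof. by move=> [_ E] [_ E']; apply: val_inj; rewrite E. Qed.

(** The condition on the sizes for two horocycles to meet.  It excludes common
    centres, as concentric horocycles are disjoint. *)
Definition overlap p (k : R) q (l : R) : Prop :=
  match p, q with
  | Some a, Some b => a != b /\ (a - b) ^+ 2 <= k * l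
  | Some _, None => l <= k
  | None, Some _ => k <= l
  | None, None => False
  end.

(** If [z] is a common point at height h, then [k l - (a - b)^2] is the square
    of [X Y / h + h], where X and Y are the abscissas of [z] relative to the
    centres. *)
Lemma horo_circles (a b k l : R) : 0 < k -> 0 < l -> a != b ->
  (exists z, horo (Some a) k z /\ horo (Some b) l z) <->
  (a - b) ^+ 2 <= k * l.
Proof.
move=> k0 l0 ab; split=> [[z [/= za zb]]|H].
  have z0 := im_gt0 z; have zn : im z != 0 by rewrite gt_eqF.
  have -> : a - b = (re z - b) - (re z - a) by ring.
  move: (re z - a) (re z - b) za zb => X Y za zb.
  rewrite -subr_ge0 (_ : _ - _ = (X * Y / im z + im z) ^+ 2) ?sqr_ge0//.
  have -> : k = (X ^+ 2 + im z ^+ 2) / im z by rewrite za mulfK.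
  have -> : l = (Y ^+ 2 + im z ^+ 2) / im z by rewrite zb mulfK.
  by field.
(* conversely h = d^2 / (k + l - 2 e), where e is a square root of k l - d^2 *)
pose d := b - a; pose e := Num.sqrt (k * l - d ^+ 2).
have d20 : 0 < d ^+ 2 by rewrite lt_def sqr_ge0 sqrf_eq0 subr_eq0 eq_sym ab.
have e2 : e ^+ 2 = k * l - d ^+ 2.
  by rewrite sqr_sqrtr// subr_ge0 (le_trans _ H)// /d -sqrrN opprB.
have e0 : 0 <= e by exact: sqrtr_ge0.
have n0 : 0 < k + l - 2 * e.
  rewrite subr_gt0 -(ltr_pXn2r (n := 2))// ?nnegrE; try lra.
  rewrite exprMn e2 -subr_gt0.
  rewrite (_ : _ - _ = (k - l) ^+ 2 + 4 * d ^+ 2); last by ring.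
  by rewrite ltr_wpDl ?sqr_ge0// mulr_gt0.
have h0 : 0 < d ^+ 2 / (k + l - 2 * e) by rewrite divr_gt0.
exists (mkH2 (a + d * (k - e) / (k + l - 2 * e)) h0) => /=.
have nn : k + l - 2 * e != 0 by rewrite gt_eqF.
have nn2 : (k + l - 2 * e) ^+ 2 != 0 by rewrite sqrf_eq0.
have E (x : R) : x * (k + l - 2 * e) ^+ 2 = 0 -> x = 0.
  by move/eqP; rewrite mulf_eq0 (negPf nn2) orbF => /eqP.
rewrite !re_mk !im_mk; split; apply/eqP; rewrite -subr_eq0; apply/eqP; apply: E.
  transitivity (d ^+ 2 * (e ^+ 2 - k * l + d ^+ 2)); last by rewrite e2; ring.
  by field.
transitivity (d ^+ 2 * (e ^+ 2 - k * l + d ^+ 2)); last by rewrite e2; ring.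
have -> : b = a + d by rewrite /d; ring.
by field.
Qed.

Lemma horo_line (b k l : R) : 0 < k -> 0 < l ->
  (exists z, horo None k z /\ horo (Some b) l z) <-> k <= l.
Proof.
move=> k0 l0; split=> [[z [/= za zb]]|kl].
  rewrite -subr_ge0 -(pmulr_rge0 _ k0); rewrite -za in k0 *.
  by rewrite mulrBr [im z * l]mulrC -zb addrK sqr_ge0.
exists (mkH2 (b + Num.sqrt (k * (l - k))) k0) => /=.
rewrite re_mk im_mk; split=> //; rewrite addrAC subrr add0r sqr_sqrtr; first by ring.
by rewrite mulr_ge0 ?subr_ge0// ltW.
Qed.

Lemma meets_iff (C : set (set (H2 R))) (c d : vertex (disj_graph C)) :
  meets c d <-> c <> d /\ exists z, val c z /\ val d z.
Proof.
split=> [[cd nadj]|[cd [z [zc zd]]]].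
  split=> //; have [z [? ?]] : val c `&` val d !=set0.
    by apply/set0P/eqP => E0; apply: nadj.
  by exists z.
by split=> // -[_ E]; suff : set0 z by []; rewrite -E.
Qed.

Lemma concentric (p : S1 R) (k l : R) z : horo p k z -> horo p l z -> k = l.
Proof.
have zn : im z != 0 by rewrite gt_eqF// im_gt0.
by case: p => [a|] /= => [->|-> //]; exact: mulIf.
Qed.

Lemma horo_nonempty p (k : R) : 0 < k -> exists z, horo p k z.
Proof.
move=> k0; case: p => [a|]; last by exists (mkH2 0 k0).
by exists (mkH2 a k0) => /=; rewrite re_mk im_mk; ring.
Qed.

Lemma horo_center p q (k l : R) : 0 < k -> 0 < l ->
  horo p k = horo q l -> p = q.
Proof.
have H (b k' l' : R) : 0 < k' -> horo (None : S1 R) k' = horo (Some b) l' -> False.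
  move=> k0 E.
  have : horo (Some b) l' (mkH2 b k0) by rewrite -E.
  have : horo (Some b) l' (mkH2 (b + 1) k0) by rewrite -E.
  by rewrite /= !re_mk !im_mk; lra.
move=> k0 l0; case: p q => [a|] [b|] // E.
- have : horo (Some b) l (mkH2 a k0) by rewrite -E /= re_mk im_mk; ring.
  have : horo (Some a) k (mkH2 b l0) by rewrite E /= re_mk im_mk; ring.
  rewrite /= !re_mk !im_mk => E1 E2; congr Some.
  have : (a - b) ^+ 2 = 0 by have := sqr_ge0 (a - b); have := sqr_ge0 (k - l); lra.
  by move=> /eqP; rewrite sqrf_eq0 subr_eq0 => /eqP.
- by case: (H _ _ _ l0 (esym E)).
- by case: (H _ _ _ k0 E).
Qed.

Lemma horo_at_uniq h p q (k l : R) : horo_at h p k -> horo_at h q l -> p = q /\ k = l.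
Proof.
move=> [k0 E] [l0 E']; have pq : p = q by apply: (horo_center k0 l0); rewrite -E.
split=> //; subst q; have [z zk] := horo_nonempty p k0.
by apply: (concentric zk); rewrite -E' E.
Qed.

Lemma meets_overlap h g p q (k l : R) : horo_at h p k -> horo_at g q l ->
  meets h g <-> overlap p k q l.
Proof.
move=> eh eg; have [[k0 Eh] [l0 Eg]] := (eh, eg); rewrite meets_iff Eh Eg.
have -> : overlap p k q l <-> p <> q /\ exists z, horo p k z /\ horo q l z.
  case: p q {eh eg Eh Eg} => [a|] [b|] /=.
  - split=> [[ab /(horo_circles k0 l0 ab) H]|[ab H]]; first by split=> // -[E]; rewrite E eqxx in ab.
    have ab' : a != b by apply/eqP => E; apply: ab; rewrite E.
    by split=> //; apply/(horo_circles k0 l0 ab').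
  - rewrite -(horo_line a l0 k0); split=> [[z [? ?]]|[_ [z [? ?]]]].
      by split=> //; exists z.
    by exists z.
  - by rewrite -(horo_line b k0 l0); split=> [H|[]].
  - by split=> // -[].
split=> -[n [z [z1 z2]]]; split; do ?[by exists z].
- move=> E; subst q; apply: n; apply: val_inj.
  by rewrite Eh Eg (concentric z1 z2).
- by move=> E; subst g; apply: n; have [] := horo_at_uniq eh eg.
Qed.

(** For concentric horocycles this is the inclusion of horoballs (see
    [inside_infinity] and [inside_finite]), and it never holds between
    horocycles with different centres (see [inside_center]).  Hence both the
    centre and the order on each family of concentric horocycles can be read off
    the graph. *)
Definition inside h g : Prop := forall x, meets x h -> meets x g.

(** Tangent horocycles meet, but cease to do so as soon as one of them shrinks. *)
Definition tangent h g : Prop :=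
  meets h g /\ forall x, inside x g -> x <> g -> ~ meets h x.

Lemma inside_center h g p q (k l : R) : horo_at h p k -> horo_at g q l ->
  inside h g -> p = q.
Proof.
move=> eh eg sub; have [[k0 _] [l0 _]] := (eh, eg).
(* a horocycle that meets the first one and misses the second one *)
suff [[c [s [s0 c1 c2]]]|//] :
    (exists c s, [/\ 0 < s, overlap c s p k & ~ overlap c s q l]) \/ p = q.
  by have [x ex] := horo_at_build c s0; case: c2; rewrite -(meets_overlap ex eg);
    apply: sub; rewrite (meets_overlap ex eh).
case: p q {eh eg} => [a|] [b|]; last by right.
- have [->|ab] := eqVneq a b; [by right|left].
  have kl0 : 0 < k / l by rewrite divr_gt0.
  have r0 : 0 < Num.sqrt (k / l) by rewrite sqrtr_gt0.
  have r2 := sqr_sqrtr (ltW kl0); set r := Num.sqrt _ in r0 r2.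
  have d0 : 0 < (a - b) ^+ 2 by rewrite lt_def sqr_ge0 sqrf_eq0 subr_eq0 ab.
  (* a horocycle tangent to the first one, on the side opposite to b *)
  exists (Some (a + r * (a - b))), ((a - b) ^+ 2 / l); split; first exact: divr_gt0.
    split.
      rewrite -subr_eq0 addrAC subrr add0r.
      by apply: mulf_neq0; [exact: lt0r_neq0|rewrite subr_eq0].
    rewrite (_ : _ - a = r * (a - b)); last by ring.
    by rewrite exprMn r2 le_eqVlt; apply/orP; left; apply/eqP; ring.
  move=> [_]; rewrite (_ : _ - b = (1 + r) * (a - b)); last by ring.
  rewrite exprMn divfK ?gt_eqF// -[leRHS]mul1r ler_pM2r// leNgt => /negP; apply.
  by have := exprn_gt0 2 r0; lra.
- left; exists (Some (a + Num.sqrt (k * (l / 2)))), (l / 2).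
  have kl0 : 0 < k * (l / 2) by rewrite !mulr_gt0.
  split; [by rewrite divr_gt0| |by rewrite /= leNgt; move/negP; apply; lra].
  split.
    by rewrite -subr_eq0 addrAC subrr add0r gt_eqF// sqrtr_gt0.
  by rewrite addrAC subrr add0r (sqr_sqrtr (ltW kl0)) mulrC lexx.
- left; exists (Some (b + (k + l))), k; split=> //=.
  have kl : 0 < k + l by rewrite addr_gt0.
  move=> [_]; rewrite addrAC subrr add0r leNgt => /negP; apply.
  by have := mulr_gt0 k0 l0; have := exprn_gt0 2 k0; have := exprn_gt0 2 l0; lra.
Qed.

Lemma inside_infinity h g (k l : R) : horo_at h None k -> horo_at g None l ->
  inside h g <-> l <= k.
Proof.
move=> eh eg; have [[k0 _] [l0 _]] := (eh, eg); split=> [sub|lk x].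
  have [x ex] := horo_at_build (Some 0) k0.
  by have := sub x; rewrite (meets_overlap ex eh) (meets_overlap ex eg) /=; apply.
have [p [s ex]] := horo_at_exists x.
rewrite (meets_overlap ex eh) (meets_overlap ex eg); case: p {ex} => [a|] //=.
exact: le_trans.
Qed.

Lemma inside_finite h g a (k l : R) : horo_at h (Some a) k -> horo_at g (Some a) l ->
  inside h g <-> k <= l.
Proof.
move=> eh eg; have [[k0 _] [l0 _]] := (eh, eg); split=> [sub|lk x].
  have [x ex] := horo_at_build None k0.
  by have := sub x; rewrite (meets_overlap ex eh) (meets_overlap ex eg) /=; apply.
have [p [s ex]] := horo_at_exists x; have s0 := ex.1.
rewrite (meets_overlap ex eh) (meets_overlap ex eg); case: p {ex} => [b|] //=.
  by move=> [ab H]; split=> //; rewrite (le_trans H)// ler_pM2l.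
by move=> H; exact: le_trans lk.
Qed.

Lemma tangent_infinity h g a (s k : R) : horo_at h (Some a) s -> horo_at g None k ->
  tangent h g <-> s = k.
Proof.
move=> eh eg; have [[s0 _] [k0 _]] := (eh, eg).
rewrite /tangent (meets_overlap eh eg) /=; split=> [[ks H]|sk].
  apply/eqP; rewrite eq_le ks andbT leNgt; apply/negP => lt.
  have [x ex] := horo_at_build None s0.
  apply: (H x); first by rewrite (inside_infinity ex eg).
    by move=> E; subst x; have [_ E] := horo_at_uniq ex eg; rewrite E ltxx in lt.
  by rewrite (meets_overlap eh ex) /= lexx.
subst s; split=> // x xg ng; have [q [l ex]] := horo_at_exists x.
have E := inside_center ex eg xg; subst q.
move: xg; rewrite (inside_infinity ex eg) (meets_overlap eh ex) /= => kl lk.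
have E : k = l by apply/eqP; rewrite eq_le kl.
by apply: ng; apply: (horo_at_inj ex); rewrite -E.
Qed.

Lemma tangent_finite h g a b (s t : R) : horo_at h (Some a) s -> horo_at g (Some b) t ->
  tangent h g <-> a != b /\ (a - b) ^+ 2 = s * t.
Proof.
move=> eh eg; have [[s0 _] [t0 _]] := (eh, eg).
rewrite /tangent (meets_overlap eh eg) /=; split=> [[[ab H] K]|[ab E]].
  have d0 : 0 < (a - b) ^+ 2 by rewrite lt_def sqr_ge0 sqrf_eq0 subr_eq0 ab.
  split=> //; apply/eqP; rewrite eq_le H leNgt; apply/negP => lt.
  have t'0 : 0 < (a - b) ^+ 2 / s by rewrite divr_gt0.
  have t't : (a - b) ^+ 2 / s < t by rewrite ltr_pdivrMr// mulrC.
  have [x ex] := horo_at_build (Some b) t'0.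
  apply: (K x); first by rewrite (inside_finite ex eg) ltW.
    by move=> E; subst x; have [_ E] := horo_at_uniq ex eg; rewrite E ltxx in t't.
  by rewrite (meets_overlap eh ex) /=; split=> //; rewrite mulrCA divff ?mulr1// gt_eqF.
split; first by split=> //; rewrite E.
move=> x xg ng; have [q [l ex]] := horo_at_exists x.
have E' := inside_center ex eg xg; subst q.
move: xg; rewrite (inside_finite ex eg) (meets_overlap eh ex) /= E ler_pM2l// => lt [_ tl].
have {}E : l = t by apply/eqP; rewrite eq_le lt.
by apply: ng; apply: (horo_at_inj ex); rewrite E.
Qed.
End Horocycles.

(** * Automorphisms of the graph of horocycles *)
Section HorocycleRigidity.
Variable R : realType.
Implicit Types (p q : S1 R) (h g x y : vertex (K_horo R)).

Section Automorphism.
Variable F : symm (vertex (K_horo R)).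
Hypothesis F_meets : forall h g, meets (F h) (F g) <-> meets h g.

Lemma inside_image h g : inside (F h) (F g) <-> inside h g.
Proof.
split=> H x; first by rewrite -F_meets -(F_meets x g); exact: H.
by rewrite -[x](symm_invK F) !F_meets; exact: H.
Qed.

Lemma tangent_image h g : tangent h g -> tangent (F h) (F g).
Proof.
move=> [hg H]; split=> [|x]; first by rewrite F_meets.
rewrite -[x](symm_invK F) inside_image F_meets => i n; apply: H => // E.
by apply: n; rewrite E.
Qed.

Lemma inside_total h g p (k l : R) : horo_at h p k -> horo_at g p l ->
  inside h g \/ inside g h.
Proof.
case: p => [a|] eh eg.
  by rewrite (inside_finite eh eg) (inside_finite eg eh); apply/orP; exact: le_total.
by rewrite (inside_infinity eh eg) (inside_infinity eg eh); apply/orP; exact: le_total.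
Qed.

Lemma center_image : exists c : S1 R -> S1 R, injective c /\
  forall h p k, horo_at h p k -> exists l, horo_at (F h) (c p) l.
Proof.
have [c cP] : exists c : S1 R -> S1 R, forall p h k, horo_at h p k ->
    exists l, horo_at (F h) (c p) l.
  suff /choice[c cP] : forall p, exists q, forall h k, horo_at h p k ->
      exists l, horo_at (F h) q l by exists c.
  move=> p; have [g eg] := horo_at_build p (@ltr01 R).
  have [q [l eg']] := horo_at_exists (F g); exists q => h k eh.
  have [r [l' eh']] := horo_at_exists (F h); exists l'.
  suff -> : q = r by [].
  have [/inside_image i|/inside_image i] := inside_total eh eg.
    by rewrite (inside_center eh' eg' i).
  by rewrite (inside_center eg' eh' i).
exists c; split=> [p q E|h p k]; last exact: cP.
have [h eh] := horo_at_build p (@ltr01 R); have [g eg] := horo_at_build q (@ltr01 R).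
have [k eh'] := cP _ _ _ eh; have [l eg'] := cP _ _ _ eg.
rewrite E in eh'.
have [/inside_image i|/inside_image i] := inside_total eh' eg'.
  exact: inside_center eh eg i.
by rewrite (inside_center eg eh i).
Qed.

Variable f : S1 R -> S1 R.
Hypothesis f_inj : injective f.
Hypothesis F_center : forall h p k, horo_at h p k -> exists l, horo_at (F h) (f p) l.
Hypothesis fN : f None = None.
Hypothesis f0 : f (Some 0) = Some 0.
Hypothesis f1 : f (Some 1) = Some 1.

(** The horocycle at height k is sent to height [s k], hence a horocycle of
    diameter k, being tangent to it, is sent to one of diameter [s k].
    Horocycles of equal diameter k are tangent when their centres are at
    distance k, so that the map [u] of the centres satisfies
    [`|u a - u b| = s `|a - b|].  As [s] is increasing, the largest of the
    distances between three points is sent to the largest; hence [s] is additive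
    and both [s] and [u] are the identity. *)
Lemma normalized_horo_id h : F h = h.
Proof.
have [u uP] : exists u : R -> R, forall a, f (Some a) = Some (u a).
  suff /choice[u uP] : forall a : R, exists b, f (Some a) = Some b by exists u.
  move=> a.
  case E : (f (Some a)) => [b|]; first by exists b.
  by have := f_inj (etrans E (esym fN)).
have [s sP] : exists s : R -> R, forall k g, horo_at g None k -> horo_at (F g) None (s k).
  suff /choice[s sP] : forall k : R, exists l, forall g, horo_at g None k ->
      horo_at (F g) None l by exists s.
  move=> k; have [k0|k0] := ltP 0 k; last first.
    by exists 0 => g [k0' _]; move: k0; rewrite leNgt k0'.
  have [g eg] := horo_at_build None k0; have [l] := F_center eg; rewrite fN => eg'.
  by exists l => g' /horo_at_inj/(_ eg) ->.
have sP' g a k : horo_at g (Some a) k -> horo_at (F g) (Some (u a)) (s k).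
  move=> eg; have [g' eg'] := horo_at_build None eg.1.
  have [l] := F_center eg; rewrite uP => Feg.
  have /tangent_image : tangent g g' by apply/(tangent_infinity eg eg').
  by rewrite (tangent_infinity Feg (sP _ _ eg')) => <-.
have s0 k : 0 < k -> 0 < s k.
  by move=> k0; have [g eg] := horo_at_build None k0; have [] := sP _ _ eg.
have dist a b : a != b -> `|u a - u b| = s `|a - b|.
  move=> ab; have d0 : 0 < `|a - b| by rewrite normr_gt0 subr_eq0.
  have [g eg] := horo_at_build (Some a) d0; have [g' eg'] := horo_at_build (Some b) d0.
  have /tangent_image : tangent g g'.
    by apply/(tangent_finite eg eg'); rewrite -expr2 real_normK ?num_real.
  rewrite (tangent_finite (sP' _ _ _ eg) (sP' _ _ _ eg')) -expr2 => -[_ E].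
  apply/eqP; rewrite -(@eqrXn2 _ 2)// ?normr_ge0 ?ltW ?s0//.
  by rewrite real_normK ?num_real// E.
have s_lt k l : 0 < k -> k < l -> s k < s l.
  move=> k0 kl; have l0 := lt_trans k0 kl.
  have [g eg] := horo_at_build None k0; have [g' eg'] := horo_at_build None l0.
  have : ~ inside (F g) (F g').
    by rewrite inside_image (inside_infinity eg eg') leNgt kl.
  by rewrite (inside_infinity (sP _ _ eg) (sP _ _ eg')) => /negP; rewrite -ltNge.
have u0 : u 0 = 0 by have := uP 0; rewrite f0 => -[].
have u1 : u 1 = 1 by have := uP 1; rewrite f1 => -[].
have sid : forall k, 0 < k -> s k = k.
  apply: additive_id => //; last first.
    by have := dist 1 0; rewrite u0 u1 !subr0 normr1 oner_eq0 => /(_ isT).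
  move=> a b a0 b0; have ab0 := addr_gt0 a0 b0.
  have := dist (a + b) 0; rewrite u0 !subr0 (gtr0_norm ab0) gt_eqF// => /(_ isT).
  have := dist a 0; rewrite u0 !subr0 (gtr0_norm a0) gt_eqF// => /(_ isT).
  have := dist (a + b) a; rewrite addrAC subrr add0r (gtr0_norm b0).
  rewrite -subr_eq0 addrAC subrr add0r gt_eqF// => /(_ isT).
  have := s_lt a (a + b) a0; have := s_lt b (a + b) b0.
  rewrite ltrDl ltrDr => /(_ a0) + /(_ b0).
  move: (u (a + b)) (u a) (s (a + b)) (s a) (s b) => U V S A B H1 H2 H3 H4 H5.
  (* the largest of three distances on a line is the sum of the others *)
  move: H3 H4 H5; case: (ger0P (U - V)); case: (ger0P V); case: (ger0P U); lra.
have uid a : u a = a.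
  have [->|a0] := eqVneq a 0; first exact: u0.
  have [->|a1] := eqVneq a 1; first exact: u1.
  have := dist _ _ a0; have := dist _ _ a1.
  rewrite u0 u1 !subr0 !sid ?normr_gt0// ?subr_eq0//.
  move=> /eqP; rewrite eqr_norm2 => /orP[/eqP|/eqP E /eqP].
    by move/addIr.
  rewrite eqr_norm2 => /orP[/eqP//|/eqP E'].
  by move/eqP: a0; lra.
have [[a|] [k eh]] := horo_at_exists h.
  have k0 := eh.1; have := sP' _ _ _ eh; rewrite uid sid// => eh'.
  exact: horo_at_inj eh' eh.
have k0 := eh.1; have := sP _ _ eh; rewrite sid// => eh'.
exact: horo_at_inj eh' eh.
Qed.
End Automorphism.

Lemma K_horo_rigid (a : Aut (K_horo R)) :
  exists2 phi, @isoms R phi & forall h, phi @` val (val a h) = val h.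
Proof.
have /set_mem/auts_meets aM := valP a.
have [c [c_inj cP]] := center_image aM.
have n01 : Some 0 <> Some 1 :> S1 R.
  by case=> /esym/eqP; rewrite oner_eq0.
have [|||phi [m [mob mN m0 m1]]] :=
    @moebius_normalize R (c None) (c (Some 0)) (c (Some 1)).
- by move/c_inj.
- by move/c_inj.
- by move/c_inj.
have iso : isoms phi by apply/isoms_delta/moebius_delta/mob.
exists phi => // h; have [F [FM FE]] := compose_isometry (@horocycles_moebius R) a iso.
rewrite -FE; congr val; apply: (@normalized_horo_id F FM (m \o c)) => //.
  exact: inj_comp (@symm_inj _ m) c_inj.
move=> {}h p k /cP[l [l0 E]].
have [l' l'0 H] := moebius_horo mob (c p) l0.
by exists l'; split=> //; rewrite FE E; exact: image_symm.
Qed.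

Lemma K_horo_automorphisms :
  exists i : {multiplicative Isom R -> Aut (K_horo R)},
    (forall (phi : Isom R) (h : vertex (K_horo R)),
       val (val (i phi) h) = [set val phi z | z in val h]) /\
    bijective i.
Proof.
exact: (isometry_automorphisms (@horocycles_moebius R)
  (@horocycles_separate R) K_horo_rigid).
Qed.
End HorocycleRigidity.

(** * Hypercycles: endpoints, connectedness, low arcs *)
Section Hypercycles.
Variable R : realType.
Implicit Types (p q r s : S1 R) (z w : H2 R) (A B : set (H2 R)).

Definition touch A B : Prop := exists z, A z /\ B z.

Lemma touchC A B : touch A B -> touch B A.
Proof. by move=> [z [Az Bz]]; exists z. Qed.

(** On a line through the origin, three points suffice to see that the equation
    of a circle does not hold identically. *)
Lemma hyper_inj p q r s (t u : R) : p <> q -> r <> s ->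
  hyper p q t = hyper r s u -> same_pair p q r s.
Proof.
move=> pq rs E.
have [k [kp kq]] := S1_third p q.
have [|||phi [m [mob mp mq _]]] := @moebius_normalize R p q k => //; try exact: nesym.
have [t2 _ Ht] := moebius_hyper mob t pq; have [u2 _ Hu] := moebius_hyper mob u rs.
suff : same_pair (m p) (m q) (m r) (m s).
  by case=> -[/(@symm_inj _ m) -> /(@symm_inj _ m) ->]; [left|right].
have H (y : R) (y0 : 0 < y) : hyper (m r) (m s) u2 (mkH2 (t2 * y) y0).
  by rewrite -[mkH2 _ _](symm_invK phi) -Hu -E Ht symm_invK mp mq /= subr0.
have := (H 1 ltr01, H 2 (ltr0Sn _ 1), H 3 (ltr0Sn _ 2)).
rewrite mp mq; case: (m r) (m s) => [a|] [b|] [[]] /=;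
  rewrite ?re_mk ?im_mk => E1 E2 E3; clear -E1 E2 E3.
- by exfalso; have := sqr_ge0 t2; lra.
- by right; split=> //; congr Some; lra.
- by left; split=> //; congr Some; lra.
- by [].
Qed.

(** The Möbius map that sends [u] to 0 and [v] to infinity sends the curve to
    a ray from 0; [k] is the position on this ray.  The displayed relation gives
    [re z / im z] as a function of [k]. *)
Lemma hyper_param (u v t : R) : u < v ->
  (forall k, 0 < k -> exists2 z, hyper (Some u) (Some v) t z &
    (v - u) * k * re z = (u - t * (u + v) * k + v * (1 + t ^+ 2) * k ^+ 2) * im z) /\
  (forall z, hyper (Some u) (Some v) t z -> exists2 k, 0 < k &
    (v - u) * k * re z = (u - t * (u + v) * k + v * (1 + t ^+ 2) * k ^+ 2) * im z).
Proof.
move=> uv; have uv0 : 0 < v - u by rewrite subr_gt0.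
split=> [k k0|z /= E].
  have N0 : 0 < (1 - k * t) ^+ 2 + k ^+ 2 by rewrite ltr_wpDl ?sqr_ge0// exprn_gt0.
  have y0 : 0 < (v - u) * k / ((1 - k * t) ^+ 2 + k ^+ 2) by rewrite divr_gt0// mulr_gt0.
  exists (mkH2 (((u - v * k * t) * (1 - k * t) + v * k ^+ 2) /
    ((1 - k * t) ^+ 2 + k ^+ 2)) y0) => /=; rewrite ?re_mk ?im_mk;
    by field; rewrite gt_eqF.
have y0 := im_gt0 z.
have D0 : 0 < (re z - v) ^+ 2 + im z ^+ 2 by rewrite ltr_wpDl ?sqr_ge0// exprn_gt0.
exists ((v - u) * im z / ((re z - v) ^+ 2 + im z ^+ 2)); first by rewrite divr_gt0// mulr_gt0.
have -> : t = ((re z - u) * (re z - v) + im z ^+ 2) / ((v - u) * im z).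
  by rewrite E; field; rewrite !gt_eqF.
by field; rewrite !gt_eqF.
Qed.

(** A hypercycle is connected: it cannot pass from one side of a ray from the
    origin to the other without meeting it.  In the parametrization
    [hyper_param], the side is the sign of a quadratic polynomial. *)
Lemma hyper_ivt p q (t l : R) z w : p <> q ->
  hyper p q t z -> hyper p q t w ->
  re z < l * im z -> l * im w < re w ->
  exists2 x, hyper p q t x & re x = l * im x.
Proof.
have line (a s y1 y2 : R) : 0 < y1 -> 0 < y2 -> a + s * y1 < l * y1 ->
    l * y2 < a + s * y2 -> exists2 y, 0 < y & a + s * y = l * y.
  move=> y10 y20 H1 H2.
  pose d1 := l * y1 - a - s * y1; pose d2 := a + s * y2 - l * y2.
  have d10 : 0 < d1 by rewrite /d1; lra.
  have d20 : 0 < d2 by rewrite /d2; lra.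
  have d0 : 0 < d1 + d2 by rewrite addr_gt0.
  exists ((y1 * d2 + y2 * d1) / (d1 + d2)).
    by rewrite divr_gt0// addr_gt0// mulr_gt0.
  have dn : d1 + d2 != 0 by rewrite gt_eqF.
  by move: dn; rewrite /d1 /d2 => dn; field.
have hline (a s : R) x y : hyper (None : S1 R) (Some a) s x -> hyper (None : S1 R) (Some a) s y ->
    re x < l * im x -> l * im y < re y ->
    exists2 c, hyper (None : S1 R) (Some a) s c & re c = l * im c.
  move=> /= hx hy rx ry; have ex : re x = a + s * im x by rewrite -hx; ring.
  have ey : re y = a + s * im y by rewrite -hy; ring.
  rewrite ex in rx; rewrite ey in ry.
  have [c c0 E] := line _ _ _ _ (im_gt0 x) (im_gt0 y) rx ry.
  by exists (mkH2 (l * c) c0) => //=; rewrite re_mk im_mk -E; ring.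
have hcirc (u v s : R) x y : u < v -> hyper (Some u : S1 R) (Some v) s x ->
    hyper (Some u : S1 R) (Some v) s y ->
    re x < l * im x -> l * im y < re y ->
    exists2 c, hyper (Some u : S1 R) (Some v) s c & re c = l * im c.
  move=> uv hx hy rx ry; have uv0 : 0 < v - u by rewrite subr_gt0.
  have [par par'] := hyper_param s uv.
  have [k1 k10 E1] := par' _ hx; have [k2 k20 E2] := par' _ hy.
  have x0 := im_gt0 x; have y0 := im_gt0 y.
  pose P k := u + (- s * (u + v) - l * (v - u)) * k + v * (1 + s ^+ 2) * k ^+ 2.
  have P1 : P k1 < 0.
    rewrite -(pmulr_llt0 _ x0).
    rewrite (_ : P k1 * im x = (v - u) * k1 * (re x - l * im x)); last first.
      by rewrite mulrBr E1 /P; ring.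
    by rewrite pmulr_rlt0 ?subr_lt0// mulr_gt0.
  have P2 : 0 < P k2.
    rewrite -(pmulr_lgt0 _ y0).
    rewrite (_ : P k2 * im y = (v - u) * k2 * (re y - l * im y)); last first.
      by rewrite mulrBr E2 /P; ring.
    by rewrite mulr_gt0 ?subr_gt0// mulr_gt0.
  have [k k0 Pk] : exists2 k, 0 < k & P k = 0.
    pose Q : {poly R} := u%:P + (- s * (u + v) - l * (v - u)) *: 'X + (v * (1 + s ^+ 2)) *: 'X^2.
    have QP k : Q.[k] = P k by rewrite /Q /P !hornerE; ring.
    have [k12|k21] := leP k1 k2.
      have [|k /andP[kk _]] := @poly_ivt _ Q _ _ k12; first by rewrite !QP !ltW.
      by rewrite /root QP => /eqP; exists k => //; exact: lt_le_trans kk.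
    have [|k /andP[kk _]] := @poly_ivt _ (- Q) _ _ (ltW k21).
      by rewrite !hornerN !QP oppr_le0 oppr_ge0 !ltW.
    by rewrite /root hornerN oppr_eq0 QP => /eqP; exists k => //; exact: lt_le_trans kk.
  have [c hc E] := par k k0; exists c => //.
  have n0 : (v - u) * k != 0 by rewrite gt_eqF// mulr_gt0.
  apply: (mulfI n0); rewrite E.
  have : P k * im c = 0 by rewrite Pk mul0r.
  by rewrite /P; lra.
case: p q => [u|] [v|] // pq; last exact: hline.
  have [uv|vu|E] := ltgtP u v; first exact: hcirc.
    by rewrite hyperC; exact: hcirc.
  by case: pq; rewrite E.
by rewrite hyperC; exact: hline.
Qed.

Lemma le0_small (a M N : R) :
  (forall y, 0 < y -> a <= M * y + N * y ^+ 2) -> a <= 0.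
Proof.
move=> H; rewrite leNgt; apply/negP => a0.
pose D := `|M| + `|N| + 1.
have D0 : 0 < D by rewrite ltr_wpDl// addr_ge0.
have aD0 : 0 < a + D by rewrite addr_gt0.
(* this y is at most 1, so that y^2 <= y, and D y < a *)
pose y := a / (a + D).
have y0 : 0 < y by rewrite divr_gt0.
have y1 : y <= 1 by rewrite ler_pdivrMr// mul1r lerDl ltW.
have yD : D * y < a by rewrite mulrA ltr_pdivrMr// mulrC ltr_pM2l// ltrDr.
have y2 : y ^+ 2 <= y by rewrite expr2 ler_piMl// ltW.
have MM : M * y <= `|M| * y by rewrite ler_pM2r// ler_norm.
have NN : N * y ^+ 2 <= `|N| * y.
  apply: (le_trans (_ : _ <= `|N| * y ^+ 2)).
    by rewrite ler_wpM2r ?sqr_ge0// ler_norm.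
  by rewrite ler_wpM2l.
by have := H y y0; move: yD; rewrite /D; lra.
Qed.

Lemma eq0_small (a s l K N : R) :
  (forall y, 0 < y -> s * y < a + K * y + N * y ^+ 2 < l * y) -> a = 0.
Proof.
move=> H; apply/eqP; rewrite eq_le -oppr_le0; apply/andP; split.
  by apply: (@le0_small _ (l - K) (- N)) => y /H/andP[]; lra.
by apply: (@le0_small _ (K - s) N) => y /H/andP[]; lra.
Qed.

(** In a sector bounded by two Euclidean rays from the origin there are no other
    hypercycles than rays: near a nonzero finite endpoint, the slope of the ray
    from the origin is unbounded. *)
Lemma hyper_in_sector p q (t s l : R) : p <> q ->
  (forall z, hyper p q t z -> s * im z < re z < l * im z) ->
  same_pair None (Some 0) p q.
Proof.
have hline (a k : R) : (forall z, hyper (None : S1 R) (Some a) k z -> s * im z < re z < l * im z) ->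
    a = 0.
  move=> H; apply: (@eq0_small _ s l k 0) => y y0.
  have := H (mkH2 (a + k * y) y0); rewrite /= re_mk im_mk mul0r addr0; apply; ring.
have hcirc (u v k : R) : u < v ->
    (forall z, hyper (Some u : S1 R) (Some v) k z -> s * im z < re z < l * im z) -> False.
  move=> uv H; have [par _] := hyper_param k uv.
  have uv0 : 0 < v - u by rewrite subr_gt0.
  have K y : 0 < y -> (v - u) * s * y < u + - k * (u + v) * y + v * (1 + k ^+ 2) * y ^+ 2 <
      (v - u) * l * y.
    move=> y0; have [z hz E] := par y y0; have z0 := im_gt0 z.
    have {}E : (u + - k * (u + v) * y + v * (1 + k ^+ 2) * y ^+ 2) * im z =
      (v - u) * y * re z by rewrite E; ring.
    rewrite -(ltr_pM2r z0) -[X in _ && X](ltr_pM2r z0) E.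
    have uvy : 0 < (v - u) * y by rewrite mulr_gt0.
    rewrite (_ : _ * s * y * _ = (v - u) * y * (s * im z)); last by ring.
    rewrite (_ : _ * l * y * _ = (v - u) * y * (l * im z)); last by ring.
    by rewrite !ltr_pM2l//; exact: H.
  have u0 : u = 0 := eq0_small K.
  have : v * (1 + k ^+ 2) = 0.
    apply: (@eq0_small _ ((v - u) * s) ((v - u) * l) (- k * (u + v)) u) => y y0.
    (* the behaviour at the other endpoint is that of k^-1 near 0 *)
    have y'0 : 0 < y^-1 by rewrite invr_gt0.
    have := K _ y'0; have y2 : 0 < y ^+ 2 by rewrite exprn_gt0.
    rewrite -(ltr_pM2r y2) -[X in _ && X](ltr_pM2r y2).
    have yn : y != 0 by rewrite gt_eqF.
    rewrite (_ : _ * s * _ * _ = (v - u) * s * y); last by field.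
    rewrite (_ : _ * l * _ * _ = (v - u) * l * y); last by field.
    by rewrite (_ : _ * y ^+ 2 = v * (1 + k ^+ 2) + - k * (u + v) * y + u * y ^+ 2)//; field.
  move=> /eqP; rewrite mulf_eq0 => /orP[/eqP v0|/eqP]; first by rewrite u0 v0 ltxx in uv.
  by have := sqr_ge0 k; lra.
case: p q => [u|] [v|] // pq H.
- exfalso; have [uv|vu|E] := ltgtP u v; first exact: hcirc uv H.
    by move: H; rewrite hyperC; exact: hcirc.
  by case: pq; rewrite E.
- by move: H; rewrite hyperC => /hline ->; right.
- by move: H => /hline ->; left.
Qed.

Lemma segment_away (c w u : R) : u < c \/ w < u ->
  exists2 d : R, 0 < d & forall x : R, c <= x <= w -> d <= `|x - u|.
Proof.
case=> H; [exists (c - u)|exists (u - w)]; rewrite ?subr_gt0// => x /andP[x1 x2].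
  by rewrite (le_trans _ (ler_norm _))//; lra.
by rewrite distrC (le_trans _ (ler_norm _))//; lra.
Qed.

Definition off_segment (c w : R) p : Prop :=
  if p is Some u then u < c \/ w < u else True.

(** A hypercycle approaches the real axis only near its endpoints: there, the
    product of the distances to the endpoints is at most [y (y + |A|)] for a
    constant A, where y is the height. *)
Lemma hyper_away (c w : R) p q (t : R) : p <> q -> off_segment c w p ->
  off_segment c w q ->
  exists2 e : R, 0 < e & forall z, hyper p q t z -> c <= re z <= w -> e <= im z.
Proof.
have hline (a k : R) : a < c \/ w < a -> exists2 e : R, 0 < e &
    forall z, hyper (None : S1 R) (Some a) k z -> c <= re z <= w -> e <= im z.
  move=> /segment_away[d d0 H]; have k0 : 0 < `|k| + 1 by rewrite ltr_wpDl.
  exists (d / (`|k| + 1)); first by rewrite divr_gt0.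
  move=> z /= hz /H; rewrite hz normrM (gtr0_norm (im_gt0 z)) ler_pdivrMr// => H'.
  by have := im_gt0 z; lra.
case: p q => [u|] [v|] // pq ou ov; last exact: hline.
  have [d1 d10 H1] := segment_away ou; have [d2 d20 H2] := segment_away ov.
  pose A := (v - u) * t; have A0 : 0 < 1 + `|A| by rewrite ltr_pwDl.
  have d0 : 0 < d1 * d2 by rewrite mulr_gt0.
  exists (Num.min 1 (d1 * d2 / (1 + `|A|))); first by rewrite lt_min ltr01 divr_gt0.
  move=> z /= hz cz; rewrite leNgt; apply/negP; rewrite lt_min => /andP[z1].
  rewrite ltr_pdivlMr// => z2; have z0 := im_gt0 z.
  have : d1 * d2 <= `|re z - u| * `|re z - v|.
    by apply: ler_pM; rewrite ?(ltW d10) ?(ltW d20) ?H1 ?H2.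
  rewrite -normrM (_ : (re z - u) * (re z - v) = im z * (A - im z)); last first.
    by move: hz; rewrite /A; lra.
  rewrite normrM (gtr0_norm z0) => H3.
  have H4 : `|A - im z| <= `|A| + im z by have := ler_normB A (im z); rewrite (gtr0_norm z0).
  have H5 : im z * `|A - im z| <= im z * (1 + `|A|).
    by rewrite ler_pM2l//; clear -H4 z1; lra.
  by clear -z2 H3 H5; lra.
by rewrite hyperC; exact: hline.
Qed.

(** A flat hypercycle over the segment from [c] to [w] stays below the height
    given by [hyper_away]. *)
Lemma low_hyper (c w : R) p q (t : R) : c < w -> p <> q -> off_segment c w p ->
  off_segment c w q -> exists2 T0 : R, 0 < T0 & forall T : R, T0 <= T ->
    ~ touch (hyper (Some c) (Some w) (- T)) (hyper p q t).
Proof.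
move=> cw pq op oq; have [e e0 H] := hyper_away t pq op oq.
have cw0 : 0 < w - c by rewrite subr_gt0.
clear op oq.
exists ((w - c) / e + 1); first by rewrite ltr_wpDl// ltW// divr_gt0.
move=> T TT [z [/= zn zh]]; have z0 := im_gt0 z; clear pq.
have T0 : 0 < T by apply: lt_le_trans TT; rewrite ltr_wpDl// ltW// divr_gt0.
have neg : (re z - c) * (re z - w) < 0.
  have : 0 < (w - c) * T * im z by rewrite !mulr_gt0.
  by have := exprn_gt0 2 z0; lra.
have [z1 z2] : c < re z /\ re z < w.
  by move: neg; rewrite mulr_lt0_iff => -[[? ?]|[? ?]]; split; lra.
have ez : e <= im z by apply: H => //; rewrite !ltW.
have : (w - c) * T * im z <= (w - c) * (w - c).
  have : (re z - c) * (w - re z) <= (w - c) * (w - c).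
    by apply: ler_pM; lra.
  by have := sqr_ge0 (im z); lra.
rewrite -mulrA ler_pM2l// leNgt => /negP; apply.
apply: lt_le_trans (_ : T * e <= _); last by rewrite ler_pM2l.
by rewrite -ltr_pdivrMr// (lt_le_trans _ TT)// ltrDl.
Qed.
End Hypercycles.

(** * Tripods of hypercycles *)
(** Disequalities are of no use to [lra], which fails on those between
    elements of a type without an order. *)
Ltac ineq := repeat match goal with H : ~ (@eq _ _ _) |- _ => clear H end; lra.

Section Tripods.
Variable R : realType.
Implicit Types (p q r s : S1 R) (z w : H2 R) (A B : set (H2 R)).

Lemma hypercycles_moebius (phi : symm (H2 R)) m : moebius phi m ->
  forall c, hypercycles c -> hypercycles (phi @` c).
Proof.
move=> mob c /hypercyclesE[p [q [t [pq t0 ->]]]]; apply/hypercyclesE.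
have [u u2 E] := moebius_hyper mob t pq.
exists (m p), (m q), u; split; last exact: image_symm.
  by move/(@symm_inj _ m).
move=> u0; apply: t0; apply/eqP; rewrite -sqrf_eq0 -u2 u0 expr0n //=.
Qed.

Lemma hypercycles_hyper p q (t : R) : p <> q -> t <> 0 ->
  hypercycles (hyper p q t).
Proof. by move=> pq t0; apply/hypercyclesE; exists p, q, t. Qed.

(** [A] and [B] are completed by a curve [J], disjoint from them, to a triple in
    which no curve separates the two others: each pair is joined by a curve
    ([N1], [N2], [N3]) that avoids the third one.  Between two disjoint
    hypercycles there is room for such a [J] unless they have the same
    endpoints. *)
Definition tripod A B : Prop := exists J N1 N2 N3,
  [/\ hypercycles J, hypercycles N1, hypercycles N2 & hypercycles N3] /\
  [/\ ~ touch J A /\ ~ touch J B,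
    [/\ ~ touch N1 J, touch N1 A & touch N1 B],
    [/\ ~ touch N2 A, touch N2 B & touch N2 J] &
    [/\ ~ touch N3 B, touch N3 A & touch N3 J]].

Lemma tripodC A B : tripod A B -> tripod B A.
Proof.
move=> [J [N1 [N2 [N3 [[hJ h1 h2 h3] [[JA JB] [? ? ?] [? ? ?] [? ? ?]]]]]]].
by exists J, N1, N3, N2; do !split.
Qed.

Lemma touch_image (phi : symm (H2 R)) A B :
  touch (phi @` A) (phi @` B) <-> touch A B.
Proof.
split=> [[_ [[z Az <-] [w Bw /(@symm_inj _ phi) E]]]|[z [Az Bz]]].
  by exists z; rewrite -{2}E.
by exists (phi z); split; exists z.
Qed.

Lemma image_symmK (phi : symm (H2 R)) A : symmV phi @` (phi @` A) = A.
Proof.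
rewrite image_comp (_ : _ \o _ = id) ?image_id//.
by apply/funext => z /=; rewrite symm_funK.
Qed.

Lemma tripod_image (phi : symm (H2 R)) A B : isoms phi ->
  tripod (phi @` A) (phi @` B) <-> tripod A B.
Proof.
have H (psi : symm (H2 R)) A' B' : isoms psi -> tripod A' B' -> tripod (psi @` A') (psi @` B').
  move=> iso [J [N1 [N2 [N3 [[hJ h1 h2 h3] K]]]]].
  exists (psi @` J), (psi @` N1), (psi @` N2), (psi @` N3).
  split; first by split; apply: (isoms_closed (@hypercycles_moebius) iso).
  by case: K => -[? ?] [? ? ?] [? ? ?] [? ? ?]; do !split; rewrite touch_image.
move=> iso; split; last exact: H.
by move=> /(H _ _ _ (isomsV iso)); rewrite !image_symmK.
Qed.

Lemma moebius_isoms (phi : symm (H2 R)) m : moebius phi m -> isoms phi.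
Proof. by move=> mob; apply/isoms_delta/moebius_delta/mob. Qed.

(** Normalize the endpoints to infinity and 0: the two hypercycles are rays from
    the origin.  The curve [J] lies in one of the three sectors that they bound.
    In an outer sector it is separated from one ray by the other; in the middle
    one it is itself a ray, by [hyper_in_sector], and separates the two rays. *)
Lemma same_ends_no_tripod p q (s t : R) : p <> q -> s <> t ->
  ~ tripod (hyper p q s) (hyper p q t).
Proof.
have ivt C (a : R) z w : hypercycles C -> C z -> C w -> re z < a * im z ->
    a * im w < re w -> touch C (hyper None (Some 0) a).
  move=> /hypercyclesE[k [l [b [kl _ ->]]]] Cz Cw H1 H2.
  have [x Cx E] := hyper_ivt kl Cz Cw H1 H2.
  by exists x; split=> //=; rewrite subr0.
have std (a b : R) : a < b -> ~ tripod (hyper None (Some 0) a) (hyper None (Some 0) b).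
  move=> ab [J [N1 [N2 [N3 [[hJ h1 h2 h3] [[JA JB] [n1J n1A n1B] [n2A n2B n2J] [n3B n3A n3J]]]]]]].
  have ray (c : R) z : hyper (None : S1 R) (Some 0) c z -> re z = c * im z.
    by rewrite /= subr0.
  have off C (c : R) z : ~ touch C (hyper None (Some 0) c) -> C z -> re z != c * im z.
    by move=> nt Cz; apply/eqP => E; apply: nt; exists z; split=> //=; rewrite subr0.
  have [z [n2z /ray Bz]] := n2B; have [z' [n2z' Jz']] := n2J.
  have [x [n3x /ray Ax]] := n3A; have [x' [n3x' Jx']] := n3J.
  have ltab y : a * im y < b * im y by rewrite ltr_pM2r// im_gt0.
  have above y : J y -> a * im y < re y.
    move=> Jy; rewrite lt_neqAle eq_sym (off _ _ _ JA Jy) leNgt; apply/negP => lt.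
    apply: n2A; apply: (ivt _ _ z' z) => //; last by rewrite Bz.
    rewrite lt_neqAle (off _ _ _ JA Jz') leNgt; apply/negP => lt'.
    by apply: JA; exact: (ivt _ _ y z').
  have below y : J y -> re y < b * im y.
    move=> Jy; rewrite lt_neqAle (off _ _ _ JB Jy) leNgt; apply/negP => lt.
    apply: n3B; apply: (ivt _ _ x x') => //; first by rewrite Ax.
    rewrite lt_neqAle eq_sym (off _ _ _ JB Jx') leNgt; apply/negP => lt'.
    by apply: JB; exact: (ivt _ _ x' y).
  have [k [l [c [kl c0 EJ]]]] := (hypercyclesE J).1 hJ.
  have [c' EJ'] : exists c', J = hyper None (Some 0) c'.
    have : same_pair None (Some 0) k l.
      by apply: (@hyper_in_sector _ _ _ c a b) => // y; rewrite -EJ => Jy; rewrite above ?below.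
    case=> -[Ek El]; rewrite EJ -Ek -El; first by exists c.
    by exists (- c); rewrite hyperC.
  have Jc : J (mkH2 c' (@ltr01 R)) by rewrite EJ' /= subr0 mulr1.
  have := (above _ Jc, below _ Jc); rewrite re_mk im_mk !mulr1 => -[ac cb].
  apply: n1J; have [y [n1y /ray Ay]] := n1A; have [y' [n1y' /ray By]] := n1B.
  rewrite EJ'; apply: (ivt _ _ y y') => //.
    by rewrite Ay ltr_pM2r// im_gt0.
  by rewrite By ltr_pM2r// im_gt0.
move=> pq st.
have [k [kp kq]] := S1_third p q.
have [|||phi [m [mob mp mq _]]] := @moebius_normalize R p q k => //; try exact: nesym.
rewrite -(tripod_image _ _ (moebius_isoms mob)).
have [s' _ Hs] := moebius_hyper mob s pq; have [t' _ Ht] := moebius_hyper mob t pq.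
rewrite (image_symm Hs) (image_symm Ht) mp mq.
have [st'|st'|E] := ltgtP s' t'; first exact: std.
  by move=> /tripodC; exact: std.
exfalso; pose z : H2 R := mkH2 s' (@ltr01 R).
have K : hyper (m p) (m q) s' (phi (symm_inv phi z)).
  by rewrite symm_invK mp mq /= subr0 mulr1.
have /= H1 := (Hs _).2 K; rewrite E in K; have /= H2 := (Ht _).2 K.
have z0 := im_gt0 (symm_inv phi z).
have zn : im (symm_inv phi z) != 0 by rewrite gt_eqF.
case: p q pq H1 H2 {mp mq Hs Ht K kp kq} => [u|] [v|] //= pq -> => [H|/mulIf|/mulIf].
- have uv : v - u != 0.
    by rewrite subr_eq0; apply/eqP => uv; apply: pq; rewrite uv.
  by apply: st; move: H => /(mulIf zn)/(mulfI uv).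
- by move=> /(_ zn) /oppr_inj.
- by move=> /(_ zn).
Qed.

Definition before (u : R) (v : S1 R) : bool :=
  if v is Some v' then u < v' else true.

(** The interval from 0 to [u] is bounded by endpoints of both curves.  The curve
    [J] is a flat arc over its middle third; [N1] is an arc from -1 to a point
    beyond [u], above [J]; [N2] and [N3] are flat arcs from the middle of the
    interval to the end of [N1] and to its origin. *)
Lemma tripod_std (u s t : R) v : 0 < u ->
  before u v ->
  tripod (hyper None (Some 0) s) (hyper (Some u) v t).
Proof.
move=> u0 uv.
have [w uw wv] : exists2 w : R, u < w & before w v.
  case: v uv => [v'|_]; last by exists (u + 1); rewrite // ltrDl.
  by rewrite /before => uv; exists ((u + v') / 2); lra.
pose A : set (H2 R) := hyper None (Some 0) s; pose B : set (H2 R) := hyper (Some u) v t.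
have uvn : Some u <> v by case: v uv {wv B} => // v' + [E]; rewrite /before E ltxx.
have N0 : (None : S1 R) <> Some 0 by [].
pose n1 : set (H2 R) := hyper (Some (-1)) (Some w) 1.
have nw : Some (-1) <> Some w :> S1 R by case; lra.
have low c d p q b : c < d -> p <> q -> off_segment c d p -> off_segment c d q ->
  exists2 T0 : R, 0 < T0 & forall T : R, T0 <= T ->
    ~ touch (hyper (Some c) (Some d) (- T)) (hyper p q b) := @low_hyper R c d p q b.
have [||||TA TA0 jA] := low (u / 3) (2 * u / 3) None (Some 0) s => //=; try lra.
have [||||TB TB0 jB] := low (u / 3) (2 * u / 3) (Some u) v t => //=; try lra.
  by case: v uv {uvn wv B} => //= v'; rewrite /before => uv; lra.
have [||||T1 T10 j1] := low (u / 3) (2 * u / 3) (Some (-1)) (Some w) 1 => //=; try lra.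
have [||||T2 T20 n2A] := low (u / 2) w None (Some 0) s => //=; try lra.
have [||||T3 T30 n3B] := low (-1) (u / 2) (Some u) v t => //=; try lra.
  by case: v uv {uvn wv B jB} => //= v'; rewrite /before => uv; lra.
have cross_outside (a b : R) : a < u -> u < b -> before b v ->
    cross (Some a) (Some b) (Some u) v.
  move=> au ub; have ab := lt_trans au ub; rewrite /before; case: (v) => [v'|] bv.
    by rewrite cross_fin//; left; rewrite au ub; split=> //; right.
  by rewrite cross_sym cross_swapl cross_inf; left.
pose T := TA + TB + T1.
have tn (x : R) : 0 < x -> - x <> 0 by ineq.
have T_gt0 : 0 < T by rewrite /T !addr_gt0.
exists (hyper (Some (u / 3)) (Some (2 * u / 3)) (- T)), n1,
  (hyper (Some (u / 2)) (Some w) (- T2)), (hyper (Some (-1)) (Some (u / 2)) (- T3)).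
split; first split; try apply: hypercycles_hyper; try (case; ineq); try exact: tn.
split.
- by split; [apply: jA|apply: jB]; rewrite /T; ineq.
- split; first by move=> /touchC; apply: j1; rewrite /T; ineq.
    apply: cross_hyper_meet => //; rewrite cross_sym cross_inf; ineq.
  by apply: cross_hyper_meet => //; apply: cross_outside => //; ineq.
- split; first exact: n2A.
    by apply: cross_hyper_meet; [case; ineq|apply: cross_outside => //; ineq].
  by apply: cross_hyper_meet; [case; ineq|rewrite cross_fin; ineq].
- split; first exact: n3B.
    by apply: cross_hyper_meet; [case; ineq|rewrite cross_sym cross_inf; ineq].
  by apply: cross_hyper_meet; [case; ineq|rewrite cross_fin; ineq].
Qed.

Lemma tripod_exists p q r s (t u : R) : p <> q -> r <> s ->
  ~ same_pair p q r s -> ~ cross p q r s -> tripod (hyper p q t) (hyper r s u).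
Proof.
have wlog_r p' q' r' s' (t' u' : R) : p' <> q' -> r' <> s' ->
    r' <> p' -> r' <> q' -> ~ cross p' q' r' s' ->
    (s' = p' \/ s' <> q') -> tripod (hyper p' q' t') (hyper r' s' u').
  move=> pq rs rp rq nc spq.
  have [|||phi [m [mob mp mq mr]]] := @moebius_normalize R p' q' r' => //; try exact: nesym.
  rewrite -(tripod_image _ _ (moebius_isoms mob)).
  have [t2 _ Ht] := moebius_hyper mob t' pq; have [u2 _ Hu] := moebius_hyper mob u' rs.
  rewrite (image_symm Ht) (image_symm Hu) mp mq mr.
  move: nc; rewrite -(moebius_cross mob) mp mq mr.
  case ms : (m s') => [c|] nc; last by apply: tripod_std.
  have c0 : c != 0.
    apply/eqP => c0; have sq : s' = q' by apply: (@symm_inj _ m); rewrite ms mq c0.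
    by case: spq => [sp|//]; apply: pq; rewrite -sp.
  have c1 : c != 1.
    by apply/eqP => c1; apply: rs; apply: (@symm_inj _ m); rewrite ms mr c1.
  have {c0} c0 : 0 < c.
    rewrite lt_neqAle eq_sym c0 leNgt; apply/negP => ?; apply: nc.
    by rewrite cross_inf; right.
  have [c1'|c1'|E] := ltgtP c 1; last by rewrite E eqxx in c1.
    by rewrite (hyperC (Some 1)); apply: tripod_std.
  exact: tripod_std.
move=> pq rs nsp nc.
have nc1 : ~ cross q p r s by rewrite cross_swapl.
have nc2 : ~ cross p q s r by rewrite cross_swapr.
have nc3 : ~ cross q p s r by rewrite cross_swapl cross_swapr.
have [rp|rp] := pselect (r = p).
  have sq : s <> q by move=> sq; apply: nsp; left.
  rewrite (hyperC r); apply: wlog_r => //; try exact: nesym.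
    by rewrite -rp; exact: nesym.
  by left.
have [rq|rq] := pselect (r = q).
  have sp : s <> p by move=> sp; apply: nsp; right.
  rewrite (hyperC r) (hyperC p); apply: wlog_r => //; try exact: nesym.
    by rewrite -rq; exact: nesym.
  by left.
have [sq|sq] := pselect (s = q).
  rewrite (hyperC p); apply: wlog_r => //; try exact: nesym.
  by left.
by apply: wlog_r => //; right.
Qed.
End Tripods.

(** * The circle map of an automorphism of the hypercycle graph *)
Section HypercycleGraph.
Variable R : realType.
Implicit Types (p q r s : S1 R) (g h j n : vertex (K_hyper R)).
Implicit Types (v w : vertex (K_geod R)).

Lemma hyper_nonempty p q (t : R) : p <> q -> exists z, hyper p q t z.
Proof.
move=> pq; have [k [kp kq]] := S1_third p q.
have [m [mp mq mk cm cm']] := normalize3 pq (nesym kp) (nesym kq).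
have [|z [Hz _]] := @cross_hyper_meet R p q k (symm_inv m (Some (-1))) t 0 pq.
  by rewrite cross_sym cross_swapl -cm symm_invK mp mq mk cross_sym cross_inf; left; lra.
by exists z.
Qed.

Lemma hyper_angle p q (t u : R) z : p <> q ->
  hyper p q t z -> hyper p q u z -> t = u.
Proof.
have zn : im z != 0 by rewrite gt_eqF// im_gt0.
case: p q => [a|] [b|] //= pq -> => [/(mulIf zn)|/(mulIf zn)|/(mulIf zn)] //.
  move=> H; have ab : b - a != 0.
    by rewrite subr_eq0; apply/eqP => ab; apply: pq; rewrite ab.
  exact: (mulfI ab).
exact: oppr_inj.
Qed.

(** The parameter is preserved up to sign, and different parameters give
    different curves, so the map of parameters is onto. *)
Lemma moebius_hyper_onto (phi : symm (H2 R)) m p q (u : R) : moebius phi m ->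
  p <> q -> exists2 t, t ^+ 2 = u ^+ 2 &
    forall z, hyper p q t z <-> hyper (m p) (m q) u (phi z).
Proof.
move=> mob pq; have [u1 /eqP + H1] := moebius_hyper mob u pq.
rewrite eqf_sqr => /orP[/eqP E|/eqP E1]; first by exists u => // z; rewrite H1 E.
have [u2 /eqP + H2] := moebius_hyper mob (- u) pq.
rewrite sqrrN eqf_sqr => /orP[/eqP E|/eqP E2].
  by exists (- u); [rewrite sqrrN|move=> z; rewrite H2 E].
have [z hz] := hyper_nonempty u pq.
have hz' : hyper p q (- u) z by rewrite H2 E2 -E1 -H1.
have E : u = - u := hyper_angle pq hz hz'.
by exists u => // y; rewrite H1 E1 -E.
Qed.

(** Together with [cross_hyper_meet], this makes linking visible in the graph:
    geodesics are linked when all hypercycles with their endpoints meet. *)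
Lemma disjoint_over p q r s : p <> q -> r <> s -> ~ same_pair p q r s ->
  ~ cross p q r s -> exists t u : R, [/\ t <> 0, u <> 0 &
    ~ touch (hyper p q t) (hyper r s u)].
Proof.
move=> pq rs nsp nc.
have [k [kp kq]] := S1_third p q.
have [|||phi [m [mob mp mq _]]] := @moebius_normalize R p q k => //; try exact: nesym.
suff [t [u [t0 u0 K]]] : exists t u : R, [/\ t <> 0, u <> 0 &
    ~ touch (hyper (m p) (m q) t) (hyper (m r) (m s) u)].
  have [t' t2 Ht] := moebius_hyper_onto t mob pq.
  have [u' u2 Hu] := moebius_hyper_onto u mob rs.
  have n0 (x y : R) : x ^+ 2 = y ^+ 2 -> y <> 0 -> x <> 0.
    move=> E yn x0; apply: yn; apply/eqP; rewrite -sqrf_eq0 -E x0 expr0n //=.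
  exists t', u'; split; [exact: n0 t0|exact: n0 u0|].
  by rewrite -(touch_image phi) (image_symm Ht) (image_symm Hu).
have {nsp} : ~ same_pair (m p) (m q) (m r) (m s).
  by move=> H; apply: nsp; case: H => -[/(@symm_inj _ m) -> /(@symm_inj _ m) ->]; [left|right].
move: nc; rewrite -(moebius_cross mob) mp mq.
have {rs} : m r <> m s by move/(@symm_inj _ m).
have one0 : 1 <> 0 :> R by apply/eqP; rewrite oner_eq0.
have line (b : R) : b != 0 ->
    ~ touch (hyper (None : S1 R) (Some 0) 1) (hyper (None : S1 R) (Some b) 1).
  by move=> /eqP b0 [z [/= H1 H2]]; apply: b0; lra.
clear -one0 line; case: (m r) (m s) => [a|] [b|] // ab nc nsp.
- have ba : b - a != 0 by rewrite subr_eq0; apply/eqP => E; apply: ab; rewrite E.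
  have ab0 : 0 <= a * b.
    rewrite leNgt; apply/negP; rewrite mulr_lt0_iff => H; apply: nc.
    by rewrite cross_inf; case: H => -[? ?]; [left|right].
  have abn : a + b != 0.
    apply/eqP => E; have bE : b = - a by lra.
    move: ab0; rewrite bE mulrN oppr_ge0 -expr2 => a2.
    have : a ^+ 2 == 0 by rewrite eq_le a2 sqr_ge0.
    by rewrite sqrf_eq0 => /eqP a0; move: ba; rewrite bE a0 !oppr0 addr0 eqxx.
  (* with this parameter, the linear term of the quadratic equation vanishes *)
  exists 1, (- ((a + b) / (b - a))); split=> //.
    by apply/eqP; rewrite oppr_eq0 mulf_neq0// invr_eq0.
  move=> [z [/= H1]]; have z0 := im_gt0 z; rewrite mulrN mulrCA divff// mulr1.
  rewrite (_ : re z = im z); last by clear -H1; lra.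
  by have := exprn_gt0 2 z0; clear -ab0; lra.
- exists 1, (- 1); split=> //; first by move/eqP; rewrite oppr_eq0 oner_eq0.
  rewrite (hyperC (Some a)) opprK; apply: line; apply/eqP => a0.
  by apply: nsp; right; rewrite a0.
- exists 1, 1; split=> //; apply: line; apply/eqP => b0.
  by apply: nsp; left; rewrite b0.
Qed.

Definition arc h p q (t : R) : Prop :=
  [/\ p <> q, t <> 0 & val h = hyper p q t].

Lemma arcC h p q (t : R) : arc h p q t -> arc h q p (- t).
Proof.
move=> [pq t0 E]; split; [exact: nesym| |by rewrite E hyperC].
by move/eqP; rewrite oppr_eq0 => /eqP.
Qed.

Lemma arc_exists h : exists p q t, arc h p q t.
Proof. by have /set_mem/hypercyclesE[p [q [t E]]] := valP h; exists p, q, t. Qed.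

Lemma vertex_build (c : set (H2 R)) : hypercycles c -> exists h, val h = c.
Proof. by move=> /mem_set H; exists (exist (fun c => c \in @hypercycles R) c H). Qed.

Lemma arc_build p q (t : R) : p <> q -> t <> 0 -> exists h, arc h p q t.
Proof. by move=> pq t0; have [h E] := vertex_build (hypercycles_hyper pq t0); exists h. Qed.

Lemma arc_inj h g p q (t : R) : arc h p q t -> arc g p q t -> h = g.
Proof. by move=> [_ _ E] [_ _ E']; apply: val_inj; rewrite E. Qed.

Lemma arc_ends h p q r s (t u : R) : arc h p q t -> arc h r s u -> same_pair p q r s.
Proof. by move=> [pq _ E] [rs _ E']; apply: (hyper_inj pq rs (t := t) (u := u)); rewrite -E. Qed.

Lemma arc_uniq h p q (t u : R) : arc h p q t -> arc h p q u -> t = u.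
Proof.
move=> [pq _ E] [_ _ E']; have [z hz] := hyper_nonempty t pq.
by apply: (hyper_angle pq hz); rewrite -E' E.
Qed.

Lemma adj_touch h g : adj h g <-> ~ touch (val h) (val g).
Proof.
split=> [[_ E] [z [hz gz]]|nt]; first by suff : set0 z by []; rewrite -E.
have [p [q [t [pq _ E]]]] := arc_exists h; have [z hz] := hyper_nonempty t pq.
split=> [hg|]; first by apply: nt; exists z; rewrite -hg E.
by rewrite -subset0 => x [hx gx]; apply: nt; exists x.
Qed.

Lemma nadj_touch h g : ~ adj h g <-> touch (val h) (val g).
Proof. by rewrite adj_touch; split=> [/contrapT|t]. Qed.

Definition graph_tripod h g : Prop := exists j n1 n2 n3,
  [/\ adj j h /\ adj j g, [/\ adj n1 j, ~ adj n1 h & ~ adj n1 g],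
    [/\ adj n2 h, ~ adj n2 g & ~ adj n2 j] &
    [/\ adj n3 g, ~ adj n3 h & ~ adj n3 j]].

Lemma graph_tripodE h g : graph_tripod h g <-> tripod (val h) (val g).
Proof.
have adjE (x y : vertex (K_hyper R)) : adj x y = (~ touch (val x) (val y)) by apply/propext/adj_touch.
have nadjE (x y : vertex (K_hyper R)) : (~ adj x y) = touch (val x) (val y) by apply/propext/nadj_touch.
split=> [[j [n1 [n2 [n3]]]]|[J [N1 [N2 [N3 [[hJ h1 h2 h3]]]]]]].
  rewrite !nadjE !adjE => H.
  exists (val j), (val n1), (val n2), (val n3); split=> //.
  by split; apply: set_mem; exact: valP.
have [j jE] := vertex_build hJ; have [n1 n1E] := vertex_build h1.
have [n2 n2E] := vertex_build h2; have [n3 n3E] := vertex_build h3.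
rewrite -jE -n1E -n2E -n3E => H; exists j, n1, n2, n3.
by rewrite !nadjE !adjE.
Qed.

(** Having the same endpoints is thus a property of the graph. *)
Lemma same_ends_iff h g p q r s (t u : R) : arc h p q t -> arc g r s u ->
  adj h g /\ ~ graph_tripod h g <-> h <> g /\ same_pair p q r s.
Proof.
move=> eh eg; have [[pq t0 Eh] [rs u0 Eg]] := (eh, eg).
split=> [[hg nt]|[hg sp]].
  split; first by move=> E; move: hg; rewrite E => /adj_irr.
  apply: contrapT => nsp; apply: nt; rewrite graph_tripodE Eh Eg.
  apply: tripod_exists => // c; move: hg; rewrite adj_touch Eh Eg; apply.
  exact: cross_hyper_meet.
have {rs u0} [u' eg'] : exists u', arc g p q u'.
  case: sp => -[pr qs]; first by exists u; rewrite pr qs.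
  by exists (- u); rewrite pr qs; exact: arcC.
have [_ _ Eg'] := eg'; rewrite graph_tripodE adj_touch Eh Eg'.
have tu : t <> u' by move=> E; apply: hg; rewrite -E in eg'; exact: arc_inj eh eg'.
split; last exact: same_ends_no_tripod.
by move=> [z [hz gz]]; apply: tu; exact: hyper_angle pq hz gz.
Qed.

Definition over h v : Prop := exists p q t, arc h p q t /\ ends v p q.

Lemma over_ends h v p q (t : R) : arc h p q t -> over h v <-> ends v p q.
Proof.
move=> eh; split=> [[r [s [u [eh' ev]]]]|ev]; last by exists p, q, t.
exact: (ends_same ev (arc_ends eh' eh)).
Qed.

Lemma over_build v : exists h, over h v.
Proof.
have [p [q ev]] := ends_exists v.
have [|h eh] := @arc_build p q 1 ev.1; first by apply/eqP; rewrite oner_eq0.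
by exists h, p, q, 1.
Qed.

Lemma over_exists h : exists v, over h v.
Proof.
have [p [q [t eh]]] := arc_exists h; have [pq _ _] := eh.
by have [v ev] := ends_build pq; exists v; rewrite (over_ends _ eh).
Qed.

Lemma over_inj h v w : over h v -> over h w -> v = w.
Proof.
have [p [q [t eh]]] := arc_exists h; rewrite !(over_ends _ eh); exact: ends_inj.
Qed.

Lemma over_same h g v : over h v ->
  over g v <-> (h = g \/ adj h g /\ ~ graph_tripod h g).
Proof.
have [p [q [t eh]]] := arc_exists h; have [r [s [u eg]]] := arc_exists g.
rewrite (over_ends _ eh) (over_ends _ eg) (same_ends_iff eh eg) => ev.
split=> [ev'|[E|[_ sp]]].
- by have [|] := pselect (h = g); [left|right; split=> //; exact: ends_uniq ev ev'].
- by rewrite -E in eg; apply: (ends_same ev); exact: arc_ends eh eg.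
- exact: ends_same ev sp.
Qed.

Lemma meets_over v w : meets v w <->
  v <> w /\ forall h g, over h v -> over g w -> ~ adj h g.
Proof.
have [p [q ev]] := ends_exists v; have [r [s ew]] := ends_exists w.
rewrite (meets_cross ev ew); split=> [c|[vw H]].
  split=> [E|h g]; first by move: c; rewrite -(meets_cross ev ew) E => -[].
  move=> [p' [q' [t [[pq' t0 Eh] ev']]]] [r' [s' [u [[rs' u0 Eg] ew']]]].
  rewrite nadj_touch Eh Eg; apply: cross_hyper_meet => //.
  by rewrite -(meets_cross ev' ew') (meets_cross ev ew).
apply: contrapT => nc.
have nsp : ~ same_pair p q r s.
  by move=> sp; apply: vw; exact: ends_inj (ends_same ev sp) ew.
have [t [u [t0 u0]]] := disjoint_over ev.1 ew.1 nsp nc.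
have [h eh] := arc_build ev.1 t0; have [g eg] := arc_build ew.1 u0.
have [_ _ <-] := eh; have [_ _ <-] := eg; rewrite -adj_touch; apply: H.
  by rewrite (over_ends _ eh).
by rewrite (over_ends _ eg).
Qed.

Lemma graph_tripod_image (F : symm (vertex (K_hyper R))) h g :
  (forall h g, adj (F h) (F g) <-> adj h g) ->
  graph_tripod h g -> graph_tripod (F h) (F g).
Proof.
move=> FA [j [n1 [n2 [n3 H]]]]; exists (F j), (F n1), (F n2), (F n3).
have FE (x y : vertex (K_hyper R)) : adj (F x) (F y) = adj x y by apply/propext/FA.
by rewrite !FE.
Qed.

Lemma adj_symmV (F : symm (vertex (K_hyper R))) :
  (forall h g, adj (F h) (F g) <-> adj h g) ->
  forall h g, adj (symmV F h) (symmV F g) <-> adj h g.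
Proof. by move=> FA h g; rewrite -FA /= !symm_invK. Qed.

Lemma geodesic_image (F : symm (vertex (K_hyper R))) :
  (forall h g, adj (F h) (F g) <-> adj h g) ->
  exists G : vertex (K_geod R) -> vertex (K_geod R),
    forall h v, over h v -> over (F h) (G v).
Proof.
move=> FA; suff /choice[G GP] : forall v, exists w, forall h, over h v -> over (F h) w.
  by exists G => h v; exact: GP.
move=> v; have [g og] := over_build v; have [w ow] := over_exists (F g).
exists w => h; rewrite (over_same _ og) (over_same _ ow) FA.
case=> [->|[gh nt]]; [by left|right; split=> //] => nt'; apply: nt.
by have := graph_tripod_image (adj_symmV FA) nt'; rewrite /= !symm_funK.
Qed.

(** Automorphisms permute the classes of hypercycles with the same endpoints.
    These classes are the geodesics, and by [meets_over] the induced permutation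
    is an automorphism of the graph of geodesics; so [circle_map] applies. *)
Lemma hyper_circle_map (F : symm (vertex (K_hyper R))) :
  (forall h g, adj (F h) (F g) <-> adj h g) ->
  exists f : symm (S1 R),
    (forall p q r s, cross (f p) (f q) (f r) (f s) <-> cross p q r s) /\
    forall h p q t, arc h p q t -> exists u, arc (F h) (f p) (f q) u.
Proof.
move=> FA; have FVA := adj_symmV FA.
have [G GP] := geodesic_image FA; have [G' GP'] := geodesic_image FVA.
have GK : cancel G G'.
  move=> v; have [h oh] := over_build v.
  by have := GP' _ _ (GP _ _ oh); rewrite /= symm_funK => oh'; exact: over_inj oh' oh.
have GK' : cancel G' G.
  move=> v; have [h oh] := over_build v.
  by have := GP _ _ (GP' _ _ oh); rewrite /= symm_invK => oh'; exact: over_inj oh' oh.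
have impl (F0 : symm (vertex (K_hyper R))) (H : symm (vertex (K_geod R))) v w :
    (forall h g, adj (F0 h) (F0 g) <-> adj h g) ->
    (forall h v, over h v -> over (F0 h) (H v)) -> meets (H v) (H w) -> meets v w.
  move=> F0A HP; rewrite !meets_over => -[vw K].
  split=> [E|h g oh og]; first by apply: vw; rewrite E.
  by rewrite -F0A; apply: K; exact: HP.
have [|f [fc fe]] := @circle_map R (Symm GK GK').
  move=> v w; split; first exact: (impl F (Symm GK GK')).
  move=> vw; apply: (impl (symmV F) (Symm GK' GK)) => //.
  by rewrite /= !GK.
exists f; split=> // h p q t eh; have [pq _ _] := eh.
have [v ev] := ends_build pq; have oh : over h v by rewrite (over_ends _ eh).
have [r [s [u [eh' ev']]]] := GP _ _ oh.
have /= [[<- <-]|[<- <-]] := ends_uniq ev' (fe _ _ _ ev); first by exists u.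
by exists (- u); exact: arcC.
Qed.
End HypercycleGraph.

(** * Lines against circles, and rigidity on the real line *)
Section LinesAndCircles.
Variable R : realType.
Implicit Types (a b c s t x u v : R).

Local Notation line a s := (hyper (None : S1 R) (Some a) s).
Local Notation circ u v t := (hyper (Some u : S1 R) (Some v) t).

(** The four criteria below are the solutions of a linear or quadratic
    equation for the height of a common point. *)
Lemma line_line a b s t : a < b -> ~ touch (line a s) (line b t) <-> s <= t.
Proof.
move=> ab; split=> [nt|st [z [/= H1 H2]]]; last first.
  have : s * im z <= t * im z by rewrite ler_pM2r// im_gt0.
  lra.
rewrite leNgt; apply/negP => ts; apply: nt.
have y0 : 0 < (b - a) / (s - t) by rewrite divr_gt0// subr_gt0.
exists (mkH2 (a + s * ((b - a) / (s - t))) y0) => /=; rewrite re_mk im_mk.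
have n0 : s - t != 0 by rewrite subr_eq0 gt_eqF.
by split; field.
Qed.

Lemma line_circ_left u v s t : u < v ->
  ~ touch (line u s) (circ u v t) <-> t + s <= 0.
Proof.
move=> uv; have uv0 : 0 < v - u by rewrite subr_gt0.
have s2 : 0 < 1 + s ^+ 2 by rewrite ltr_pwDl ?sqr_ge0.
split=> [nt|st [z [/= H1 H2]]]; last first.
  have z0 := im_gt0 z; have : 0 < (1 + s ^+ 2) * im z ^+ 2 by rewrite mulr_gt0// exprn_gt0.
  rewrite (_ : _ * _ = (v - u) * im z * (t + s)).
    by rewrite pmulr_rgt0 ?mulr_gt0// ltNge st.
  have E : re z - v = s * im z - (v - u) by lra.
  by move: H2; rewrite E H1; lra.
rewrite leNgt; apply/negP => st; apply: nt.
have y0 : 0 < (v - u) * (t + s) / (1 + s ^+ 2) by rewrite divr_gt0// mulr_gt0.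
exists (mkH2 (u + s * ((v - u) * (t + s) / (1 + s ^+ 2))) y0) => /=; rewrite re_mk im_mk.
have n0 : 1 + s ^+ 2 != 0 by rewrite gt_eqF.
by split; field.
Qed.

Lemma line_circ_right u v s t : u < v ->
  ~ touch (line v s) (circ u v t) <-> t <= s.
Proof.
move=> uv; have uv0 : 0 < v - u by rewrite subr_gt0.
have s2 : 0 < 1 + s ^+ 2 by rewrite ltr_pwDl ?sqr_ge0.
split=> [nt|st [z [/= H1 H2]]]; last first.
  have z0 := im_gt0 z; have : 0 < (1 + s ^+ 2) * im z ^+ 2 by rewrite mulr_gt0// exprn_gt0.
  rewrite (_ : _ * _ = (v - u) * im z * (t - s)).
    by rewrite pmulr_rgt0 ?mulr_gt0// subr_gt0 ltNge st.
  have E : re z - u = s * im z + (v - u) by lra.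
  by move: H2; rewrite E H1; lra.
rewrite leNgt; apply/negP => st; apply: nt.
have y0 : 0 < (v - u) * (t - s) / (1 + s ^+ 2) by rewrite divr_gt0// mulr_gt0// subr_gt0.
exists (mkH2 (v + s * ((v - u) * (t - s) / (1 + s ^+ 2))) y0) => /=; rewrite re_mk im_mk.
have n0 : 1 + s ^+ 2 != 0 by rewrite gt_eqF.
by split; field.
Qed.

Lemma line_circ_far x u v s : x < u -> u < v -> 0 < s ->
  ~ touch (line x s) (circ u v s) <-> s ^+ 2 * (v - u) < u - x.
Proof.
move=> xu uv s0; have uv0 : 0 < v - u by rewrite subr_gt0.
have s2 : 0 < 1 + s ^+ 2 by rewrite ltr_pwDl ?sqr_ge0.
have s2n : 1 + s ^+ 2 != 0 by rewrite gt_eqF.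
have vx : 0 < v - x by lra.
(* completing the square *)
have E z : re z - x = s * im z -> (re z - u) * (re z - v) + im z ^+ 2 - (v - u) * s * im z =
    ((1 + s ^+ 2) * im z - s * (v - x)) ^+ 2 / (1 + s ^+ 2) +
    (v - x) * (u - x - s ^+ 2 * (v - u)) / (1 + s ^+ 2).
  move=> H; have -> : re z = x + s * im z by rewrite -H; ring.
  by field.
split=> [nt|lt [z [H1 /= H2]]]; last first.
  have : 0 < (v - x) * (u - x - s ^+ 2 * (v - u)) / (1 + s ^+ 2).
    by rewrite divr_gt0// mulr_gt0// subr_gt0.
  have : 0 <= ((1 + s ^+ 2) * im z - s * (v - x)) ^+ 2 / (1 + s ^+ 2).
    by rewrite divr_ge0 ?sqr_ge0// ltW.
  by have := E z H1; lra.
rewrite ltNge; apply/negP => ge; apply: nt.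
pose d := (v - x) * (s ^+ 2 * (v - u) - (u - x)).
have d0 : 0 <= d by apply: mulr_ge0; [exact: ltW|rewrite subr_ge0].
have d2 := sqr_sqrtr d0.
have y0 : 0 < (s * (v - x) + Num.sqrt d) / (1 + s ^+ 2).
  by rewrite divr_gt0// ltr_pwDl ?sqrtr_ge0// mulr_gt0.
exists (mkH2 (x + s * ((s * (v - x) + Num.sqrt d) / (1 + s ^+ 2))) y0).
set z := mkH2 _ _; have H1 : re z - x = s * im z by rewrite re_mk im_mk; ring.
split=> //; apply/eqP => /=; rewrite -subr_eq0 E// im_mk; apply/eqP.
rewrite (_ : _ * _ - _ = Num.sqrt d); last by field.
by rewrite d2 /d; field.
Qed.
End LinesAndCircles.

Section NonzeroOrder.
Variable R : realType.

Lemma nonzero_between (a b : R) : a < b -> exists c, [/\ c != 0, a < c & c < b].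
Proof.
move=> ab; have [E|n0] := eqVneq ((a + b) / 2) 0; last first.
  by exists ((a + b) / 2); split=> //; lra.
(* if the midpoint is 0 then b is positive, and so is this point *)
by exists ((3 * b + a) / 4); split; [apply: lt0r_neq0; lra|lra|lra].
Qed.

(** If [f s < g s], a nonzero value [c = g r] strictly between them gives
    [s < r], hence [g s < f r <= g r = c], a contradiction. *)
Lemma order_rigid (f g : R -> R) :
  (forall s, s != 0 -> f s != 0) -> (forall s, s != 0 -> g s != 0) ->
  (forall s, s != 0 -> exists2 r, r != 0 & f r = s) ->
  (forall s, s != 0 -> exists2 r, r != 0 & g r = s) ->
  (forall s r, s != 0 -> r != 0 -> f s <= g r <-> s <= r) ->
  forall s, s != 0 -> f s = g s.
Proof.
move=> f0 g0 fsurj gsurj fg s s0; have fgs : f s <= g s by apply/fg.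
apply/eqP; rewrite eq_le fgs /= leNgt; apply/negP => lt.
have [c [c0 c1 c2]] := nonzero_between lt.
have [r r0 E] := gsurj c c0.
have sr : s <= r by rewrite -fg// E ltW.
have nrs : ~~ (r <= s).
  apply/negP => rs; have rsE : r = s by apply/eqP; rewrite eq_le rs.
  by move: c2; rewrite -E rsE ltxx.
have : ~~ (f r <= g s) by apply/negP; rewrite fg// => H; rewrite H in nrs.
have : f r <= g r by apply/fg.
by rewrite -ltNge E; lra.
Qed.
End NonzeroOrder.

(** Comparison with 0 and 1 shows that signs are preserved; then the order of
    two numbers of the same sign is that of betweenness with 0. *)
Lemma between_increasing (R : realType) (U : R -> R) :
  U 0 = 0 -> U 1 = 1 ->
  (forall a x b, (a < x /\ x < b) \/ (b < x /\ x < a) ->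
    (U a < U x /\ U x < U b) \/ (U b < U x /\ U x < U a)) ->
  forall a b, a < b -> U a < U b.
Proof.
move=> U0 U1 btw.
have pos x : 0 < x -> 0 < U x.
  move=> x0; have [x1|x1|->] := ltgtP x 1; last by rewrite U1.
    by have := btw 0 x 1; rewrite U0 U1; lra.
  by have := btw 0 1 x; rewrite U0 U1; lra.
have neg x : x < 0 -> U x < 0.
  by move=> x0; have := btw x 0 1; rewrite U0 U1; lra.
move=> a b ab; have [a0|a0|a0] := ltgtP a 0; last by rewrite a0 U0 pos// -a0.
  have [b0|b0|->] := ltgtP b 0; last by rewrite U0 neg.
    by have := neg b b0; have := btw a b 0; rewrite U0; lra.
  by rewrite (lt_trans (neg a a0))// pos.
have b0 := lt_trans a0 ab.
by have := pos a a0; have := btw 0 a b; rewrite U0; lra.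
Qed.

(** Two adjacent segments of equal length have images with a constant ratio [k].
    Four adjacent unit segments have images of lengths 1, k, k^2, k^3; grouped in
    pairs, they are two adjacent segments of equal length with images in the
    ratio k^2, so that [k = 1].  Then midpoints are preserved and the map is
    additive. *)
Lemma ratio_rigid (R : realType) (U : R -> R) : U 0 = 0 -> U 1 = 1 ->
  (forall a b, a < b -> U a < U b) ->
  (forall x h x' h', 0 < h -> 0 < h' ->
    (U (x + h) - U x) * (U (x' + 2 * h') - U (x' + h')) =
    (U (x' + h') - U x') * (U (x + 2 * h) - U (x + h))) ->
  forall x, U x = x.
Proof.
move=> U0 U1 Ui H.
pose k := U 2 - U 1.
have step x h : 0 < h -> U (x + 2 * h) - U (x + h) = k * (U (x + h) - U x).
  move=> h0; have := H x h 0 1 h0 ltr01; rewrite !add0r !mulr1 U0 U1 subr0 mul1r => <-.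
  by rewrite mulrC /k U1.
have k1 : k = 1.
  have k0 : 0 < k by rewrite subr_gt0 Ui// ltr1n.
  have E1 := step 0 1 ltr01; have E2 := step 1 1 ltr01; have E3 := step 2 1 ltr01.
  have E4 := step 0 2 (ltr0Sn _ 1).
  have e1 : 0 + 2 * 1 = 2 :> R by ring.
  have e2 : 0 + 1 = 1 :> R by ring.
  have e3 : 1 + 2 * 1 = 3 :> R by ring.
  have e4 : 1 + 1 = 2 :> R by ring.
  have e5 : 2 + 2 * 1 = 4 :> R by ring.
  have e6 : 2 + 1 = 3 :> R by ring.
  have e7 : 0 + 2 * 2 = 4 :> R by ring.
  have e8 : 0 + 2 = 2 :> R by ring.
  move: E1 E2 E3 E4; rewrite e1 e2 e3 e4 e5 e6 e7 e8 U0 U1 => E1 E2 E3 E4.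
  have F2 : U 2 = 1 + k by rewrite /k U1; ring.
  have F3 : U 3 = 1 + k + k ^+ 2 by rewrite -F2; move: E2; rewrite F2; lra.
  have F4 : U 4 = 1 + k + k ^+ 2 + k ^+ 3 by move: E3; rewrite F3 F2; lra.
  have : k * (1 + k) * (k - 1) = 0 by move: E4; rewrite F4 F2; lra.
  move=> /eqP; rewrite !mulf_eq0 (gt_eqF k0) subr_eq0 /= => /orP[/eqP|/eqP//].
  by lra.
have mid x y : x < y -> U y + U x = 2 * U ((x + y) / 2).
  move=> xy; have h0 : 0 < (y - x) / 2 by lra.
  have := step x _ h0; rewrite k1 mul1r.
  have -> : x + 2 * ((y - x) / 2) = y by field.
  have -> : x + (y - x) / 2 = (x + y) / 2 by field.
  by lra.
have UD a b : 0 < a -> 0 < b -> U (a + b) = U a + U b.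
  move=> a0 b0; have := mid 0 (a + b); rewrite U0 add0r addr0 => -> //; last by lra.
  have [ab|ab|->] := ltgtP a b.
  - by rewrite -mid// addrC.
  - by rewrite addrC -mid.
  - by have -> : (b + b) / 2 = b by [field]; ring.
have Upos x : 0 < x -> U x = x.
  by apply: additive_id => // a a0; rewrite -U0 Ui.
move=> x; have [x0|x0|->] := ltgtP x 0; [|exact: Upos|exact: U0].
have nx : 0 < - x by rewrite oppr_gt0.
have := mid x (- x); rewrite subrr mul0r U0 (Upos _ nx) => H'.
have : x < - x by lra.
by move=> /H'; lra.
Qed.

(** * Automorphisms of the graph of hypercycles *)
Section HypercycleRigidity.
Variable R : realType.
Implicit Types (p q r : S1 R) (h g : vertex (K_hyper R)).

Section Normalized.
Variable F : symm (vertex (K_hyper R)).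
Hypothesis F_adj : forall h g, adj (F h) (F g) <-> adj h g.
Variable f : symm (S1 R).
Hypothesis f_cross : forall p q r s,
  cross (f p) (f q) (f r) (f s) <-> cross p q r s.
Hypothesis F_ends : forall h p q (t : R), arc h p q t ->
  exists u, arc (F h) (f p) (f q) u.
Hypothesis fN : f None = None.
Hypothesis f0 : f (Some 0) = Some 0.
Hypothesis f1 : f (Some 1) = Some 1.

Lemma angle_map : exists Phi : S1 R -> S1 R -> R -> R,
  [/\ forall h p q t, arc h p q t -> arc (F h) (f p) (f q) (Phi p q t),
    forall p q (t : R), p <> q -> t != 0 -> Phi p q t != 0 &
    forall p q (t : R), p <> q -> t != 0 -> exists2 s : R, s != 0 & Phi p q s = t].
Proof.
have [Phi PhiP] : exists Phi : S1 R * S1 R * R -> R, forall x h,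
    arc h x.1.1 x.1.2 x.2 -> arc (F h) (f x.1.1) (f x.1.2) (Phi x).
  suff /choice[Phi PhiP] : forall x : S1 R * S1 R * R, exists u, forall h,
      arc h x.1.1 x.1.2 x.2 -> arc (F h) (f x.1.1) (f x.1.2) u by exists Phi.
  move=> [[p q] t] /=; have [[h eh]|nex] := pselect (exists h, arc h p q t).
    have [u eu] := F_ends eh; exists u => h' eh'.
    by rewrite (arc_inj eh' eh).
  by exists 0 => h eh; case: nex; exists h.
exists (fun p q t => Phi (p, q, t)); split=> [h p q t|p q t pq t0|p q t pq t0].
- exact: (PhiP (p, q, t)).
- have [h eh] := arc_build pq (elimN eqP t0).
  by have [_ /eqP] := PhiP (p, q, t) h eh.
- have fpq : f p <> f q by move/(@symm_inj _ f).
  have [g eg] := arc_build fpq (elimN eqP t0).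
  have [p' [q' [s eh]]] := arc_exists (symm_inv F g).
  have [s' eh'] : exists s', arc (symm_inv F g) p q s'.
    have [u eu] := F_ends eh; rewrite symm_invK in eu.
    case: (arc_ends eu eg) => -[/(@symm_inj _ f) <- /(@symm_inj _ f) <-]; first by exists s.
    by exists (- s); exact: arcC.
  exists s'; first by apply/eqP; case: eh'.
  have := PhiP (p, q, s') _ eh'; rewrite symm_invK => eg'.
  exact: arc_uniq eg' eg.
Qed.

(** The circle map is an increasing map [U] of the line.  The criterion
    [line_line] shows that the parameter of a hypercycle ending at infinity is
    changed by a monotone function [phi] which does not depend on its finite
    endpoint.
    Comparing circles with the lines through their endpoints, by
    [line_circ_left] and [line_circ_right], shows that the parameter of any
    hypercycle is changed by the same [phi], and that [phi] is odd.  Finally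
    [line_circ_far], for lines and circles with equal parameters, recovers the
    ratio of the adjacent segments [x u] and [u v], so that [U] preserves
    equality of ratios and is the identity by [ratio_rigid]; the same criterion
    then gives back the parameter. *)
Lemma normalized_hyper_id h : F h = h.
Proof.
have [Phi [PhiP Phi0 Phi_onto]] := angle_map.
have [U UP] : exists U : R -> R, forall a : R, f (Some a) = Some (U a).
  suff /choice[U UP] : forall a : R, exists b, f (Some a) = Some b by exists U.
  move=> a; case E : (f (Some a)) => [b|]; first by exists b.
  by have := @symm_inj _ f _ _ (etrans E (esym fN)).
have U0 : U 0 = 0 by have := UP 0; rewrite f0 => -[].
have U1 : U 1 = 1 by have := UP 1; rewrite f1 => -[].
have Uinc : forall a b, a < b -> U a < U b.
  apply: between_increasing => // a x b; rewrite -!cross_inf.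
  by rewrite -f_cross fN !UP.
have Ulem a b : a < b -> 0 < U b - U a by move=> /Uinc; rewrite subr_gt0.
have touchF p q r s (t u : R) : p <> q -> r <> s -> t != 0 -> u != 0 ->
    ~ touch (hyper (f p) (f q) (Phi p q t)) (hyper (f r) (f s) (Phi r s u)) <->
    ~ touch (hyper p q t) (hyper r s u).
  move=> pq rs /eqP t0 /eqP u0; have [g eg] := arc_build pq t0.
  have [g' eg'] := arc_build rs u0.
  have [_ _ <-] := PhiP _ _ _ _ eg; have [_ _ <-] := PhiP _ _ _ _ eg'.
  by have [_ _ <-] := eg; have [_ _ <-] := eg'; rewrite -!adj_touch.
have Nn (a : R) : (None : S1 R) <> Some a by [].
have lt_neq (a b : R) : a < b -> Some a <> Some b :> S1 R.
  by move=> ab [E]; rewrite E ltxx in ab.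
pose L a t := Phi None (Some a) t.
have L_le a b t u : a < b -> t != 0 -> u != 0 -> L a t <= L b u <-> t <= u.
  move=> ab t0 u0; rewrite -(line_line _ _ (Uinc _ _ ab)) -!UP -{1 2}fN touchF//.
  exact: line_line.
pose phi t := L 0 t.
have phi0 t : t != 0 -> phi t != 0 by exact: Phi0.
have L_eq a b t : a < b -> t != 0 -> L a t = L b t.
  move=> ab; apply: order_rigid => //; try by move=> ?; [exact: Phi0|exact: Phi_onto].
  - by move=> s s0; exact: Phi0.
  - by move=> s s0; exact: Phi0.
  - by move=> s s0; exact: Phi_onto.
  - by move=> s s0; exact: Phi_onto.
  - by move=> s r s0 r0; exact: L_le.
have Lphi a t : t != 0 -> L a t = phi t.
  by move=> t0; have [a0|a0|->] := ltgtP a 0; rewrite // /phi; [|symmetry]; exact: L_eq.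
have phi_le t u : t != 0 -> u != 0 -> phi t <= phi u <-> t <= u.
  by move=> t0 u0; rewrite -(Lphi 0 t t0) -(Lphi 1 u u0); exact: L_le.
have phi_onto t : t != 0 -> exists2 s, s != 0 & phi s = t by exact: Phi_onto.
have same (a b : R) : a != 0 -> b != 0 ->
    (forall s, s != 0 -> phi s <= a <-> phi s <= b) -> a = b.
  move=> a0 b0 H; have [s s0 E] := phi_onto a a0; have [r r0 E'] := phi_onto b b0.
  by apply/eqP; rewrite eq_le -{1}E (H s s0).1 ?E//= -{1}E' (H r r0).2 ?E'.
have Cleft u v t : u < v -> t != 0 -> - Phi (Some u) (Some v) t = phi (- t).
  move=> uv t0; have uv' := lt_neq _ _ uv; have nt : - t != 0 by rewrite oppr_eq0.
  apply: same; [by rewrite oppr_eq0; exact: Phi0|exact: phi0|move=> s s0].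
  rewrite phi_le// -(Lphi u s s0).
  have := touchF None (Some u) (Some u) (Some v) s t (Nn _) uv' s0 t0.
  rewrite fN !UP (line_circ_left _ _ (Uinc _ _ uv)) (line_circ_left _ _ uv) => H.
  have neg (x y : R) : (x <= - y) = (y + x <= 0) by apply/idP/idP => ?; lra.
  by rewrite !neg.
have Cright u v t : u < v -> t != 0 -> Phi (Some u) (Some v) t = phi t.
  move=> uv t0; have uv' := lt_neq _ _ uv.
  have nle (x y : R) : x != 0 -> y != 0 -> (forall s, s != 0 -> x <= phi s <-> y <= phi s) -> x = y.
    move=> x0 y0 H; have [s s0 E] := phi_onto x x0; have [r r0 E'] := phi_onto y y0.
    apply/eqP; rewrite eq_le; apply/andP; split.
      by rewrite -E'; apply/(H r r0); rewrite E'.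
    by rewrite -E; apply/(H s s0); rewrite E.
  apply: nle; [exact: Phi0|exact: phi0|move=> s s0].
  rewrite phi_le// -(Lphi v s s0).
  have := touchF None (Some v) (Some u) (Some v) s t (Nn _) uv' s0 t0.
  by rewrite fN !UP (line_circ_right _ _ (Uinc _ _ uv)) (line_circ_right _ _ uv).
have phiN t : t != 0 -> phi (- t) = - phi t.
  by move=> t0; rewrite -(Cleft 0 1 t ltr01 t0) Cright.
have phi_gt0 t : 0 < t -> 0 < phi t.
  move=> t0; have tn := lt0r_neq0 t0; have tn' : - t != 0 by rewrite oppr_eq0.
  have : ~~ (phi t <= phi (- t)) by apply/negP; rewrite phi_le//; lra.
  by rewrite phiN// -ltNge; lra.
have far (x u v s : R) : x < u -> u < v -> 0 < s ->
    phi s ^+ 2 * (U v - U u) < U u - U x <-> s ^+ 2 * (v - u) < u - x.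
  move=> xu uv s0; have sn := lt0r_neq0 s0; have uv' := lt_neq _ _ uv.
  rewrite -(line_circ_far xu uv s0).
  rewrite -(line_circ_far (Uinc _ _ xu) (Uinc _ _ uv) (phi_gt0 s s0)).
  have := touchF None (Some x) (Some u) (Some v) s s (Nn _) uv' sn sn.
  by rewrite fN !UP Cright// -/(L x s) Lphi.
have phi_sqr (c : R) : 0 < c -> exists2 s : R, 0 < s & phi s ^+ 2 = c.
  move=> c0; have rc0 : 0 < Num.sqrt c by rewrite sqrtr_gt0.
  have [s s0 E] := phi_onto _ (lt0r_neq0 rc0).
  exists s; last by rewrite E sqr_sqrtr// ltW.
  rewrite ltNge; apply/negP => sle; have sn : 0 < - s by rewrite oppr_gt0 lt_neqAle s0.
  by have := phi_gt0 _ sn; rewrite phiN// E; lra.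
(* if the ratios differ, [far] at the parameter s for which phi s ^+ 2 is the
   smaller one tells the two pairs of segments apart *)
have ratio (x l x' k : R) : 0 < l -> 0 < k ->
    ~ (U (x + l) - U x) * (U (x' + 2 * k) - U (x' + k)) <
      (U (x' + k) - U x') * (U (x + 2 * l) - U (x + l)).
  move=> h0 k0 lt.
  have [A0 B0] : 0 < U (x + l) - U x /\ 0 < U (x + 2 * l) - U (x + l).
    by split; apply: Ulem; lra.
  have [A'0 B'0] : 0 < U (x' + k) - U x' /\ 0 < U (x' + 2 * k) - U (x' + k).
    by split; apply: Ulem; lra.
  have [s s0 E] := phi_sqr _ (divr_gt0 A0 B0).
  have H1 := far x (x + l) (x + 2 * l) s; have H2 := far x' (x' + k) (x' + 2 * k) s.
  have : s ^+ 2 * (x' + 2 * k - (x' + k)) < x' + k - x'.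
    apply/H2 => //; try lra.
    by rewrite E mulrAC ltr_pdivrMr.
  have : ~ s ^+ 2 * (x + 2 * l - (x + l)) < x + l - x.
    by rewrite -H1//; [rewrite E divfK ?gt_eqF// ltxx|lra|lra].
  rewrite (_ : x' + 2 * k - _ = k); last by ring.
  rewrite (_ : x' + k - x' = k); last by ring.
  rewrite (_ : x + 2 * l - _ = l); last by ring.
  rewrite (_ : x + l - x = l); last by ring.
  by rewrite gtr_pMl// gtr_pMl.
have Uid : forall x, U x = x.
  apply: ratio_rigid => // x l x' k h0 k0; apply/eqP; rewrite eq_le.
  by apply/andP; split; rewrite leNgt; apply/negP; [exact: ratio|exact: ratio].
have phi_id_pos s : 0 < s -> phi s = s.
  move=> s0; have p0 := phi_gt0 s s0.
  have key c : 0 < c -> phi s ^+ 2 < c <-> s ^+ 2 < c.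
    move=> c0; have := far 0 c (c + 1) s c0 _ s0; rewrite ltrDl ltr01 => /(_ isT).
    by rewrite !Uid addrAC subrr add0r subr0 !mulr1.
  apply/eqP; rewrite -(@eqrXn2 _ 2)// ?ltW//; apply/eqP.
  have := key (s ^+ 2) (exprn_gt0 _ s0); have := key (phi s ^+ 2) (exprn_gt0 _ p0).
  rewrite !ltxx => H1 H2; apply/eqP; rewrite eq_le !leNgt.
  by apply/andP; split; apply/negP => H; [have := H1.2 H|have := H2.1 H].
have phi_id s : s != 0 -> phi s = s.
  move=> s0; have [sn|sp|E] := ltgtP s 0; [|exact: phi_id_pos|by rewrite E eqxx in s0].
  by rewrite -[s]opprK phiN ?oppr_eq0// phi_id_pos ?oppr_gt0.
have fid p : f p = p by case: p => [a|//]; rewrite UP Uid.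
have [p [q [t eh]]] := arc_exists h; have [pq /eqP t0 _] := eh.
wlog std : p q t eh pq t0 / (p = None) \/ (exists u v, [/\ p = Some u, q = Some v & u < v]).
  move=> W; have nt : - t != 0 by rewrite oppr_eq0.
  have W1 := W _ _ _ eh pq t0; have W2 := W _ _ _ (arcC eh) (nesym pq) nt.
  case: p q pq {W eh} W1 W2 => [u|] [v|] // pq W1 W2; try by [apply: W1; left|apply: W2; left].
  have [uv|vu|E] := ltgtP u v; last by case: pq; rewrite E.
    by apply: W1; right; exists u, v.
  by apply: W2; right; exists v, u.
have := PhiP _ _ _ _ eh; rewrite !fid => eF; apply: arc_inj eh; move: eF.
case: std => [E|[u [v [E E' uv]]]]; subst p; last by subst q; rewrite Cright// phi_id.
by case: q pq => [a|//] _; rewrite -/(L a t) Lphi// phi_id.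
Qed.
End Normalized.

(** Two lines of different slopes meet in one point. *)
Lemma hypercycles_separate (z w : H2 R) :
  (forall c, hypercycles c -> c z -> c w) -> z = w.
Proof.
move=> H; have n1 : 1 <> 0 :> R by apply/eqP; rewrite oner_eq0.
have n1' : - 1 <> 0 :> R by apply/eqP; rewrite oppr_eq0 oner_eq0.
have K (s : R) : s <> 0 -> hyper None (Some (re z - s * im z)) s w.
  by move=> s0; apply: H; [exact: hypercycles_hyper|rewrite /=; ring].
have /= := (K 1 n1, K (-1) n1'); clear -R => -[H1 H2].
by apply: H2_eq; lra.
Qed.

Lemma K_hyper_rigid (a : Aut (K_hyper R)) :
  exists2 phi, @isoms R phi & forall h, phi @` val (val a h) = val h.
Proof.
have aM := set_mem (valP a).
have aA h g : adj (val a h) (val a g) <-> adj h g by apply: iff_sym; exact: aM.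
have [c [cc cP]] := hyper_circle_map aA.
have n01 : Some 0 <> Some 1 :> S1 R.
  by case=> /esym/eqP; rewrite oner_eq0.
have [|||phi [m [mob mN m0 m1]]] :=
    @moebius_normalize R (c None) (c (Some 0)) (c (Some 1)).
- by move/(@symm_inj _ c).
- by move/(@symm_inj _ c).
- by move/(@symm_inj _ c).
have iso := moebius_isoms mob.
exists phi => // h; have [F [FM FE]] := compose_isometry (@hypercycles_moebius R) a iso.
have FA (g g' : vertex (K_hyper R)) : adj (F g) (F g') <-> adj g g'.
  have FE' (k : vertex (K_hyper R)) : val (F k) = phi @` val (val a k) := FE k.
  apply: iff_trans (adj_touch (F g) (F g')) _; rewrite !FE' touch_image.
  exact: (iff_trans (iff_sym (adj_touch (val a g) (val a g'))) (aA g g')).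
rewrite -FE; congr val; apply: (@normalized_hyper_id F FA (symmM m c)) => //=.
- by move=> p q r s; rewrite (moebius_cross mob) cc.
move=> {}h p q t /cP[u [pq u0 E]].
have [v v2 H] := moebius_hyper mob u pq.
exists v; split; first by move/(@symm_inj _ m).
  by move=> v0; apply: u0; apply/eqP; rewrite -sqrf_eq0 -v2 v0 expr0n.
by rewrite FE E; exact: image_symm.
Qed.

Lemma K_hyper_automorphisms :
  exists i : {multiplicative Isom R -> Aut (K_hyper R)},
    (forall (phi : Isom R) (h : vertex (K_hyper R)),
       val (val (i phi) h) = [set val phi z | z in val h]) /\
    bijective i.
Proof.
exact: (isometry_automorphisms (@hypercycles_moebius R)
  hypercycles_separate K_hyper_rigid).
Qed.
End HypercycleRigidity.

Theorem theorem3 (R : realType) :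
  (exists i : {multiplicative Homeo (S1 R) -> Aut (K_geod R)},
     [/\ forall (f : Homeo (S1 R)) (g : vertex (K_geod R)) (x y : S1 R),
           x <> y -> val g = geodesic x y ->
           val (val (i f) g) = geodesic (val f x) (val f y),
         bijective i
       & forall a : Aut (K_geod R),
           exists f : Homeo (S1 R), link_preserving (val f) /\ i f = a]) /\
  (exists i : {multiplicative Isom R -> Aut (K_horo R)},
     (forall (phi : Isom R) (h : vertex (K_horo R)),
        val (val (i phi) h) = [set val phi z | z in val h]) /\
     bijective i) /\
  (exists i : {multiplicative Isom R -> Aut (K_hyper R)},
     (forall (phi : Isom R) (h : vertex (K_hyper R)),
        val (val (i phi) h) = [set val phi z | z in val h]) /\
     bijective i).
Proof.
split; first exact: K_geod_automorphisms.
by split; [exact: K_horo_automorphisms|exact: K_hyper_automorphisms].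
Qed.
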